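(* Let $n\geq 3$ and let $o$ denote the origin of $\mathbb{C}^n$. There exist an open neighborhood $U$ of $o$ in $\mathbb{C}^n$, a plurisubharmonic function $\varphi$ on $U$, and a smooth divisor $D$ in $U$ with $\varphi|_D\not\equiv-\infty$, such that for every real number $\alpha>1$ the analytic adjoint ideal sheaf $Adj^{\alpha}_{D}(\varphi)\subset\mathcal{O}_U$ associated to $\varphi$ along $D$ is not coherent near $o$; that is, there is no open neighborhood $V\subset U$ of $o$ such that the restriction $Adj^{\alpha}_{D}(\varphi)|_V$ is a coherent sheaf of $\mathcal{O}_V$-modules.
   Context: Let $X$ be a complex manifold with structure sheaf $\mathcal{O}_X$ of germs of holomorphic functions, let $D=\sum D_i$ be a simple normal crossing (SNC) divisor on $X$ (in particular reduced; a smooth divisor, i.e. a smooth reduced complex hypersurface, is a special case), let $\varphi$ be a quasi-plurisubharmonic function on $X$ (locally the sum of a plurisubharmonic function and a smooth function; in particular every plurisubharmonic function qualifies), and let $\alpha>1$ be a real number. The ideal sheaf $Adj^{\alpha}_{D,*}(\varphi)\subset\mathcal{O}_X$ is defined as the sheaf of germs of holomorphic functions $f\in\mathcal{O}_{X,x}$ such that $$|f|^2\prod_{k=1}^{p}\frac{1}{|h_k|^2(-\log|h_k|)^{\alpha}}\,e^{-\varphi}$$ is integrable with respect to the Lebesgue measure, in some local coordinates, on some neighborhood of $x$. Here $h=h_1\cdots h_p$ is the minimal defining function of $D$ near $x$, where $h_1,\dots,h_p$ are local defining functions of the components of $D$ passing through $x$ (so $-\log|h_k|>0$ near $x$; if $x\notin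 D$, the product is empty and equals $1$; if $D$ is smooth and $x\in D$, then $p=1$). The analytic adjoint ideal sheaf associated to $\varphi$ along $D$ is the ideal sheaf $$Adj^{\alpha}_{D}(\varphi):=\bigcup_{\varepsilon>0}Adj^{\alpha}_{D,*}\big((1+\varepsilon)\varphi\big)\subset\mathcal{O}_X.$$ *)

(* Defs.v *)
From HB Require Import structures.
From mathcomp Require Import all_boot all_order all_algebra.
From mathcomp Require Import complex.
From mathcomp Require Import all_classical all_reals all_analysis.

Set Implicit Arguments.
Unset Strict Implicit.
Unset Printing Implicit Defensive.

Import Order.TTheory GRing.Theory Num.Theory.
Import numFieldNormedType.Exports.

Local Open Scope classical_set_scope.
Local Open Scope ring_scope.

(* [R[i]] packaged as a [numClosedFieldType], the key under which
   MathComp-Analysis finds the norm topology of a field; with it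
   ['rV[Cx R]_n] is a normed space over [Cx R], and [differentiable] means
   complex (Frechet) differentiable. *)
Definition Cx (R : realType) : numClosedFieldType := R[i].

(* The modulus as an element of [R]; the norm [`|z|] has values in [R[i]]. *)
Definition cabs {R : realType} (z : Cx R) : R := ComplexField.Normc.normc z.

Section BinaryProducts.
Context {d d' : measure_display} {T : measurableType d} {T' : measurableType d'}.
Context {R : realType}.

Section prod.
Variable m : {sigma_finite_measure set T -> \bar R}.
Variable m' : {sigma_finite_measure set T' -> \bar R}.

Definition product_sigma_finite : set (T * T') -> \bar R :=
  product_measure1 m m'.

HB.instance Definition _ :=
  Measure.copy product_sigma_finite (product_measure1 m m').

Let prod_sigma_finite : sigma_finite setT product_sigma_finite.
Proof.
have /sigma_finiteP[F [TF ndF Foo]] := sigma_finiteT m.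
have /sigma_finiteP[G [TG ndG Goo]] := sigma_finiteT m'.
exists (fun n => F n `*` G n).
  rewrite -setXTT TF TG predeqE => -[x y]; split.
    move=> [/= [n _ Fnx] [k _ Gky]]; exists (maxn n k) => //; split.
    - by move: x Fnx; exact/subsetPset/ndF/leq_maxl.
    - by move: y Gky; exact/subsetPset/ndG/leq_maxr.
  by move=> [n _ []/= ? ?]; split; exists n.
move=> k; have [? ?] := Foo k; have [? ?] := Goo k.
split; first exact: measurableX.
by rewrite /product_sigma_finite product_measure1E// lte_mul_pinfty// ge0_fin_numE.
Qed.

HB.instance Definition _ :=
  Measure_isSigmaFinite.Build _ _ _ product_sigma_finite prod_sigma_finite.

End prod.

End BinaryProducts.

Section TupleProducts.
Context {d : measure_display} {T : measurableType d} {R : realType}.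

Definition tuple_cons n (p : T * n.-tuple T) : n.+1.-tuple T :=
  [tuple of p.1 :: p.2].

Lemma measurable_tuple_cons n : measurable_fun setT (@tuple_cons n).
Proof. exact: measurable_cons. Qed.

HB.instance Definition _ n :=
  isMeasurableFun.Build _ _ _ _ (@tuple_cons n) (@measurable_tuple_cons n).

Section step.
Variables (n : nat) (m : {sigma_finite_measure set T -> \bar R}).
Variable mu : {sigma_finite_measure set (n.-tuple T) -> \bar R}.

Definition product_tuple_step : set (n.+1.-tuple T) -> \bar R :=
  pushforward (product_sigma_finite m mu) (@tuple_cons n).

Let step0 : product_tuple_step set0 = 0%E. Proof. exact: measure0. Qed.

Let step_ge0 A : (0 <= product_tuple_step A)%E.
Proof. exact: measure_ge0. Qed.

Let step_sigma_additive : semi_sigma_additive product_tuple_step.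
Proof. exact: measure_semi_sigma_additive. Qed.

HB.instance Definition _ := isMeasure.Build _ _ _ product_tuple_step
  step0 step_ge0 step_sigma_additive.

Let step_sigma_finite : sigma_finite setT product_tuple_step.
Proof.
have [F FT mF] := sigma_finiteT (product_sigma_finite m mu).
pose g (t : n.+1.-tuple T) : T * n.-tuple T := (thead t, [tuple of behead t]).
have mg : measurable_fun setT g.
  by apply: measurable_fun_pair; [exact: measurable_tnth|exact: measurable_behead].
have gK : cancel (@tuple_cons n) g.
  by move=> -[x t]; rewrite /g /tuple_cons /=; congr pair; apply/val_inj.
exists (fun k => g @^-1` F k).
  by rewrite -preimage_bigcup -FT preimage_setT.
move=> k; have [mFk Fk] := mF k; split.
  by rewrite -[X in measurable X]setTI; exact: mg.
rewrite /product_tuple_step /pushforward -comp_preimage.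
by rewrite (_ : g \o _ = id)//; apply/funext => p; exact: gK.
Qed.

HB.instance Definition _ :=
  Measure_isSigmaFinite.Build _ _ _ product_tuple_step step_sigma_finite.

End step.

Fixpoint product_tuple (m : {sigma_finite_measure set T -> \bar R}) (n : nat) :
    {sigma_finite_measure set (n.-tuple T) -> \bar R} :=
  if n is k.+1 then product_tuple_step m (product_tuple m k)
  else dirac [tuple].

End TupleProducts.

Section LebesgueMeasure.
Context {R : realType}.

Local Notation plane := (measurableTypeR R * measurableTypeR R)%type.

(* Lebesgue measure on (R x R)^n. *)
Definition lebesgue_planes (n : nat) :
    {sigma_finite_measure set (n.-tuple plane) -> \bar R} :=
  product_tuple (product_sigma_finite lebesgue_measure lebesgue_measure) n.

Definition of_planes n (t : n.-tuple plane) : 'rV[Cx R]_n :=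
  \row_i ((tnth t i).1 +i* (tnth t i).2)%C.

(* Lebesgue integrability on [W] of a function on C^n, in the coordinates
   (x_1, y_1, ..., x_n, y_n). *)
Definition Cn_integrable n (W : set 'rV[Cx R]_n) (F : 'rV[Cx R]_n -> \bar R) :=
  (lebesgue_planes n).-integrable (@of_planes n @^-1` W) (F \o @of_planes n).

End LebesgueMeasure.

Section SeveralComplexVariables.
Context {R : realType} {n : nat}.

Local Notation C := (Cx R).
Local Notation Cn := 'rV[Cx R]_n.

Definition holomorphic_on (W : set Cn) (f : Cn -> C) :=
  forall x, W x -> differentiable f x.

Definition holomorphic_near (x : Cn) (f : Cn -> C) :=
  \forall y \near x, differentiable f y.

(* The sub-mean value inequality is required on every closed complex disc
   {a + zeta b : |zeta| <= 1} contained in [U]; the function -oo is allowed. *)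
Definition plurisubharmonic (U : set Cn) (phi : Cn -> \bar R) :=
  [/\ forall x, U x -> (phi x < +oo)%E,
      forall x (c : R), U x -> (phi x < c%:E)%E ->
        \forall y \near x, (phi y < c%:E)%E
    & forall a b : Cn,
        (forall zeta : C, cabs zeta <= 1 -> U (a + zeta *: b)) ->
        ((2 * pi)%:E * phi a <=
         \int[lebesgue_measure]_(t in `[0%R, (2 * pi)%R])
           phi (a + ((cos t +i* sin t)%C : C) *: b)%R)%E].

(* [h] is a minimal local defining function at [x] of the hypersurface [D],
   which is smooth at [x]. *)
Definition local_equation (D : set Cn) (x : Cn) (h : Cn -> C) :=
  [/\ holomorphic_near x h,
      h x = 0,
      \forall y \near x, D y <-> h y = 0
    & exists v : Cn, 'd h x v != 0].

Definition smooth_divisor (U D : set Cn) :=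
  [/\ D `<=` U,
      forall x, U x -> ~ D x -> \forall y \near x, ~ D y
    & forall x, D x -> exists h, local_equation D x h].

(* The factor prod_k 1 / (|h_k|^2 (- log |h_k|)^alpha) at [x]: at most one
   component of a smooth divisor passes through [x], so the product is empty
   or has a single factor.  The value on [D], a null set, is irrelevant, and so
   is the value where [- log |h| <= 0]: [adjoint_star] may shrink [W].  It does
   not matter which local equation is used. *)
Definition adjoint_weight (alpha : R) (D : set Cn) (x : Cn) (w : Cn -> R) :=
  (~ D x /\ w = cst 1) \/
  (exists2 h, local_equation D x h &
     w = fun y => (cabs (h y) ^+ 2 * (- ln (cabs (h y))) `^ alpha)^-1).

(* A sheaf of submodules of O^k is given by its stalks: [M x f] says that the
   germ at [x] of the k-tuple of functions [f] belongs to the stalk at [x].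
   An ideal sheaf is the case of single functions. *)
Definition adjoint_star (alpha : R) (D : set Cn) (psi : Cn -> \bar R)
    (x : Cn) (f : Cn -> C) :=
  holomorphic_near x f /\
  exists2 w, adjoint_weight alpha D x w &
  exists W, [/\ open W, W x &
    Cn_integrable W
      (fun y => (cabs (f y) ^+ 2 * w y)%:E * expeR (- psi y))%E].

Definition adjoint_ideal (alpha : R) (D : set Cn) (phi : Cn -> \bar R)
    (x : Cn) (f : Cn -> C) :=
  exists2 eps : R, 0 < eps &
    adjoint_star alpha D (fun y => (1 + eps)%:E * phi y)%E x f.

Definition is_section k (M : Cn -> ('I_k -> Cn -> C) -> Prop) (W : set Cn)
    (s : 'I_k -> Cn -> C) :=
  (forall i, holomorphic_on W (s i)) /\ (forall y, W y -> M y s).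

Definition finite_type k (V : set Cn) (M : Cn -> ('I_k -> Cn -> C) -> Prop) :=
  forall x, V x -> exists W, [/\ open W, W x, W `<=` V &
    exists m (g : 'I_m -> 'I_k -> Cn -> C),
      (forall j, is_section M W (g j)) /\
      (forall y f, W y -> M y f ->
         exists2 a : 'I_m -> Cn -> C, (forall j, holomorphic_near y (a j)) &
         forall i, \forall z \near y, f i z = \sum_j a j z * g j i z)].

Definition relations k m (s : 'I_m -> 'I_k -> Cn -> C)
    (y : Cn) (r : 'I_m -> Cn -> C) :=
  (forall j, holomorphic_near y (r j)) /\
  (forall i, \forall z \near y, \sum_j r j z * s j i z = 0).

Definition coherent k (V : set Cn) (M : Cn -> ('I_k -> Cn -> C) -> Prop) :=
  finite_type V M /\
  forall W m (s : 'I_m -> 'I_k -> Cn -> C),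
    open W -> W `<=` V -> (forall j, is_section M W (s j)) ->
    finite_type W (relations s).

Definition coherent_ideal (V : set Cn) (I : Cn -> (Cn -> C) -> Prop) :=
  coherent V (fun x (f : 'I_1 -> Cn -> C) => I x (f ord0)).

End SeveralComplexVariables.

(* Main.v *)
Require Import Defs.
From mathcomp Require Import all_boot all_order all_algebra.
From mathcomp Require Import complex.
From mathcomp Require Import all_classical all_reals all_analysis.
From mathcomp Require Import measurable_realfun.
From mathcomp Require Import ring lra.

Set Implicit Arguments.
Unset Strict Implicit.
Unset Printing Implicit Defensive.

Import Order.TTheory GRing.Theory Num.Theory.
Import numFieldNormedType.Exports.

Local Open Scope classical_set_scope.
Local Open Scope ring_scope.

(** Coordinates [z0], [z1], [z2] are singled out, the divisor is the hyperplane
    [z0 = 0], and with [ell z = - log |z|] the potential [phi] is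
      [- min (2 ell z1, inf_k N_k)],  where
      [N_k = k (1 + sum_(j < k) 2^-j ell (z2 - p_j)) + 2^-k ell z0].
    It is plurisubharmonic because [ell] is superharmonic and, as [N_k >= k],
    the infimum is locally a minimum of finitely many functions.

    The points [p_j] are poles placed on the [z2]-axis.  Where [z2] stays away
    from all of them, taking [k] about [log (ell z0)] shows that [inf_k N_k] is
    at most a multiple of [log (ell z0)].  Interpolating between the two terms
    of the minimum, [e^(- (1 + eps) phi)] is then at most
    [|z1|^(- 2 (1 - eps))] times a small power of [ell z0]; since [alpha > 1],
    this is integrable against [1 / (|z0|^2 (ell z0)^alpha)] for [eps] small,
    and the ideal contains 1 ([one_in_adjoint]).  Close to a pole [p_j], on the
    contrary, [inf_k N_k] exceeds any given multiple of [log (ell z0)] for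
    small [z0].  On boxes [|z0| ~ 2^-m], [|z1| <= m^-kap] the integral of the
    weight is then at least of order [m^(2 kap eps - alpha)], which tends to
    infinity if [kap] is chosen large after [eps]: every germ of the ideal
    vanishes at the pole ([adjoint_vanishes]).  An arbitrary local equation
    [h] of the divisor may occur there; Schwarz's lemma gives [|h| <= K |z0|].

    Finally let the [p_j] be dense in the boundaries of squares of the
    [z2]-axis shrinking to 0.  If finitely many sections generated the ideal
    near the origin, they would vanish at the poles, by continuity on the
    boundaries of the small squares, and by Cauchy's formula inside them.  But
    inside them there are points away from the poles, where 1 belongs to the
    ideal and would be a combination of functions vanishing there
    ([not_coherent]).

    Cauchy's formula is proved for functions that are complex differentiable
    at each point of a rectangle, by Goursat's bisection, in the approximate
    form [cauchy_approx] that both applications ([holo_zero_edges] and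
    [schwarz_bound]) start from.  The superharmonicity of [ell] rests on the
    mean value property of [log |1 + b w|] ([ringlog_mean0]). *)

(** * The modulus of a complex number *)

Definition cre {R : realType} (z : Cx R) : R := complex.Re z.
Definition cim {R : realType} (z : Cx R) : R := complex.Im z.

Section ComplexModulus.
Context {R : realType}.
Implicit Types z w : Cx R.

Lemma cabsE z : cabs z = Num.sqrt (cre z ^+ 2 + cim z ^+ 2).
Proof. by case: z. Qed.

Lemma normr_cabs z : `|z| = ((cabs z)%:C)%C.
Proof. by case: z => x y; rewrite [LHS]normc_def. Qed.

Lemma cabs_ge0 z : 0 <= cabs z.
Proof. by rewrite cabsE sqrtr_ge0. Qed.

Lemma cabsM z w : cabs (z * w) = cabs z * cabs w.
Proof. exact: ComplexField.Normc.normcM. Qed.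

Lemma cabsV z : cabs z^-1 = (cabs z)^-1.
Proof. exact: ComplexField.Normc.normcV. Qed.

Lemma cabs_eq0 z : (cabs z == 0) = (z == 0).
Proof.
apply/eqP/eqP => [|->]; first exact: ComplexField.Normc.eq0_normc.
exact: ComplexField.Normc.normc0.
Qed.

Lemma cabs0 : cabs (0 : Cx R) = 0.
Proof. by apply/eqP; rewrite cabs_eq0. Qed.

Lemma cabs1 : cabs (1 : Cx R) = 1.
Proof. exact: ComplexField.Normc.normc1. Qed.

Lemma cabs_gt0 z : (0 < cabs z) = (z != 0).
Proof. by rewrite lt_neqAle cabs_ge0 andbT eq_sym cabs_eq0. Qed.

Lemma cabsN z : cabs (- z) = cabs z.
Proof. by rewrite !cabsE; case: z => x y; rewrite /cre /cim /= !sqrrN. Qed.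

Lemma cabsB z w : cabs (z - w) = cabs (w - z).
Proof. by rewrite -cabsN opprB. Qed.

Lemma cabsD z w : cabs (z + w) <= cabs z + cabs w.
Proof.
by have := ler_normD z w; rewrite !normr_cabs -rmorphD /= lecR.
Qed.

Lemma Re_le_cabs z : `|cre z| <= cabs z.
Proof.
rewrite cabsE -(sqrtr_sqr (cre z)); rewrite ler_wsqrtr//.
by rewrite lerDl sqr_ge0.
Qed.

Lemma Im_le_cabs z : `|cim z| <= cabs z.
Proof.
rewrite cabsE -(sqrtr_sqr (cim z)); rewrite ler_wsqrtr//.
by rewrite lerDr sqr_ge0.
Qed.

Lemma cabs_le z : cabs z <= `|cre z| + `|cim z|.
Proof.
rewrite cabsE -[leRHS]ger0_norm ?addr_ge0// -sqrtr_sqr ler_sqrt ?sqr_ge0//.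
rewrite sqrrD !real_normK ?num_real// -addrA lerD2l lerDr.
by rewrite mulrn_wge0// mulr_ge0.
Qed.

Lemma cabs_real (x : R) : cabs ((x%:C)%C : Cx R) = `|x|.
Proof. by rewrite cabsE /cim /= expr0n addr0 sqrtr_sqr. Qed.

Lemma cabsX z n : cabs (z ^+ n) = cabs z ^+ n.
Proof. by elim: n => [|n IH]; rewrite ?expr0 ?cabs1// !exprS cabsM IH. Qed.

Lemma ReD z w : cre (z + w) = cre z + cre w.
Proof. by case: z => ? ?; case: w. Qed.
Lemma ImD z w : cim (z + w) = cim z + cim w.
Proof. by case: z => ? ?; case: w. Qed.
Lemma ReB z w : cre (z - w) = cre z - cre w.
Proof. by case: z => ? ?; case: w. Qed.
Lemma ImB z w : cim (z - w) = cim z - cim w.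
Proof. by case: z => ? ?; case: w. Qed.
Lemma ReM z w : cre (z * w) =
  cre z * cre w - cim z * cim w.
Proof. by case: z => ? ?; case: w. Qed.
Lemma ImM z w : cim (z * w) =
  cre z * cim w + cim z * cre w.
Proof. by case: z => ? ?; case: w. Qed.

Lemma Cx_eq z w : cre z = cre w -> cim z = cim w -> z = w.
Proof. by case: z => ? ?; case: w => ? ? /= -> ->. Qed.

End ComplexModulus.

(** * Integrals over a segment *)

Section RealIntegral.
Context {R : realType}.

Definition rint (f : R -> R) (a b : R) : R :=
  \int[@lebesgue_measure R]_(x in `[a, b]) f x.

(** Continuity in a full neighbourhood of every point, endpoints included:
    slices of functions that are continuous at each point of an edge have it,
    and it passes to subsegments without any subspace topology. *)
Definition cont_on (a b : R) (f : R -> R) := forall x, a <= x <= b -> {for x, continuous f}.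

Lemma cont_on_integrable a b f : cont_on a b f ->
  (@lebesgue_measure R).-integrable `[a, b] (EFin \o f).
Proof.
move=> cf; apply: continuous_compact_integrable; first exact: segment_compact.
by apply: continuous_in_subspaceT => x; rewrite inE /= in_itv /= => xab; exact: cf.
Qed.

Lemma rintD a b f g : cont_on a b f -> cont_on a b g ->
  rint (fun x => f x + g x) a b = rint f a b + rint g a b.
Proof.
by move=> cf cg; rewrite /rint RintegralD//; exact: cont_on_integrable.
Qed.

Lemma rintB a b f g : cont_on a b f -> cont_on a b g ->
  rint (fun x => f x - g x) a b = rint f a b - rint g a b.
Proof.
by move=> cf cg; rewrite /rint RintegralB//; exact: cont_on_integrable.
Qed.

Lemma rintZ a b f k : cont_on a b f ->
  rint (fun x => k * f x) a b = k * rint f a b.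
Proof.
by move=> cf; rewrite /rint RintegralZl//; exact: cont_on_integrable.
Qed.

Lemma rint_cst a b k : a <= b -> rint (fun=> k) a b = k * (b - a).
Proof.
move=> ab; rewrite /rint Rintegral_cst//= lebesgue_measure_itv/= lte_fin.
case: ltP => [_|ba]; first by rewrite -EFinB.
by have -> : a = b; [lra | rewrite subrr].
Qed.

Lemma le_rint a b f g : cont_on a b f -> cont_on a b g ->
  (forall x, a <= x <= b -> f x <= g x) -> rint f a b <= rint g a b.
Proof.
move=> cf cg fg; apply: le_Rintegral => //; exact: cont_on_integrable.
Qed.

Lemma eq_rint a b f g : (forall x, a <= x <= b -> f x = g x) ->
  rint f a b = rint g a b.
Proof.
move=> fg; apply: eq_Rintegral => x; rewrite inE /= in_itv /=; exact: fg.
Qed.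

Lemma rint_split c a b f : a <= c <= b -> cont_on a b f ->
  rint f a b = rint f a c + rint f c b.
Proof.
move=> /andP[ac cb] cf; have fi := cont_on_integrable cf.
apply/eqP; rewrite addrC -subr_eq; apply/eqP.
rewrite /rint Rintegral_itvB//; apply: Rintegral_itv_obnd_cbnd.
apply: integrableS fi => //= x /=; rewrite !in_itv/= => /andP[cx ->].
by rewrite andbT (le_trans ac)// ltW.
Qed.

Lemma le_abs_rint a b f M : a <= b -> cont_on a b f ->
  (forall x, a <= x <= b -> `|f x| <= M) -> `|rint f a b| <= M * (b - a).
Proof.
move=> ab cf fM; rewrite ler_norml; apply/andP; split.
  rewrite -mulNr -(rint_cst _ ab); apply: le_rint => //; first by move=> x _; exact: cst_continuous.
  by move=> x /fM; rewrite ler_norml => /andP[].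
rewrite -(rint_cst _ ab); apply: le_rint => //; first by move=> x _; exact: cst_continuous.
by move=> x /fM; rewrite ler_norml => /andP[].
Qed.

Lemma rint_FTC2 a b (f F : R -> R) : a <= b -> cont_on a b f ->
  (forall x : R, is_derive x (1 : R) F (f x)) -> rint f a b = F b - F a.
Proof.
rewrite le_eqVlt => /predU1P[<-|ab] cf dF.
  by rewrite subrr /rint set_itv1 Rintegral_set1.
have cF x : {for x, continuous F}.
  by apply: differentiable_continuous; apply/derivable1_diffP; have [] := dF x.
rewrite /rint /Rintegral (@continuous_FTC2 _ f F)//.
- apply: continuous_in_subspaceT => x; rewrite inE /= in_itv /= => xab; exact: cf.
- split.
  + by move=> x _; have [] := dF x.
  + by apply: cvg_at_right_filter; exact: cF.
  + by apply: cvg_at_left_filter; exact: cF.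
- by move=> x _; rewrite derive1E; have [_ ->] := dF x.
Qed.

Lemma rint_id a b : a <= b -> rint (fun x => x) a b = (b ^+ 2 - a ^+ 2) / 2.
Proof.
move=> ab; have dF (x : R) : is_derive x (1 : R) (fun x => 2^-1 * x ^+ 2) x.
  by apply: is_derive_eq; rewrite /GRing.scale /=; lra.
rewrite (rint_FTC2 ab _ dF); first by lra.
by move=> x _; exact: cvg_id.
Qed.

End RealIntegral.

(** * Limits and derivatives in terms of the modulus *)

Section ComplexTopology.
Context {R : realType}.
Local Notation C := (Cx R).
Implicit Types (z w : C) (F G : C -> C).

Lemma ltc_pos (e : C) : 0 < e -> exists2 d : R, 0 < d & e = ((d%:C)%C : C).
Proof.
case: e => x y; rewrite ltcE /= => /andP[/eqP-> x0].
by exists x.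
Qed.

Lemma nbhs_CxP z (P : set C) :
  nbhs z P <-> exists2 d : R, 0 < d & forall w, cabs (w - z) < d -> P w.
Proof.
split=> [/nbhs_normP[e /ltc_pos[d d0 ->] eP]|[d d0 dP]].
  exists d => // w wd; apply: eP => /=.
  by rewrite normr_cabs cabsB ltcR.
apply/nbhs_normP; exists (d%:C)%C; first by rewrite /= ltcR.
by move=> w /=; rewrite normr_cabs ltcR cabsB; exact: dP.
Qed.

Lemma cvg_CxP (T : Type) (f : T -> C) (A : set_system T) {FA : Filter A} l :
  f @ A --> l <-> forall e : R, 0 < e -> \forall x \near A, cabs (f x - l) < e.
Proof.
split=> [fl e e0|fl].
  apply: (fl [set w | cabs (w - l) < e]); apply/nbhs_CxP; exists e => // w; exact.
by move=> P /nbhs_CxP[d d0 dP]; have := fl _ d0; apply: filterS => x; exact: dP.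
Qed.

Lemma continuous_CxP F z : {for z, continuous F} <->
  forall e : R, 0 < e -> exists2 d : R, 0 < d &
    forall w, cabs (w - z) < d -> cabs (F w - F z) < e.
Proof.
split=> [Fc e e0|Fc].
  by apply/nbhs_CxP; apply: (@cvg_CxP _ F (nbhs z) _ (F z)).1.
by apply: (@cvg_CxP _ F (nbhs z) _ (F z)).2 => e /Fc H; apply/nbhs_CxP.
Qed.

(** Goursat's theorem needs only that some slope exists, hence the
    quantified [A]. *)
Lemma derivable_CxP F z : derivable F z 1 -> exists A : C,
  forall e : R, 0 < e -> exists2 d : R, 0 < d &
    forall w, cabs (w - z) < d -> cabs (F w - F z - A * (w - z)) <= e * cabs (w - z).
Proof.
move=> dF; exists ('D_1 F z) => e e0.
have := (@cvg_CxP _ _ (0^')%classic _ ('D_1 F z)).1 dF _ e0.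
rewrite near_withinE => /(_ ltac:(exact _)) H.
have [d d0 dP] := (nbhs_CxP (0 : C) (fun h => h != 0 ->
  cabs (h^-1 *: ((F \o shift z) (h *: 1) - F z) - 'D_1 F z) < e)).1 H; exists d => // w wd.
have [->|wz] := eqVneq w z; first by rewrite !subrr mulr0 subrr cabs0 mulr0.
have /= := dP (w - z); rewrite subr0 subr_eq0 => /(_ wd wz).
rewrite scaler1 subrK -mulr_algl => {}H.
have -> : F w - F z - 'D_1 F z * (w - z) =
   ((w - z)^-1%:A * (F w - F z) - lim ((fun h : C => h^-1 *: ((F \o shift z) (h *: 1) - F z)) @ 0^')) * (w - z).
  rewrite /derive /= mulrBl; congr (_ - _).
  by rewrite /GRing.scale /= mulr1 mulrAC mulVf ?mul1r// subr_eq0.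
by rewrite cabsM ler_wpM2r ?cabs_ge0// ltW.
Qed.

Lemma derivable_continuous F z : derivable F z 1 -> {for z, continuous F}.
Proof.
by move=> dF; apply: differentiable_continuous; apply/derivable1_diffP.
Qed.

End ComplexTopology.

(** * Boundary integrals over rectangles *)

Section RectangleIntegral.
Context {R : realType}.
Local Notation C := (Cx R).
Implicit Types (z w : C) (F G : C -> C) (g : R -> C) (a b c d : R).

Definition pt (x y : R) : C := (x +i* y)%C.

Definition cint g a b : C := pt (rint (cre \o g) a b) (rint (cim \o g) a b).

Definition ccont_on a b g := cont_on a b (cre \o g) /\ cont_on a b (cim \o g).

Lemma cintD a b g h : ccont_on a b g -> ccont_on a b h ->
  cint (fun t => g t + h t) a b = cint g a b + cint h a b.
Proof.
move=> [g1 g2] [h1 h2]; apply: Cx_eq; rewrite /cint ?ReD ?ImD/= -rintD//;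
  by apply: eq_rint => t _ /=; rewrite ?ReD ?ImD.
Qed.

Lemma cintZ a b g k : ccont_on a b g ->
  cint (fun t => k * g t) a b = k * cint g a b.
Proof.
move=> [g1 g2].
have kg (l : R) (f : R -> R) : cont_on a b f -> cont_on a b (fun t => l * f t).
  by move=> cf t tab; apply: cvgM; [exact: cvg_cst|exact: cf].
apply: Cx_eq; rewrite ?ReM ?ImM.
  change (rint (fun t => cre (k * g t)) a b =
    cre k * rint (cre \o g) a b - cim k * rint (cim \o g) a b).
  rewrite -!rintZ// -rintB; try exact: kg.
  by apply: eq_rint => t _ /=; rewrite ReM.
change (rint (fun t => cim (k * g t)) a b =
  cre k * rint (cim \o g) a b + cim k * rint (cre \o g) a b).
rewrite -!rintZ// -rintD; try exact: kg.
by apply: eq_rint => t _ /=; rewrite ImM.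
Qed.

Lemma cint_split c a b g : a <= c <= b -> ccont_on a b g ->
  cint g a b = cint g a c + cint g c b.
Proof.
by move=> acb [g1 g2]; apply: Cx_eq; rewrite ?ReD ?ImD/=; exact: rint_split.
Qed.

(** The factor 2 is the price of bounding real and imaginary parts
    separately. *)
Lemma cabs_cint a b g M : a <= b -> ccont_on a b g ->
  (forall t, a <= t <= b -> cabs (g t) <= M) -> cabs (cint g a b) <= 2 * M * (b - a).
Proof.
move=> ab [g1 g2] gM; apply: le_trans (cabs_le _) _.
rewrite -mulrA mulr_natl mulr2n; apply: lerD; apply: le_abs_rint => // t /gM;
  apply: le_trans; first exact: Re_le_cabs.
exact: Im_le_cabs.
Qed.

Lemma eq_cint a b g h : (forall t, a <= t <= b -> g t = h t) -> cint g a b = cint h a b.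
Proof. by move=> gh; congr pt; apply: eq_rint => t /gh /= ->. Qed.

(** The counterclockwise boundary integral of [F(z) dz] over
    [[a, b] x [c, d]]: [dz] is [dt] on the horizontal edges and [i dt] on the
    vertical ones. *)
Definition rectint F a b c d : C :=
  cint (fun t => F (pt t c)) a b - cint (fun t => F (pt t d)) a b +
  pt 0 1 * (cint (fun t => F (pt b t)) c d - cint (fun t => F (pt a t)) c d).

Record on_edges (P : C -> Prop) a b c d : Prop := OnEdges {
  on_hedges : forall t, a <= t <= b -> P (pt t c) /\ P (pt t d);
  on_vedges : forall t, c <= t <= d -> P (pt a t) /\ P (pt b t) }.

Definition on_rect (P : C -> Prop) a b c d :=
  forall x y, a <= x <= b -> c <= y <= d -> P (pt x y).

Lemma on_rect_edges P a b c d : a <= b -> c <= d ->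
  on_rect P a b c d -> on_edges P a b c d.
Proof. by move=> ab cd H; split=> t tab; split; apply: H => //; lra. Qed.

Lemma continuous_hline F y x : {for pt x y, continuous F} ->
  {for x, continuous (cre \o (fun t => F (pt t y)))} /\
  {for x, continuous (cim \o (fun t => F (pt t y)))}.
Proof.
move=> /continuous_CxP Fc.
have H (e : R) : 0 < e -> \forall t \near x, cabs (F (pt t y) - F (pt x y)) < e.
  move=> /Fc[d d0 dP]; near=> t; apply: dP.
  rewrite cabsE /cre /cim /= subrr expr0n addr0 sqrtr_sqr.
  by near: t; apply: cvgr_distC_lt.
split; apply/cvgrPdist_lt => e /H; apply: filterS => t; apply: le_lt_trans.
  by rewrite /= distrC -ReB Re_le_cabs.
by rewrite /= distrC -ImB Im_le_cabs.
Unshelve. all: by end_near. Qed.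

Lemma continuous_vline F x y : {for pt x y, continuous F} ->
  {for y, continuous (cre \o (fun t => F (pt x t)))} /\
  {for y, continuous (cim \o (fun t => F (pt x t)))}.
Proof.
move=> /continuous_CxP Fc.
have H (e : R) : 0 < e -> \forall t \near y, cabs (F (pt x t) - F (pt x y)) < e.
  move=> /Fc[d d0 dP]; near=> t; apply: dP.
  rewrite cabsE /cre /cim /= subrr expr0n add0r sqrtr_sqr.
  by near: t; apply: cvgr_distC_lt.
split; apply/cvgrPdist_lt => e /H; apply: filterS => t; apply: le_lt_trans.
  by rewrite /= distrC -ReB Re_le_cabs.
by rewrite /= distrC -ImB Im_le_cabs.
Unshelve. all: by end_near. Qed.

Definition cont_edges F := on_edges (fun z => {for z, continuous F}).

Lemma cont_edgesP F a b c d : cont_edges F a b c d ->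
  [/\ ccont_on a b (fun t => F (pt t c)), ccont_on a b (fun t => F (pt t d)),
      ccont_on c d (fun t => F (pt a t)) & ccont_on c d (fun t => F (pt b t))].
Proof.
move=> [H V]; split; split=> t tab.
- by have [/continuous_hline[]] := H _ tab.
- by have [/continuous_hline[]] := H _ tab.
- by have [_ /continuous_hline[]] := H _ tab.
- by have [_ /continuous_hline[]] := H _ tab.
- by have [/continuous_vline[]] := V _ tab.
- by have [/continuous_vline[]] := V _ tab.
- by have [_ /continuous_vline[]] := V _ tab.
- by have [_ /continuous_vline[]] := V _ tab.
Qed.

Lemma cont_edgesD F G a b c d : cont_edges F a b c d -> cont_edges G a b c d ->
  cont_edges (fun z => F z + G z) a b c d.
Proof.
move=> [F1 F2] [G1 G2]; split=> t tab; split.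
- by have [h1 _] := F1 t tab; have [h2 _] := G1 t tab; exact: (cvgD h1 h2).
- by have [_ h1] := F1 t tab; have [_ h2] := G1 t tab; exact: (cvgD h1 h2).
- by have [h1 _] := F2 t tab; have [h2 _] := G2 t tab; exact: (cvgD h1 h2).
- by have [_ h1] := F2 t tab; have [_ h2] := G2 t tab; exact: (cvgD h1 h2).
Qed.

Lemma rectintD F G a b c d : cont_edges F a b c d -> cont_edges G a b c d ->
  rectint (fun z => F z + G z) a b c d = rectint F a b c d + rectint G a b c d.
Proof.
move=> /cont_edgesP[? ? ? ?] /cont_edgesP[? ? ? ?].
rewrite /rectint !cintD//; ring.
Qed.

Lemma rectintZ F k a b c d : cont_edges F a b c d ->
  rectint (fun z => k * F z) a b c d = k * rectint F a b c d.
Proof.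
by move=> /cont_edgesP[? ? ? ?]; rewrite /rectint !cintZ//; ring.
Qed.

Lemma eq_rectint F G a b c d : on_edges (fun z => F z = G z) a b c d ->
  rectint F a b c d = rectint G a b c d.
Proof.
move=> [H V]; congr (_ - _ + _ * (_ - _)); apply: eq_cint => t.
- by move=> /H[].
- by move=> /H[].
- by move=> /V[].
- by move=> /V[].
Qed.

Lemma cabs_rectint F a b c d M : a <= b -> c <= d -> cont_edges F a b c d ->
  on_edges (fun z => cabs (F z) <= M) a b c d ->
  cabs (rectint F a b c d) <= 4 * M * ((b - a) + (d - c)).
Proof.
move=> ab cd /cont_edgesP[c1 c2 c3 c4] [H V].
have h1 := cabs_cint ab c1 (fun t tab => (H t tab).1).
have h2 := cabs_cint ab c2 (fun t tab => (H t tab).2).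
have h3 := cabs_cint cd c3 (fun t tab => (V t tab).1).
have h4 := cabs_cint cd c4 (fun t tab => (V t tab).2).
have i1 : cabs (pt 0 1) = 1.
  by rewrite cabsE /cre /cim /= expr0n add0r expr1n sqrtr1.
apply: le_trans (cabsD _ _) _; rewrite cabsM i1 mul1r.
have := cabsD (cint (fun t => F (pt t c)) a b) (- cint (fun t => F (pt t d)) a b).
have := cabsD (cint (fun t => F (pt b t)) c d) (- cint (fun t => F (pt a t)) c d).
rewrite !cabsN; lra.
Qed.

(** The common edge is traversed in both directions, so its
    contributions cancel whatever [F] is there. *)
Lemma rectint_splitv e F a b c d : a <= e <= b -> cont_edges F a b c d ->
  rectint F a b c d = rectint F a e c d + rectint F e b c d.
Proof.
move=> aeb /cont_edgesP[c1 c2 c3 c4].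
rewrite /rectint (cint_split aeb c1) (cint_split aeb c2); ring.
Qed.

Lemma rectint_splith e F a b c d : c <= e <= d -> cont_edges F a b c d ->
  rectint F a b c d = rectint F a b c e + rectint F a b e d.
Proof.
move=> aeb /cont_edgesP[c1 c2 c3 c4].
rewrite /rectint (cint_split aeb c3) (cint_split aeb c4); ring.
Qed.

Lemma rectint_cst k a b c d : a <= b -> c <= d -> rectint (fun=> k) a b c d = 0.
Proof. by move=> ab cd; rewrite /rectint !subrr mulr0 addr0. Qed.

(** Together with [rectint_cst] this gives the vanishing of the integral
    of an affine function, the starting point of Goursat's theorem. *)
Lemma rectint_id a b c d : a <= b -> c <= d -> rectint (fun z => z) a b c d = 0.
Proof.
move=> ab cd; rewrite /rectint /cint.
have E1 (u v k : R) : u <= v -> rint (cre \o (fun t => pt t k)) u v = (v ^+ 2 - u ^+ 2) / 2.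
  by move=> uv; rewrite -rint_id//.
have E2 (u v k : R) : u <= v -> rint (cim \o (fun t => pt t k)) u v = k * (v - u).
  by move=> uv; rewrite -rint_cst//.
have E3 (u v k : R) : u <= v -> rint (cre \o (fun t => pt k t)) u v = k * (v - u).
  by move=> uv; rewrite -rint_cst//.
have E4 (u v k : R) : u <= v -> rint (cim \o (fun t => pt k t)) u v = (v ^+ 2 - u ^+ 2) / 2.
  by move=> uv; rewrite -rint_id//.
cbv beta; rewrite !E1// !E2//.
apply: Cx_eq; rewrite ?(ReD, ReM, ImD, ImM, ReB, ImB); rewrite /cre /cim /=; ring.
Qed.

End RectangleIntegral.

(** * Goursat's theorem *)

Section Cauchy.
Context {R : realType}.
Local Notation C := (Cx R).
Implicit Types (z w : C) (F G : C -> C) (a b c d : R).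

Lemma nested_intervals (u v : nat -> R) :
  (forall n, u n <= u n.+1) -> (forall n, v n.+1 <= v n) -> (forall n, u n <= v n) ->
  exists x, forall n, u n <= x <= v n.
Proof.
move=> ui vd uv.
have uh m n : (m <= n)%N -> u m <= u n.
  by elim: n => [|n IH]; [rewrite leqn0 => /eqP->|rewrite leq_eqVlt =>
    /predU1P[->//|/IH h]; exact: le_trans h (ui _)].
have vh m n : (m <= n)%N -> v n <= v m.
  by elim: n => [|n IH]; [rewrite leqn0 => /eqP->|rewrite leq_eqVlt =>
    /predU1P[->//|/IH h]; exact: le_trans (vd _) h].
have uvmn m n : u m <= v n.
  apply: le_trans (uh _ _ (leq_maxl m n)) _.
  by apply: le_trans (uv _) (vh _ _ (leq_maxr m n)).
exists (sup (range u)) => n; apply/andP; split.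
  apply: ub_le_sup; last by exists n.
  by exists (v 0) => _ [m _ <-].
by apply: ge_sup; [exists (u 0); exists 0%N|move=> _ [m _ <-]].
Qed.

Lemma on_rectW (P : C -> Prop) a b c d a' b' c' d' :
  on_rect P a b c d -> a <= a' -> b' <= b -> c <= c' -> d' <= d ->
  on_rect P a' b' c' d'.
Proof. by move=> H aa bb cc dd x y xab ycd; apply: H; lra. Qed.

Definition holo_rect F := on_rect (fun z => derivable F z 1).

Lemma holo_rect_cont F a b c d : a <= b -> c <= d ->
  holo_rect F a b c d -> cont_edges F a b c d.
Proof.
move=> ab cd H.
apply: (@on_rect_edges _ (fun z => {for z, continuous F}) _ _ _ _ ab cd) => x y xab ycd.
exact/derivable_continuous/H.
Qed.

(** The boundary integrals of the four quarters add up to that of the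
    whole rectangle, so one of them has at least a quarter of its modulus. *)
Lemma worst_quarter F a c l h : 0 <= l -> 0 <= h -> holo_rect F a (a + l) c (c + h) ->
  exists p : R * R, [/\ a <= p.1, p.1 + l / 2 <= a + l, c <= p.2, p.2 + h / 2 <= c + h &
   cabs (rectint F a (a + l) c (c + h)) <=
     4 * cabs (rectint F p.1 (p.1 + l / 2) p.2 (p.2 + h / 2))].
Proof.
move=> l0 h0 H.
have al : a <= a + l / 2 <= a + l by lra.
have ch : c <= c + h / 2 <= c + h by lra.
have HC a' b' c' d' : a <= a' -> a' <= b' -> b' <= a + l -> c <= c' -> c' <= d' ->
    d' <= c + h -> cont_edges F a' b' c' d'.
  by move=> *; apply: holo_rect_cont => //; apply: on_rectW H _ _ _ _.
have E : rectint F a (a + l) c (c + h) =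
   rectint F a (a + l / 2) c (c + h / 2) + rectint F a (a + l / 2) (c + h / 2) (c + h)
   + (rectint F (a + l / 2) (a + l) c (c + h / 2)
   + rectint F (a + l / 2) (a + l) (c + h / 2) (c + h)).
  rewrite (rectint_splitv al); last by apply: HC; lra.
  rewrite (rectint_splith ch); last by apply: HC; lra.
  by rewrite (rectint_splith (a := a + l / 2) ch)//; apply: HC; lra.
have al2 : a + l = a + l / 2 + l / 2 by lra.
have ch2 : c + h = c + h / 2 + h / 2 by lra.
move: (cabs (rectint F a (a + l) c (c + h))) (congr1 cabs E) => J.
rewrite al2 ch2 => EJ.
have : J <= cabs (rectint F a (a + l / 2) c (c + h / 2)) +
   cabs (rectint F a (a + l / 2) (c + h / 2) (c + h / 2 + h / 2)) +
   (cabs (rectint F (a + l / 2) (a + l / 2 + l / 2) c (c + h / 2)) +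
   cabs (rectint F (a + l / 2) (a + l / 2 + l / 2) (c + h / 2) (c + h / 2 + h / 2))).
  rewrite EJ; apply: le_trans (cabsD _ _) _; apply: lerD; exact: cabsD.
set J1 := cabs _; set J2 := cabs _; set J3 := cabs _; set J4 := cabs _ => JJ.
have [h1|h1] := lerP J (4 * J1).
  by exists (a, c); split; last exact: h1; clear -l0 h0; rewrite /=; lra.
have [h2|h2] := lerP J (4 * J2).
  by exists (a, c + h / 2); split; last exact: h2; clear -l0 h0; rewrite /=; lra.
have [h3|h3] := lerP J (4 * J3).
  by exists (a + l / 2, c); split; last exact: h3; clear -l0 h0; rewrite /=; lra.
have h4 : J <= 4 * J4 by clearbody J1 J2 J3 J4; clear -JJ h1 h2 h3; lra.
by exists (a + l / 2, c + h / 2); split; last exact: h4; clear -l0 h0; rewrite /=; lra.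
Qed.

(** Iterating [worst_quarter] gives nested rectangles around a point [z],
    the [n]-th integral being at least [4^-n] times the first one.  Near [z]
    the function is affine up to [e |w - z|] and the affine part integrates to
    0, so the [n]-th integral is at most [4 e (S / 2^n)^2], where [S] is half
    the perimeter; now [e] is arbitrary. *)
Lemma goursat F a b c d : a <= b -> c <= d -> holo_rect F a b c d ->
  rectint F a b c d = 0.
Proof.
move=> ab cd H; pose l := b - a; pose h := d - c.
have l0 : 0 <= l by rewrite /l; lra.
have h0 : 0 <= h by rewrite /h; lra.
have eb : b = a + l by rewrite /l; lra.
have ed : d = c + h by rewrite /h; lra.
have half0 n (x : R) : 0 <= x -> 0 <= x / 2 ^+ n by move=> x0; rewrite divr_ge0// exprn_ge0.
pose ok n (p : R * R) := [/\ a <= p.1, p.1 + l / 2 ^+ n <= b, c <= p.2 &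
  p.2 + h / 2 ^+ n <= d].
pose J n (p : R * R) := cabs (rectint F p.1 (p.1 + l / 2 ^+ n) p.2 (p.2 + h / 2 ^+ n)).
have step n p : exists q : R * R, ok n p ->
    [/\ ok n.+1 q, p.1 <= q.1, q.1 + l / 2 ^+ n.+1 <= p.1 + l / 2 ^+ n,
       p.2 <= q.2 /\ q.2 + h / 2 ^+ n.+1 <= p.2 + h / 2 ^+ n & J n p <= 4 * J n.+1 q].
  have [okp|nok] := pselect (ok n p); last by exists p.
  have [g1 g2 g3 g4] := okp.
  have Hp : holo_rect F p.1 (p.1 + l / 2 ^+ n) p.2 (p.2 + h / 2 ^+ n).
    by apply: on_rectW H _ _ _ _.
  have [q [q1 q2 q3 q4 q5]] := worst_quarter (half0 n _ l0) (half0 n _ h0) Hp.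
  have e2 (x : R) : x / 2 ^+ n / 2 = x / 2 ^+ n.+1 by rewrite exprSr invfM mulrA.
  move: q2 q4 q5; rewrite !e2 => q2 q4 q5.
  by exists q => _; split => //; split; clear -q1 q2 q3 q4 g1 g2 g3 g4; lra.
have [f fP] := choice (fun np => step np.1 np.2).
pose q := fix q n := if n is m.+1 then f (m, q m) else (a, c).
have okq n : ok n (q n).
  elim: n => [|n IH]; first by rewrite /ok /= expr0 !divr1 -eb -ed.
  by have [] := fP (n, q n) IH.
have qP n := fP (n, q n) (okq n).
have Jn n : cabs (rectint F a b c d) <= 4 ^+ n * J n (q n).
  elim: n => [|n IH]; first by rewrite expr0 mul1r /J /= expr0 !divr1 -eb -ed.
  apply: le_trans IH _; rewrite exprSr -mulrA ler_wpM2l// ?exprn_ge0//.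
  by have [] := qP n.
have [x xP] : exists x, forall n, (q n).1 <= x <= (q n).1 + l / 2 ^+ n.
  apply: nested_intervals => n; first by have [] := qP n.
  - by have [] := qP n.
  - by rewrite lerDl half0.
have [y yP] : exists y, forall n, (q n).2 <= y <= (q n).2 + h / 2 ^+ n.
  apply: nested_intervals => n; first by have [_ _ _ []] := qP n.
  - by have [_ _ _ []] := qP n.
  - by rewrite lerDl half0.
have dz : derivable F (pt x y) 1.
  by apply: H; have := xP 0%N; have := yP 0%N; rewrite /= expr0 !divr1 -eb -ed.
have [A AP] := derivable_CxP dz.
apply/eqP; rewrite -cabs_eq0 eq_le cabs_ge0 andbT.
set J0 := cabs _ in Jn *.
rewrite leNgt; apply/negP => J0_gt0.
pose S := l + h.
have S0 : 0 <= S by rewrite addr_ge0.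
(* makes the final bound [4 e S^2] less than [J0]; adding 1 covers [S = 0] *)
pose e := J0 / (8 * (S ^+ 2 + 1)).
have S21 : 0 < S ^+ 2 + 1 by rewrite ltr_wpDl ?sqr_ge0.
have e0 : 0 < e by rewrite divr_gt0// mulr_gt0.
have [dl dl0 dlP] := AP _ e0.
have [n nP] : exists n, S / 2 ^+ n < dl.
  exists (Num.truncn (S / dl)).+1; rewrite ltr_pdivrMr ?exprn_gt0//.
  rewrite mulrC -ltr_pdivrMr//.
  apply: lt_trans (truncnS_gt _) _; rewrite -natrX ltr_nat; exact: ltn_expl.
have := okq n; move: (q n) (Jn n) (xP n) (yP n) => p Jp xp yp [g1 g2 g3 g4].
have lp : p.1 <= p.1 + l / 2 ^+ n by rewrite lerDl half0.
have hp : p.2 <= p.2 + h / 2 ^+ n by rewrite lerDl half0.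
have Hp : holo_rect F p.1 (p.1 + l / 2 ^+ n) p.2 (p.2 + h / 2 ^+ n).
  by apply: on_rectW H _ _ _ _.
pose z := pt x y.
(* the affine approximation of [F] at [z] *)
pose L w := A * w + (F z - A * z).
have cM (k : C) : continuous (fun w : C => k * w).
  exact: mulrl_continuous.
have cL : continuous (fun w => - L w).
  by move=> w; exact: (cvgN (cvgD (cM A w) (cvg_cst _))).
have cF := holo_rect_cont lp hp Hp.
have contE (G : C -> C) a' b' c' d' : continuous G -> cont_edges G a' b' c' d'.
  by move=> cG; split=> t _; split; exact: cG.
have EE : rectint F p.1 (p.1 + l / 2 ^+ n) p.2 (p.2 + h / 2 ^+ n) =
   rectint (fun w => F w + - L w) p.1 (p.1 + l / 2 ^+ n) p.2 (p.2 + h / 2 ^+ n).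
  rewrite rectintD; [|exact: cF|by apply: contE].
  have -> : (fun w => - L w) = (fun w => (- A) * w + (- (F z - A * z))).
    by apply/funext => w; rewrite /L; ring.
  rewrite rectintD; [|by apply: contE; exact: cM|by apply: contE; exact: cst_continuous].
  rewrite (rectint_cst _ lp hp) rectintZ; last by apply: contE => w; apply: cvg_id.
  by rewrite (rectint_id lp hp) mulr0 !addr0.
have Sn : S / 2 ^+ n = l / 2 ^+ n + h / 2 ^+ n by rewrite -mulrDl.
have bnd : on_edges (fun w => cabs (F w + - L w) <= e * (S / 2 ^+ n))
    p.1 (p.1 + l / 2 ^+ n) p.2 (p.2 + h / 2 ^+ n).
  apply: (@on_rect_edges _ (fun w => cabs (F w + - L w) <= e * (S / 2 ^+ n))
    _ _ _ _ lp hp) => x' y' x'p y'p.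
  have wz : cabs (pt x' y' - z) <= S / 2 ^+ n.
    apply: le_trans (cabs_le _) _; rewrite ReB ImB /cre /cim /= Sn.
    by apply: lerD; rewrite ler_norml; apply/andP; split;
      clear -x'p xp y'p yp; lra.
  have -> : F (pt x' y') + - L (pt x' y') = F (pt x' y') - F z - A * (pt x' y' - z).
    by rewrite /L; ring.
  apply: le_trans (dlP _ (le_lt_trans wz nP)) _.
  by rewrite ler_wpM2l// ltW.
have cFL : cont_edges (fun w => F w + - L w) p.1 (p.1 + l / 2 ^+ n) p.2 (p.2 + h / 2 ^+ n).
  split=> t tp; split.
  - by have [h1 _] := on_hedges cF tp; exact: (cvgD h1 (cL _)).
  - by have [_ h1] := on_hedges cF tp; exact: (cvgD h1 (cL _)).
  - by have [h1 _] := on_vedges cF tp; exact: (cvgD h1 (cL _)).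
  - by have [_ h1] := on_vedges cF tp; exact: (cvgD h1 (cL _)).
have := cabs_rectint lp hp cFL bnd; rewrite -EE => JJ.
have : J0 <= 4 ^+ n * (4 * (e * (S / 2 ^+ n)) * (S / 2 ^+ n)).
  apply: le_trans Jp _; rewrite ler_wpM2l ?exprn_ge0//.
  apply: le_trans JJ _; rewrite le_eqVlt; apply/orP; left; apply/eqP.
  by congr (_ * _); rewrite Sn; clear; lra.
have -> : 4 ^+ n * (4 * (e * (S / 2 ^+ n)) * (S / 2 ^+ n)) = 4 * e * S ^+ 2.
  have -> : (4 : R) ^+ n = 2 ^+ n * 2 ^+ n by rewrite -exprMn; congr (_ ^+ _); clear; lra.
  by field; rewrite expf_neq0.
have -> : 4 * e * S ^+ 2 = J0 / 2 * (S ^+ 2 / (S ^+ 2 + 1)).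
  by rewrite /e; field; rewrite lt0r_neq0//.
have : S ^+ 2 / (S ^+ 2 + 1) <= 1 by rewrite ler_pdivrMr// mul1r lerDl.
move=> /(ler_wpM2l (ltW (divr_gt0 J0_gt0 (ltr0n R 2)))); clear -J0_gt0; lra.
Qed.

End Cauchy.

(** * Cauchy's formula and Schwarz's lemma *)

Section CauchyFormula.
Context {R : realType}.
Local Notation C := (Cx R).
Implicit Types (z w : C) (F G : C -> C) (a b c d x y s r : R).

(** Goursat's theorem applies to the four rectangles that remain when the
    square around the exceptional point is removed. *)
Lemma rectint_cut G a b c d x y s : 0 < s ->
  a < x - s -> x + s < b -> c < y - s -> y + s < d ->
  on_rect (fun w => w != pt x y -> derivable G w 1) a b c d ->
  rectint G a b c d = rectint G (x - s) (x + s) (y - s) (y + s).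
Proof.
move=> s0 ax xb cy yd H.
have Hn u v : a <= u <= b -> c <= v <= d -> (u != x) || (v != y) ->
    derivable G (pt u v) 1.
  move=> uab vcd uv; apply: H => //; apply/eqP => -[ux vy].
  by move: uv; rewrite ux vy !eqxx.
have He a' b' c' d' : a <= a' -> a' <= b' -> b' <= b -> c <= c' -> c' <= d' -> d' <= d ->
    a' != x -> b' != x -> c' != y -> d' != y -> cont_edges G a' b' c' d'.
  move=> aa ab bb cc cd dd ax' bx' cy' dy'.
  by split=> t tab; split; apply: derivable_continuous; apply: Hn;
     rewrite ?ax' ?bx' ?cy' ?dy' ?orbT//; lra.
have l0 a' b' c' d' : a <= a' -> a' <= b' -> b' <= b -> c <= c' -> c' <= d' -> d' <= d ->
    (b' < x) \/ (x < a') \/ (d' < y) \/ (y < c') -> rectint G a' b' c' d' = 0.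
  move=> aa ab bb cc cd dd or4; apply: (goursat ab cd) => u v uab vcd.
  apply: Hn; [lra|lra|apply/orP].
  have [ux|ux] := eqVneq u x; last by left.
  by right; apply/eqP => vy; move: uab vcd; rewrite ux vy; lra.
have z1 : rectint G a (x - s) c d = 0 by apply: l0; (try (clear -s0 ax xb cy yd; lra)); left; lra.
have z2 : rectint G (x + s) b c d = 0 by apply: l0; (try (clear -s0 ax xb cy yd; lra)); right; left; lra.
have z3 : rectint G (x - s) (x + s) c (y - s) = 0.
  by apply: l0; (try (clear -s0 ax xb cy yd; lra)); do 2 right; left; lra.
have z4 : rectint G (x - s) (x + s) (y + s) d = 0.
  by apply: l0; (try (clear -s0 ax xb cy yd; lra)); do 3 right; lra.
have sx : x - s != x by rewrite lt_eqF//; lra.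
have sx' : x + s != x by rewrite gt_eqF//; lra.
have sy : y - s != y by rewrite lt_eqF//; lra.
have sy' : y + s != y by rewrite gt_eqF//; lra.
have ax' : a != x by rewrite lt_eqF//; lra.
have bx' : b != x by rewrite gt_eqF//; lra.
have cy' : c != y by rewrite lt_eqF//; lra.
have dy' : d != y by rewrite gt_eqF//; lra.
rewrite (@rectint_splitv _ (x - s)); [|lra|by apply: He => //; clear -s0 ax xb cy yd; lra].
rewrite (@rectint_splitv _ (x + s) _ (x - s)); [|lra|by apply: He => //; clear -s0 ax xb cy yd; lra].
rewrite (@rectint_splith _ (y - s) _ (x - s)); [|lra|by apply: He => //; clear -s0 ax xb cy yd; lra].
rewrite (@rectint_splith _ (y + s) _ (x - s) (x + s) (y - s));
  [|lra|by apply: He => //; clear -s0 ax xb cy yd; lra].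
rewrite z1 z2 z3 z4.
by rewrite !add0r !addr0.
Qed.

Lemma derivable_invB z w : w != z -> derivable (fun u : C => (u - z)^-1) w 1.
Proof.
move=> wz; apply: derivableV; first by rewrite subr_eq0.
by apply: derivableB; [exact: derivable_id|exact: derivable_cst].
Qed.

(** The integral is [2 i pi]; a lower bound suffices for what follows and
    is elementary: on each edge the relevant component of the kernel is at
    least [1 / (2 s)], so each edge contributes at least 1 to the imaginary
    part. *)
Lemma cauchy_kernel_bound x y s : 0 < s ->
  4 <= cabs (rectint (fun w => (w - pt x y)^-1) (x - s) (x + s) (y - s) (y + s)).
Proof.
move=> s0; apply: le_trans (Im_le_cabs _); apply: le_trans (ler_norm _).
pose g := (fun w : C => (w - pt x y)^-1).
have cE : cont_edges g (x - s) (x + s) (y - s) (y + s).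
  split=> t ts; split; apply: derivable_continuous; apply: derivable_invB;
    apply/eqP => -[]; lra.
have [[_ c1] [_ c2] [c3 _] [c4 _]] := cont_edgesP cE.
have cc (k a b : R) : cont_on a b (fun=> k) by move=> ? _; exact: cvg_cst.
have l1 : x - s <= x + s by lra.
have l2 : y - s <= y + s by lra.
have inv_re (u v : R) : cre ((pt u v)^-1) = u / (u ^+ 2 + v ^+ 2) by [].
have inv_im (u v : R) : cim ((pt u v)^-1) = - (v / (u ^+ 2 + v ^+ 2)) by [].
have key (t : R) : - s <= t <= s -> (2 * s)^-1 <= s / (t ^+ 2 + s ^+ 2).
  move=> ts; rewrite ler_pdivlMr; last by rewrite ltr_wpDl ?sqr_ge0// exprn_gt0.
  rewrite mulrC ler_pdivrMr ?mulr_gt0//; nra.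
have gE (u v : R) : g (pt u v) = (pt (u - x) (v - y))^-1 by [].
have ey : y - s - y = - s by lra.
have ey' : y + s - y = s by lra.
have ex : x - s - x = - s by lra.
have ex' : x + s - x = s by lra.
have h1 : 1 <= rint (cim \o (fun t => g (pt t (y - s)))) (x - s) (x + s).
  rewrite (_ : 1 = (2 * s)^-1 * (x + s - (x - s))); last by field; lra.
  rewrite -rint_cst//; apply: le_rint => //.
  move=> t ts; have -> : (cim \o (fun t => g (pt t (y - s)))) t = s / ((t - x) ^+ 2 + s ^+ 2).
    by rewrite /comp gE inv_im ey sqrrN mulNr opprK.
  by rewrite ?mulN1r ?opprK; apply: key; lra.
have h2 : 1 <= - rint (cim \o (fun t => g (pt t (y + s)))) (x - s) (x + s).
  rewrite [leLHS](_ : 1 = (2 * s)^-1 * (x + s - (x - s))); last by field; lra.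
  rewrite -rint_cst// -[leRHS]mulN1r -rintZ//; apply: le_rint => //.
    by move=> t ts; apply: cvgM; [exact: cvg_cst|exact: c2].
  move=> t ts; have -> : (cim \o (fun t => g (pt t (y + s)))) t = - (s / ((t - x) ^+ 2 + s ^+ 2)).
    by rewrite /comp gE inv_im ey'.
  by rewrite ?mulN1r ?opprK; apply: key; lra.
have h3 : 1 <= rint (cre \o (fun t => g (pt (x + s) t))) (y - s) (y + s).
  rewrite (_ : 1 = (2 * s)^-1 * (y + s - (y - s))); last by field; lra.
  rewrite -rint_cst//; apply: le_rint => //.
  move=> t ts; have -> : (cre \o (fun t => g (pt (x + s) t))) t = s / ((t - y) ^+ 2 + s ^+ 2).
    by rewrite /comp gE inv_re ex' (addrC (s ^+ 2)).
  by rewrite ?mulN1r ?opprK; apply: key; lra.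
have h4 : 1 <= - rint (cre \o (fun t => g (pt (x - s) t))) (y - s) (y + s).
  rewrite [leLHS](_ : 1 = (2 * s)^-1 * (y + s - (y - s))); last by field; lra.
  rewrite -rint_cst// -[leRHS]mulN1r -rintZ//; apply: le_rint => //.
    by move=> t ts; apply: cvgM; [exact: cvg_cst|exact: c3].
  move=> t ts; have -> : (cre \o (fun t => g (pt (x - s) t))) t = - (s / ((t - y) ^+ 2 + s ^+ 2)).
    by rewrite /comp gE inv_re ex sqrrN mulNr (addrC (s ^+ 2)).
  by rewrite ?mulN1r ?opprK; apply: key; lra.
rewrite /rectint ImD ImB ImM ReB /cint -/g.
rewrite /cim /cre /= -/cim -/cre; move: h1 h2 h3 h4; rewrite /g /=; clear; lra.
Qed.

(** Used to estimate a kernel with pole at the centre of the square: the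
    distance to the centre is between [s] and [2 s] on the boundary. *)
Lemma square_edges (P : C -> Prop) x y s : 0 < s ->
  (forall u v, x - s <= u <= x + s -> y - s <= v <= y + s ->
    s <= cabs (pt u v - pt x y) -> cabs (pt u v - pt x y) <= 2 * s -> P (pt u v)) ->
  on_edges P (x - s) (x + s) (y - s) (y + s).
Proof.
move=> s0 PP.
have le2 u v : x - s <= u <= x + s -> y - s <= v <= y + s ->
    cabs (pt u v - pt x y) <= 2 * s.
  move=> us vs; apply: le_trans (cabs_le _) _; rewrite ReB ImB /cre /cim /=.
  rewrite mulr_natl mulr2n.
  by apply: lerD; rewrite ler_norml; apply/andP; split; lra.
have far u v : s <= `|u - x| \/ s <= `|v - y| -> s <= cabs (pt u v - pt x y).
  case=> su; first by apply: le_trans (Re_le_cabs _); rewrite ReB.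
  by apply: le_trans (Im_le_cabs _); rewrite ImB.
have side u v : x - s <= u <= x + s -> y - s <= v <= y + s ->
    s <= `|u - x| \/ s <= `|v - y| -> P (pt u v).
  by move=> us vs uv; apply: PP => //; [exact: far|exact: le2].
have [xl xr] : s <= `|x - s - x| /\ s <= `|x + s - x|.
  by rewrite !ler_normr; split; apply/orP; [right|left]; lra.
have [yl yr] : s <= `|y - s - y| /\ s <= `|y + s - y|.
  by rewrite !ler_normr; split; apply/orP; [right|left]; lra.
by split=> t ts; split; apply: side => //; [lra|right|lra|right|lra|left|lra|left].
Qed.

(** Cauchy's formula up to an error: the contour is shrunk to a square
    around [z] so small that [F] is almost constant on it.  The factor [K] is
    the integral of the kernel over this square, and depends on [e]. *)
Lemma cauchy_approx F a b c d x y e : a < x -> x < b -> c < y -> y < d -> 0 < e ->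
  holo_rect F a b c d ->
  exists2 K : C, 4 <= cabs K &
    cabs (rectint (fun w => F w * (w - pt x y)^-1) a b c d - F (pt x y) * K) <= e.
Proof.
move=> ax xb cy yd e0 H; set z := pt x y.
have dF : derivable F z 1 by apply: H; lra.
(* on a square of half-side [s] the kernel is at most [1 / s], and
   [cabs_rectint] contributes 4 times twice the side: 16 in total *)
have e160 : 0 < e / 16 by lra.
have /continuous_CxP/(_ _ e160)[dl dl0 dlP] := derivable_continuous dF.
pose m := Num.min (Num.min (x - a) (b - x)) (Num.min (y - c) (d - y)).
have m0 : 0 < m by rewrite /m !lt_min; lra.
pose s := Num.min (m / 2) (dl / 3).
have s0 : 0 < s by rewrite lt_min; lra.
have sm : s < m by rewrite (@le_lt_trans _ _ (m / 2))// ?ge_min ?lexx//; lra.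
have sdl : s <= dl / 3 by rewrite ge_min lexx orbT.
have [sm1 sm2 sm3 sm4] : [/\ s < x - a, s < b - x, s < y - c & s < d - y].
  by move: sm; rewrite /m !lt_min => /andP[/andP[-> ->] /andP[-> ->]].
pose g w := (w - z)^-1.
have dg w : w != z -> derivable g w 1 by exact: derivable_invB.
exists (rectint g (x - s) (x + s) (y - s) (y + s)); first exact: cauchy_kernel_bound.
have -> : rectint (fun w => F w * (w - z)^-1) a b c d =
    rectint (fun w => F w * g w) (x - s) (x + s) (y - s) (y + s).
  apply: rectint_cut; [exact: s0|lra|lra|lra|lra|] => u v uab vcd uz.
  by apply: derivableM; [apply: H|apply: dg].
have edge P := @square_edges P x y s s0.
have nz u v : s <= cabs (pt u v - z) -> pt u v != z.
  by move=> h; rewrite -subr_eq0 -cabs_gt0; exact: lt_le_trans h.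
have cg : cont_edges g (x - s) (x + s) (y - s) (y + s).
  by apply: edge => u v us vs h1 h2; apply/derivable_continuous/dg/nz.
have cFg : cont_edges (fun w => F w * g w) (x - s) (x + s) (y - s) (y + s).
  apply: edge => u v us vs h1 h2; apply/derivable_continuous/derivableM.
    by apply: H; lra.
  exact/dg/nz.
have cFzg : cont_edges (fun w => - F z * g w) (x - s) (x + s) (y - s) (y + s).
  apply: edge => u v us vs h1 h2; apply/derivable_continuous/derivableM.
    exact: derivable_cst.
  exact/dg/nz.
rewrite -mulNr -(rectintZ _ cg) -(rectintD cFg cFzg).
have -> : e = 4 * (e / 16 / s) * ((x + s - (x - s)) + (y + s - (y - s))).
  by field; clear -s0; lra.
apply: cabs_rectint; [lra|lra|..].
  exact: cont_edgesD.
apply: edge => u v us vs h1 h2; rewrite -mulrDl cabsM cabsV.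
apply: ler_pM; rewrite ?cabs_ge0 ?invr_ge0 ?cabs_ge0//.
  by apply/ltW/dlP; apply: le_lt_trans h2 _; lra.
by rewrite lef_pV2// posrE; lra.
Qed.

(** The boundary integral in [cauchy_approx] is 0, so [4 |F z|] is at
    most the error, which may be chosen to be [|F z|]. *)
Lemma holo_zero_edges F a b c d x y : a < x -> x < b -> c < y -> y < d ->
  holo_rect F a b c d -> on_edges (fun w => F w = 0) a b c d -> F (pt x y) = 0.
Proof.
move=> ax xb cy yd H F0; apply/eqP; rewrite -cabs_eq0 eq_le cabs_ge0 andbT.
rewrite leNgt; apply/negP => Fz.
have [K K4] := cauchy_approx ax xb cy yd Fz H.
have -> : rectint (fun w => F w * (w - pt x y)^-1) a b c d = rectint (fun=> 0) a b c d.
  by apply: eq_rectint; split=> t tab; split;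
    [have [-> _] := on_hedges F0 tab|have [_ ->] := on_hedges F0 tab|
     have [-> _] := on_vedges F0 tab|have [_ ->] := on_vedges F0 tab]; rewrite mul0r.
rewrite rectint_cst ?sub0r ?cabsN ?cabsM; nra.
Qed.

(** Cauchy's formula at [z] and at 0: the difference of the two kernels is
    [z / (w (w - z))], which produces the factor [|z|]. *)
Lemma schwarz_bound F r M z : 0 < r -> holo_rect F (- r) r (- r) r -> F 0 = 0 ->
  on_edges (fun w => cabs (F w) <= M) (- r) r (- r) r ->
  cabs z <= r / 2 -> cabs (F z) <= 8 * M / r * cabs z.
Proof.
move=> r0 H F0 FM zr.
have M0 : 0 <= M.
  have t0 : - r <= 0 <= r by lra.
  have [h _] := on_hedges FM t0.
  exact: le_trans (cabs_ge0 _) h.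
have zE : z = pt (cre z) (cim z) by case: (z).
have := le_trans (Re_le_cabs z) zr; rewrite ler_norml => /andP[z1 z2].
have := le_trans (Im_le_cabs z) zr; rewrite ler_norml => /andP[z3 z4].
have l1 : - r <= r by lra.
have edge (P : C -> Prop) : (forall u v, - r <= u <= r -> - r <= v <= r ->
    r <= cabs (pt u v) -> P (pt u v)) ->
    on_edges P (- r) r (- r) r.
  have := @square_edges P 0 0 r r0; rewrite !sub0r !add0r => sq PP.
  by apply: sq => u v us vs; rewrite subr0 => ru _; apply: PP.
have far u : r <= cabs u -> r / 2 <= cabs (u - z).
  move=> ru; have := cabsD (u - z) z; rewrite subrK; lra.
have nz (z' : C) u : cabs z' <= r / 2 -> r <= cabs u -> u != z'.
  move=> zr' ru; apply/eqP => uz; move: ru; rewrite uz; lra.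
have cq (z' : C) : cabs z' <= r / 2 ->
    cont_edges (fun w => F w * (w - z')^-1) (- r) r (- r) r.
  move=> zr'; apply: edge => u v us vs ru; apply/derivable_continuous/derivableM.
    exact: H.
  exact/derivable_invB/nz.
apply/ler_addgt0Pr => e e0.
have [||||K K4] := @cauchy_approx F (- r) r (- r) r (cre z) (cim z) e _ _ _ _ e0 H;
  try lra.
have [||||K' K4'] := @cauchy_approx F (- r) r (- r) r 0 0 e _ _ _ _ e0 H; try lra.
have -> : pt 0 0 = 0 :> C by [].
rewrite F0 mul0r subr0 -zE => h1 h2.
have cz0 : cabs (0 : C) <= r / 2 by rewrite cabs0; lra.
pose I1 := rectint (fun w => F w * (w - 0)^-1) (- r) r (- r) r.
pose I2 := rectint (fun w => F w * (w - z)^-1) (- r) r (- r) r.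
have I12 : cabs (I2 - I1) <= 4 * (2 * M / r ^+ 2 * cabs z) * ((r - - r) + (r - - r)).
  have -> : I2 - I1 = I2 + -1 * I1 by ring.
  rewrite /I2 /I1 -(rectintZ _ (cq 0 cz0)).
  have cq' : cont_edges (fun w => -1 * (F w * (w - 0)^-1)) (- r) r (- r) r.
    apply: edge => u v us vs ru; apply: derivable_continuous.
    apply: derivableM; first exact: derivable_cst.
    apply: derivableM; first exact: H.
    exact/derivable_invB/nz.
  rewrite -(rectintD (cq z zr) cq').
  apply: (cabs_rectint l1 l1 (cont_edgesD (cq z zr) cq')).
  have : on_edges (fun w => r <= cabs w) (- r) r (- r) r by apply: edge.
  move: FM => [FM1 FM2] [E1 E2].
  have main w : cabs (F w) <= M -> r <= cabs w ->
     cabs (F w * (w - z)^-1 + -1 * (F w * (w - 0)^-1)) <= 2 * M / r ^+ 2 * cabs z.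
    move=> FwM rw.
    have w0 : w != 0 := nz _ _ cz0 rw.
    have wz : w - z != 0 by rewrite subr_eq0 (nz _ _ zr rw).
    have -> : F w * (w - z)^-1 + -1 * (F w * (w - 0)^-1) = F w * (w^-1 * (w - z)^-1) * z.
      rewrite subr0; field; by rewrite w0 wz.
    rewrite !cabsM !cabsV ler_wpM2r ?cabs_ge0//.
    have -> : 2 * M / r ^+ 2 = M * (r^-1 * (r / 2)^-1) by field; lra.
    rewrite ler_pM ?mulr_ge0 ?invr_ge0 ?cabs_ge0//.
    have fr := far _ rw.
    by rewrite ler_pM ?invr_ge0 ?cabs_ge0 ?lef_pV2 ?posrE//; clear -rw fr r0; lra.
  split=> t ts; split; apply: main.
  - by have [] := FM1 t ts.
  - by have [] := E1 t ts.
  - by have [] := FM1 t ts.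
  - by have [] := E1 t ts.
  - by have [] := FM2 t ts.
  - by have [] := E2 t ts.
  - by have [] := FM2 t ts.
  - by have [] := E2 t ts.
have e1 : 4 * (2 * M / r ^+ 2 * cabs z) * ((r - - r) + (r - - r)) = 4 * (8 * M / r * cabs z).
  by field; clear -r0; lra.
rewrite e1 in I12.
have : cabs (F z * K) <= 4 * (8 * M / r * cabs z) + 2 * e.
  have -> : F z * K = (I2 - I1) + I1 - (I2 - F z * K) by ring.
  apply: le_trans (cabsD _ _) _; rewrite cabsN.
  have := cabsD (I2 - I1) I1; rewrite -/I1 in h2; rewrite -/I2 in h1; lra.
rewrite cabsM; have := cabs_ge0 (F z); nra.
Qed.

End CauchyFormula.

(** * Holomorphic functions of several variables *)

Section SeveralVariables.
Context {R : realType} {n : nat}.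
Local Notation C := (Cx R).
Local Notation Cn := 'rV[C]_n.
Implicit Types (x y v : Cn) (f h : Cn -> C).

Lemma nbhs_rVP x (P : set Cn) :
  nbhs x P <-> exists2 d : R, 0 < d & forall y, (forall i, cabs (y 0 i - x 0 i) < d) -> P y.
Proof.
split=> [/nbhs_ballP[e /= /ltc_pos[d d0 ->] eP]|[d d0 dP]].
  exists d => // y yd; apply: eP; split=> [|i j]; first by rewrite ltcR.
  rewrite (ord1 i).
  by rewrite -ball_normE /= normr_cabs cabsB ltcR.
apply/nbhs_ballP; exists (d%:C)%C; first by rewrite /= ltcR.
move=> y /= [_ xy]; apply: dP => i.
by have := xy 0 i; rewrite -ball_normE /= normr_cabs ltcR cabsB.
Qed.

Lemma differentiable_slice f x v (t : C) : differentiable f (x + t *: v) ->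
  derivable (fun s : C => f (x + s *: v)) t 1.
Proof.
move=> df; apply/derivable1_diffP.
apply: (@differentiable_comp _ _ _ _ (fun s : C => x + s *: v) f) => //.
Qed.

(** Schwarz's lemma in the variable of index [i0], the others being
    frozen.  It bounds any equation of the hyperplane by the coordinate. *)
Lemma vanishing_lipschitz h x i0 : (\forall y \near x, differentiable h y) ->
  x 0 i0 = 0 -> h x = 0 -> (\forall y \near x, (y : Cn) 0 i0 = 0 -> h y = 0) ->
  exists K d : R, [/\ 0 < K, 0 < d & forall y, (forall i, cabs (y 0 i - x 0 i) < d) ->
     cabs (h y) <= K * cabs (y 0 i0)].
Proof.
move=> dh x0 hx h0.
have hx1 : \forall y \near x, cabs (h y) < 1.
  have /differentiable_continuous hc : differentiable h x by exact: nbhs_singleton dh.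
  have := (@cvg_CxP _ _ h (nbhs x) (nbhs_filter x) (h x)).1 hc _ ltr01.
  by apply: filterS => y; rewrite hx subr0.
have /nbhs_rVP[d d0 dP] : \forall y \near x,
    [/\ differentiable h y, (y : Cn) 0 i0 = 0 -> h y = 0 & cabs (h y) < 1].
  by near=> y; split; near: y.
pose r := d / 3; have r0 : 0 < r by rewrite /r; lra.
exists (8 / r), (r / 2); split; [exact: divr_gt0|lra|] => y yx.
pose e : Cn := delta_mx 0 i0.
pose p (t : C) : Cn := y + (t - y 0 i0) *: e.
have pi0 t : p t 0 i0 = t by rewrite !mxE !eqxx /= mulr1 addrC subrK.
have pi t i : i != i0 -> p t 0 i = y 0 i.
  by move=> ii; rewrite !mxE eqxx/= (negbTE ii) mulr0 addr0.
have pd t : cabs t < d -> forall i, cabs (p t 0 i - x 0 i) < d.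
  move=> td i; have [->|ii] := eqVneq i i0; first by rewrite pi0 x0 subr0.
  by rewrite pi//; apply: lt_trans (yx i) _; rewrite /r; lra.
pose F (t : C) := h (p t).
have sq (u v' : R) : - r <= u <= r -> - r <= v' <= r -> cabs (pt u v') < d.
  move=> us vs; apply: le_lt_trans (cabs_le _) _; rewrite /cre /cim /=.
  have : `|u| <= r by rewrite ler_norml.
  have : `|v'| <= r by rewrite ler_norml.
  rewrite /r; lra.
have dF t : cabs t < d -> derivable F t 1.
  move=> td; have -> : F = (fun s => h ((y - y 0 i0 *: e) + s *: e)).
    apply/funext => s; rewrite /F /p; congr h.
    by rewrite scalerBl addrA addrAC.
  apply: differentiable_slice.
  have -> : y - y 0 i0 *: e + t *: e = p t by rewrite /p scalerBl addrA addrAC.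
  by have [] := dP _ (pd _ td).
have yE : y = p (y 0 i0) by rewrite /p subrr scale0r addr0.
have yi0 : cabs (y 0 i0) <= r / 2 by have := yx i0; rewrite x0 subr0 => /ltW.
have -> : h y = F (y 0 i0) by rewrite /F -yE.
have Fle t : cabs t < d -> cabs (F t) <= 1.
  by move=> td; have [_ _ /ltW] := dP _ (pd _ td).
have -> : 8 / r = 8 * 1 / r by rewrite mulr1.
have c0 : cabs (0 : C) < d by rewrite cabs0.
apply: schwarz_bound => //.
- by move=> u v' us vs; apply: dF; exact: sq.
- by rewrite /F; have [_ -> //] := dP _ (pd _ c0).
- have l1 : - r <= r by lra.
  apply: (@on_rect_edges _ (fun w => cabs (F w) <= 1) _ _ _ _ l1 l1) => u v' us vs.
  by apply: Fle; exact: sq.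
Unshelve. all: by end_near. Qed.

Definition polydisc (x : Cn) (r : R) : set Cn := [set y | forall i, cabs (y 0 i - x 0 i) < r].

Lemma open_polydisc x r : open (polydisc x r).
Proof.
rewrite openE => z Wz; rewrite /interior.
apply: (@filter_forall _ _ (fun i (y : Cn) => cabs (y 0 i - x 0 i) < r) (nbhs z) (nbhs_filter z)) => i.
apply: (nbhs_rVP z [set y : Cn | cabs (y 0 i - x 0 i) < r]).2.
exists (r - cabs (z 0 i - x 0 i)); first by have := Wz i; lra.
move=> y /(_ i) yz /=; have := cabsD (y 0 i - z 0 i) (z 0 i - x 0 i).
by rewrite addrA subrK; lra.
Qed.

End SeveralVariables.

(** * The mean value property of log |1 + b w| *)

Section CircleMean.
Context {R : realType}.
Local Notation C := (Cx R).

Lemma rint_shift (g : R -> R) (a b c : R) : a <= b -> continuous g ->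
  rint g (a + c) (b + c) = rint (fun t => g (t + c)) a b.
Proof.
move=> ab cg; pose F (t : R) := t + c.
have F' : (F : R^o -> R^o)^`()%classic = cst 1.
  apply/funext => t; rewrite derive1E.
  have dF : is_derive (t : R) (1 : R) F 1 by apply: is_derive_eq; rewrite addr0.
  by rewrite derive_val.
have cF x : {for x, continuous F} by apply: cvgD; [exact: cvg_id|exact: cvg_cst].
rewrite /rint /Rintegral.
rewrite (@integration_by_substitution_increasing _ F g a b ab).
- by congr fine; apply: eq_integral => t _; rewrite F' /= mulr1.
- by move=> x y _ _ xy; rewrite /F ltrD2r.
- by move=> x _; rewrite F'; exact: cst_continuous.
- by rewrite F'; exact: is_cvg_cst.
- by rewrite F'; exact: is_cvg_cst.
- split.
  + by move=> x _; apply: derivableD; [exact: derivable_id|exact: derivable_cst].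
  + by apply: cvg_at_right_filter; exact: cF.
  + by apply: cvg_at_left_filter; exact: cF.
- by apply: continuous_subspaceT.
Qed.

Lemma rint_periodic (g : R -> R) T c : 0 <= c <= T -> continuous g ->
  (forall t, g (t + T) = g t) -> rint (fun t => g (t + c)) 0 T = rint g 0 T.
Proof.
move=> c0T cg gT; have cO a b : cont_on a b g by move=> x _; exact: cg.
rewrite -rint_shift//; last lra.
rewrite add0r (@rint_split _ T); [|lra|exact: cO].
rewrite (_ : rint g T (T + c) = rint g 0 c).
  rewrite addrC -rint_split//.
have := @rint_shift g 0 c T; rewrite add0r addrC => ->//; last lra.
by apply: eq_rint => t _; rewrite gT.
Qed.

Definition expi (t : R) : C := pt (cos t) (sin t).

Lemma cabs_expi t : cabs (expi t) = 1.
Proof. by rewrite cabsE /cre /cim /= cos2Dsin2 sqrtr1. Qed.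

Lemma expiD s t : expi (s + t) = expi s * expi t.
Proof.
by apply: Cx_eq; rewrite ?ReM ?ImM/= /cre /cim /= ?cosD ?sinD//; ring.
Qed.

Lemma expi_pi : expi pi = -1.
Proof. by apply: Cx_eq; rewrite /cre /cim /= ?cospi ?sinpi ?oppr0. Qed.

Lemma expi_2piM (k : nat) t : expi (t + 2 * pi * k%:R) = expi t.
Proof.
have e2 : expi (2 * pi) = 1.
  by rewrite mulr_natl mulr2n expiD expi_pi mulrNN mulr1.
elim: k => [|k IH]; first by rewrite mulr0 addr0.
rewrite -[in RHS]IH -[k.+1%:R]natr1 mulrDr mulr1 addrA expiD.
by rewrite e2 mulr1.
Qed.

Lemma continuous_cabs_line (f g : R -> R) : continuous f -> continuous g ->
  continuous (fun t => cabs (pt (f t) (g t))).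
Proof.
move=> cf cg t; rewrite /cabs /=.
apply: (@continuous_comp _ _ _ (fun t => f t ^+ 2 + g t ^+ 2) Num.sqrt); last exact: sqrt_continuous.
apply: cvgD; apply: (@continuous_comp _ _ _ _ (fun x : R => x ^+ 2));
  by [exact: cf|exact: cg|exact: exprn_continuous].
Qed.

(** The frequency [N] is kept as a parameter because the recursion of
    [ringlog_double] doubles it. *)
Definition ringlog (N : nat) (b : C) (t : R) := ln (cabs (1 + b * expi (N%:R * t))).

Lemma ringlog_bounds N b t : cabs b < 1 ->
  1 - cabs b <= cabs (1 + b * expi (N%:R * t)) <= 1 + cabs b.
Proof.
move=> b1; have e1 : cabs (b * expi (N%:R * t)) = cabs b by rewrite cabsM cabs_expi mulr1.
have := cabsD 1 (b * expi (N%:R * t)); rewrite e1 cabs1 => ->; rewrite andbT.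
have := cabsD (1 + b * expi (N%:R * t)) (- (b * expi (N%:R * t))).
by rewrite cabsN e1 addrK cabs1; lra.
Qed.

Lemma continuous_circle (a b : C) (k : R) :
  continuous (fun t : R => cabs (a + b * expi (k * t))).
Proof.
have kc : continuous (fun t : R => k * t) by exact: mulrl_continuous.
have -> : (fun t => cabs (a + b * expi (k * t))) =
  (fun t => cabs (pt (cre a + (cre b * cos (k * t) - cim b * sin (k * t)))
                     (cim a + (cre b * sin (k * t) + cim b * cos (k * t))))).
  apply/funext => t; congr cabs; apply: Cx_eq; rewrite ?ReD ?ReM ?ImD ?ImM /cre /cim /=; ring.
have cc : continuous (fun t => cos (k * t)).
  by move=> t; apply: continuous_comp; [exact: kc|exact: continuous_cos].
have cs : continuous (fun t => sin (k * t)).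
  by move=> t; apply: continuous_comp; [exact: kc|exact: continuous_sin].
have cM (l : R) (f : R -> R) : continuous f -> continuous (fun t => l * f t).
  by move=> cf t; apply: cvgM; [exact: cvg_cst|exact: cf].
apply: continuous_cabs_line => t.
  apply: cvgD; first exact: cvg_cst.
  by apply: cvgB; exact: cM.
apply: cvgD; first exact: cvg_cst.
by apply: cvgD; exact: cM.
Qed.

Lemma ringlog_continuous N b : cabs b < 1 -> continuous (ringlog N b).
Proof.
move=> b1 t; apply: continuous_comp; first exact: continuous_circle.
by apply: continuous_ln; have := ringlog_bounds N t b1; lra.
Qed.

(** Translating [t] by [pi / N] changes [b] into [- b] and keeps the
    integral, while [(1 + u) (1 - u) = 1 - u^2]. *)
Lemma ringlog_double N b : (0 < N)%N -> cabs b < 1 ->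
  2 * rint (ringlog N b) 0 (2 * pi) = rint (ringlog (N * 2) (- b ^+ 2)) 0 (2 * pi).
Proof.
move=> N0 b1; have pi0 := pi_gt0 R.
have NR : 0 < N%:R :> R by rewrite ltr0n.
have N1 : 1 <= N%:R :> R by rewrite ler1n.
have cb : cont_on 0 (2 * pi) (ringlog N b) by move=> t _; exact: ringlog_continuous.
have bN1 : cabs (- b) < 1 by rewrite cabsN.
have cNb : cont_on 0 (2 * pi) (ringlog N (- b)) by move=> t _; exact: ringlog_continuous.
have shift : rint (ringlog N (- b)) 0 (2 * pi) = rint (ringlog N b) 0 (2 * pi).
  rewrite -(@rint_periodic (ringlog N b) (2 * pi) (pi / N%:R)).
  - apply: eq_rint => t _; rewrite /ringlog mulrDr expiD.
    rewrite (_ : N%:R * (pi / N%:R) = pi); last by field; lra.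
    by rewrite expi_pi; congr (ln (cabs _)); ring.
  - apply/andP; split; first by apply: divr_ge0; exact: ltW.
    by rewrite ler_pdivrMr//; nra.
  - exact: ringlog_continuous.
  - move=> t; rewrite /ringlog mulrDr (_ : N%:R * (2 * pi) = 2 * pi * N%:R); last by ring.
    by rewrite expi_2piM.
rewrite mulr_natl mulr2n -{2}shift -rintD//.
apply: eq_rint => t _; rewrite /ringlog.
have h1 := ringlog_bounds N t b1.
have h2 := ringlog_bounds N t bN1.
rewrite -lnM ?posrE; [|lra|move: h2; rewrite cabsN; lra].
rewrite -cabsM; congr (ln (cabs _)).
rewrite natrM -mulrA (mulrC 2 t) mulrA (mulr_natr _ 2) mulr2n expiD; ring.
Qed.

(** Each application of [ringlog_double] multiplies the integral by 2,
    yet all these integrals are bounded by the same constant. *)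
Lemma ringlog_mean0 b : cabs b < 1 -> rint (ringlog 1 b) 0 (2 * pi) = 0.
Proof.
move=> b1; have pi0 := pi_gt0 R; pose r := cabs b.
have r0 : 0 <= r := cabs_ge0 b.
have pi20 : 0 <= 2 * pi :> R by lra.
pose M := r / (1 - r).
have M0 : 0 <= M by rewrite divr_ge0//; rewrite /r; lra.
(* the bound [M] on the integrand comes from [ln (1 + x) <= x] applied to the
   extreme values [1 + r] and [1 / (1 - r)] *)
have bnd N c : cabs c <= r -> `|rint (ringlog N c) 0 (2 * pi)| <= M * (2 * pi).
  move=> cr; have c1 : cabs c < 1 by apply: le_lt_trans cr b1.
  rewrite -{2}[2 * pi]subr0; apply: le_abs_rint => //.
    by move=> t _; exact: ringlog_continuous.
  move=> t _; have /andP[h1 h2] := ringlog_bounds N t c1.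
  have c0 := cabs_ge0 c.
  rewrite /ringlog; set u := cabs (1 + _) in h1 h2 *.
  have u0 : 0 < u by lra.
  have rM : r <= M by rewrite /M ler_pdivlMr; rewrite -/r in b1; nra.
  rewrite ler_norml; apply/andP; split.
    rewrite lerNl -lnV ?posrE//.
    have -> : u^-1 = 1 + (u^-1 - 1) by ring.
    have ui : u^-1 <= (1 - r)^-1 by rewrite lef_pV2 ?posrE//; rewrite -/r in b1; lra.
    have u1 : 0 < u^-1 by rewrite invr_gt0.
    apply: le_trans (le_ln1Dx _) _; first lra.
    have -> : M = (1 - r)^-1 - 1 by rewrite /M; field; rewrite -/r in b1; lra.
    lra.
  have -> : u = 1 + (u - 1) by ring.
  by apply: le_trans (le_ln1Dx _) _; lra.
have iter_ n : exists2 c : C, cabs c <= r &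
   2 ^+ n * rint (ringlog 1 b) 0 (2 * pi) = rint (ringlog (2 ^ n) c) 0 (2 * pi).
  elim: n => [|n [c cr IH]]; first by exists b; rewrite // expr0 mul1r expn0.
  have c1 : cabs c < 1 := le_lt_trans cr b1.
  exists (- c ^+ 2); first by rewrite cabsN cabsX; have := cabs_ge0 c; rewrite -/r in b1; nra.
  by rewrite exprS -mulrA IH expnSr; apply: ringlog_double => //; rewrite expn_gt0.
apply/eqP; rewrite -normr_eq0 eq_le normr_ge0 andbT leNgt; apply/negP => J0.
set J := rint _ _ _ in J0 iter_.
pose B := M * (2 * pi).
have [n nP] : exists n : nat, B / `|J| < 2 ^+ n.
  exists (Num.truncn (B / `|J|)).+1.
  apply: lt_trans (truncnS_gt _) _; rewrite -natrX ltr_nat; exact: ltn_expl.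
have [c cr E] := iter_ n.
have := bnd (2 ^ n)%N c cr; rewrite -E normrM ger0_norm ?exprn_ge0//.
by rewrite ltr_pdivrMr// in nP; rewrite -/B; lra.
Qed.

End CircleMean.

(** * The logarithmic pole *)

Section LogPole.
Context {R : realType}.
Local Notation C := (Cx R).

Lemma near_CxP (z : C) (P : set C) (d : R) : 0 < d ->
  (forall w, cabs (w - z) < d -> P w) -> \forall w \near z, P w.
Proof. by move=> d0 dP; apply: (nbhs_CxP z P).2; exists d. Qed.

(** Being infinite at the pole makes [ell] continuous as an extended
    real-valued function. *)
Definition ell (z : C) : \bar R := if z == 0 then +oo%E else (- ln (cabs z))%:E.

Lemma ell0 : ell 0 = +oo%E. Proof. by rewrite /ell eqxx. Qed.

Lemma ell_neq0 z : z != 0 -> ell z = (- ln (cabs z))%:E.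
Proof. by rewrite /ell => /negbTE ->. Qed.

Lemma ell_ge (z : C) r : 0 < r -> cabs z <= r -> ((- ln r)%:E <= ell z)%E.
Proof.
move=> r0 zr; rewrite /ell; case: eqP => [_|/eqP z0]; first exact: leey.
by rewrite lee_fin lerN2 ler_ln// posrE cabs_gt0.
Qed.

Lemma ell_ge0 (z : C) : cabs z <= 1 -> (0 <= ell z)%E.
Proof. by move=> /(ell_ge ltr01); rewrite ln1 oppr0. Qed.

Lemma ell_le (z : C) r : 0 < r -> r <= cabs z -> (ell z <= (- ln r)%:E)%E.
Proof.
move=> r0 rz; have cz : 0 < cabs z by apply: lt_le_trans rz.
by rewrite ell_neq0 -?cabs_gt0// lee_fin lerN2 ler_ln ?posrE.
Qed.

Lemma continuous_cabs : continuous (@cabs R).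
Proof.
move=> z; apply/(@cvgrPdist_lt _ _ _ (nbhs z) (nbhs_filter z)) => e e0; apply: (near_CxP e0) => w wz.
apply: le_lt_trans wz; have h1 := cabsD (w - z) z; have h2 := cabsD (z - w) w.
by rewrite ?subrK in h1 h2; rewrite (cabsB z w) in h2; rewrite ler_norml; lra.
Qed.

Lemma continuous_ell : continuous ell.
Proof.
move=> z; have [->|z0] := eqVneq z 0.
  rewrite /continuous_at ell0; apply/(@cvgeyPge _ _ (nbhs (0 : C)) (nbhs_filter _)) => A.
  apply: (near_CxP (expR_gt0 (- A))) => w; rewrite subr0 => /ltW /(ell_ge (expR_gt0 _)).
  by rewrite expRK opprK.
have cz : 0 < cabs z by rewrite cabs_gt0.
rewrite /continuous_at ell_neq0//.
have nz : \forall w \near z, w != 0.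
  apply: (near_CxP cz) => w wz; apply/eqP => w0.
  by move: wz; rewrite w0 sub0r cabsN ltxx.
apply: (@cvg_trans _ ((fun w => (- ln (cabs w))%:E) @ nbhs z)).
  apply: (@near_eq_cvg _ _ (nbhs z) (nbhs_filter z)).
  by apply: (@filterS _ (nbhs z) (nbhs_filter z) _ _ _ nz) => w w0; rewrite ell_neq0.
apply: (@cvg_EFin _ _ (nbhs z) (nbhs_filter z)); first exact: nearW.
apply: (@cvgN _ _ _ (nbhs z) (nbhs_filter z)).
apply: (@cvg_comp _ _ _ (@cabs R) (@ln R)); first exact: continuous_cabs.
exact: continuous_ln.
Qed.

Lemma measurable_ell (d : measure_display) (T : measurableType d) (D : set T) (u v : T -> R) :
  measurable D -> measurable_fun D u -> measurable_fun D v ->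
  measurable_fun D ((fun t => ell (pt (u t) (v t))) : T -> \bar R).
Proof.
move=> mD mu mv.
pose r t := Num.sqrt (u t ^+ 2 + v t ^+ 2).
have mr : measurable_fun D r.
  have ms : measurable_fun [set: R] (@Num.sqrt R).
    by apply: continuous_measurable_fun; exact: sqrt_continuous.
  apply: (measurableT_comp ms).
  by apply: measurable_funD; exact: measurable_funX.
have -> : (fun t => ell (pt (u t) (v t))) =
    (fun t => if r t == 0 then +oo%E else (- ln (r t))%:E).
  by apply/funext => t; rewrite /ell -cabs_eq0.
apply: measurable_fun_if => //.
- apply: (measurable_fun_bool true); rewrite /=.
  by apply: measurable_fun_eqr => //; exact: measurable_cst.
- apply/measurable_EFinP; apply: measurableT_comp => //.
  by apply: measurableT_comp => //; apply: measurable_funS mr => // ? [].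
Qed.

Definition conjp (z : C) : C := pt (cre z) (- cim z).

Lemma cabs_conjp z : cabs (conjp z) = cabs z.
Proof. by rewrite !cabsE /cre /cim /= sqrrN. Qed.

(** On the unit circle [|a + b w|] is the modulus of
    [conj a + conj b w^-1], hence of [conj b + conj a w]: the two radii
    [|a|] and [|b|] can be exchanged. *)
Lemma cabs_circle_swap (a b : C) t :
  cabs (a + b * expi t) = cabs (conjp b + conjp a * expi t).
Proof.
rewrite -(cabs_conjp (a + b * expi t)) -[LHS]mul1r -(cabs_expi t) -cabsM; congr cabs.
have h := cos2Dsin2 t.
apply: Cx_eq; rewrite !(ReM, ImM) /conjp !(ReD, ImD, ReM, ImM) /cre /cim /=.
  rewrite -[X in _ = X + _]mulr1 -h; ring.
rewrite -[X in _ = X + _]mulr1 -h; ring.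
Qed.

(** The closed disc misses the pole, and [ell] is harmonic there. *)
Lemma ell_mean_lt (a b : C) : cabs b < cabs a ->
  (\int[lebesgue_measure]_(t in `[0%R, (2 * pi)%R]) ell (a + b * expi t) = (2 * pi)%:E * ell a)%E.
Proof.
move=> ba; have ca : 0 < cabs a by apply: le_lt_trans ba; exact: cabs_ge0.
have a0 : a != 0 by rewrite -cabs_gt0.
have pi0 := pi_gt0 R.
pose c := b / a; have c1 : cabs c < 1 by rewrite cabsM cabsV ltr_pdivrMr// mul1r.
have E t : ell (a + b * expi t) = (- ln (cabs a) - ringlog 1 c t)%:E.
  have -> : a + b * expi t = a * (1 + c * expi t) by rewrite /c; field.
  have := ringlog_bounds 1 t c1; rewrite mul1r => h.
  have h1 : 0 < cabs (1 + c * expi t) by lra.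
  rewrite ell_neq0; last by rewrite mulf_neq0// -cabs_gt0.
  by rewrite cabsM lnM ?posrE// opprD /ringlog mul1r.
under eq_integral do rewrite E.
have c1' : cont_on 0 (2 * pi) (ringlog 1 c) by move=> t _; exact: ringlog_continuous.
have cc : cont_on 0 (2 * pi) (fun=> - ln (cabs a)) by move=> t _; exact: cvg_cst.
have cd : cont_on 0 (2 * pi) (fun t => - ln (cabs a) - ringlog 1 c t).
  by move=> t tp; apply: cvgB; [exact: cc|exact: c1'].
rewrite -[LHS]fineK; last by apply: integrable_fin_num => //; exact: cont_on_integrable.
rewrite -/(Rintegral _ _ _) -/(rint _ _ _) rintB// ringlog_mean0// subr0.
by rewrite rint_cst ?ell_neq0 -?EFinM ?subr0 1?mulrC//; lra.
Qed.

Lemma measurable_ell_circle (a b : C) (D : set R) : measurable D ->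
  measurable_fun D ((fun t => ell (a + b * expi t)) : R -> \bar R).
Proof.
move=> mD.
have cM (l : R) (f : R -> R) : continuous f -> continuous (fun t => l * f t).
  by move=> cf t; apply: cvgM; [exact: cvg_cst|exact: cf].
have mc (f : R -> R) : continuous f -> measurable_fun D f.
  by move=> cf; apply: measurable_funTS; exact: continuous_measurable_fun.
have -> : (fun t => ell (a + b * expi t)) = (fun t =>
  ell (pt (cre a + (cre b * cos t - cim b * sin t))
                     (cim a + (cre b * sin t + cim b * cos t)))).
  apply/funext => t; congr ell.
  by apply: Cx_eq; rewrite ?ReD ?ReM ?ImD ?ImM /cre /cim /=; ring.
apply: measurable_ell => //; apply: mc => t.
  apply: cvgD; first exact: cvg_cst.
  by apply: cvgB; apply: cM; [exact: continuous_cos|exact: continuous_sin].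
apply: cvgD; first exact: cvg_cst.
by apply: cvgD; apply: cM; [exact: continuous_sin|exact: continuous_cos].
Qed.

(** If [|b| < |a|], the disc misses the pole.  If [|a| < |b|], exchange
    the two.  If [|a| = |b|] is not 0, the pole is on the circle; Fatou's lemma applies
    on slightly smaller circles, [ell] being nonnegative on the unit disc. *)
Lemma ell_superharmonic (a b : C) :
  (forall z : C, cabs z <= 1 -> cabs (a + z * b) <= 1) ->
  (\int[lebesgue_measure]_(t in `[0%R, (2 * pi)%R]) ell (a + b * expi t) <= (2 * pi)%:E * ell a)%E.
Proof.
move=> ab1; have pi0 := pi_gt0 R.
have pi20 : 0 < 2 * pi :> R by lra.
have [->|a0] := eqVneq a 0.
  by rewrite ell0 gt0_muley ?lte_fin// leey.
have ca : 0 < cabs a by rewrite cabs_gt0.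
have [ba|ab|ba] := ltgtP (cabs b) (cabs a).
- by rewrite ell_mean_lt.
- have E t : ell (a + b * expi t) = ell (conjp b + conjp a * expi t).
    by rewrite /ell -!cabs_eq0 cabs_circle_swap.
  under eq_integral do rewrite E.
  rewrite ell_mean_lt ?cabs_conjp//.
  have cb : 0 < cabs b by apply: lt_trans ab.
  rewrite lee_pmul2l ?lte_fin// ell_neq0 -?cabs_gt0 ?cabs_conjp//.
  by rewrite ell_neq0// lee_fin lerN2 ler_ln ?posrE// ltW.
(* the case [|a| = |b|], by circles of radius [r k |b|] *)
pose r (k : nat) : R := 1 - (k.+1%:R)^-1.
have r01 k : 0 <= r k < 1.
  rewrite /r subr_ge0 invf_le1 ?ltr0Sn// ler1n /= ltrBlDr ltrDl invr_gt0 ltr0Sn//.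
pose f (k : nat) (t : R) := ell (a + ((r k)%:C)%C * b * expi t).
have mf k : measurable_fun `[0%R, (2 * pi)%R] (f k) by exact: measurable_ell_circle.
have f0 k t : `[0%R, (2 * pi)%R]%classic t -> (0 <= f k t)%E.
  move=> _; apply: ell_ge0; rewrite mulrAC; apply: ab1.
  rewrite cabsM cabs_expi mulr1 cabs_real; have /andP[r0 /ltW r1] := r01 k.
  by rewrite ger0_norm.
have lim t : limn_einf (f ^~ t) = ell (a + b * expi t).
  have cf : f ^~ t @ \oo --> ell (a + b * expi t).
    apply: (@cvg_comp _ _ _ (fun k => a + ((r k)%:C)%C * b * expi t) ell); last exact: continuous_ell.
    apply: (@cvg_CxP _ _ _ _ _ _).2 => e e0; near=> k.
    have -> : a + ((r k)%:C)%C * b * expi t - (a + b * expi t) =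
       (((r k)%:C)%C - 1) * b * expi t by ring.
    rewrite cabsM cabs_expi mulr1 cabsM.
    have -> : ((r k)%:C)%C - 1 = ((- (k.+1%:R)^-1)%:C)%C :> C.
      by apply: Cx_eq; rewrite ?ReB ?ImB /cre /cim /= /r; ring.
    rewrite cabs_real normrN ger0_norm ?invr_ge0// mulrC.
    rewrite ltr_pdivrMr ?ltr0Sn// mulrC -ltr_pdivrMr//.
    near: k; exists (Num.truncn (cabs b / e)) => // k /= kt.
    by apply: lt_le_trans (truncnS_gt _) _; rewrite ler_nat.
  rewrite is_cvg_limn_einfE; last exact: (cvgP _ cf).
  exact: (cvg_lim _ cf).
have mI : measurable (`[0%R, (2 * pi)%R]%classic : set R) by [].
have := fatou lebesgue_measure mI mf f0.
under eq_integral do rewrite lim.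
move/le_trans; apply.
have -> : (fun k => \int[lebesgue_measure]_(x in `[0%R, (2 * pi)%R]) f k x)%E =
   cst ((2 * pi)%:E * ell a)%E.
  apply/funext => k; rewrite /f ell_mean_lt// cabsM cabs_real -ba.
  have /andP[r0 r1] := r01 k; rewrite ger0_norm//.
  have cb : 0 < cabs b by rewrite ba.
  nra.
rewrite is_cvg_limn_einfE; last exact: is_cvg_cst.
by rewrite lim_cst.
Unshelve. all: by end_near. Qed.

End LogPole.

(** * The plurisubharmonic function *)

Section Potential.
Context {R : realType} {n : nat}.
Local Notation C := (Cx R).
Local Notation Cn := 'rV[C]_n.
Variables (i0 i1 i2 : 'I_n) (p : nat -> C).

(** The functions [N_k]: the poles enter one after another with summable
    weights, amplified by [k], while the pole along the divisor fades out. *)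
Definition barrier (k : nat) (z : Cn) : \bar R :=
  ((k%:R)%:E + \sum_(j < k) (k%:R / 2 ^+ j)%:E * ell (z 0 i2 - p j)%R
   + (2 ^- k)%:E * ell (z 0 i0)%R)%E.

(** The infimum of the barriers is at most of the order of [log (ell z0)] away
    from the poles, and beyond any multiple of it near each pole.  The term
    [2 ell z1], on the edge of integrability, turns this difference of growth
    into a difference of integrability. *)
Definition neg_potential (z : Cn) : \bar R :=
  mine ((2:R)%:E * ell (z 0 i1)%R)%E (einfs (fun k => barrier k z) 0%N).

Definition potential (z : Cn) : \bar R := (- neg_potential z)%E.

Definition half_polydisc : set Cn := [set z | forall i, cabs (z 0 i) < 1 / 2].

Hypothesis p_half : forall j, cabs (p j) <= 1 / 2.

Lemma einfs0_le (u : nat -> \bar R) k : (einfs u 0%N <= u k)%E.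
Proof. by apply: ereal_inf_lbound; exists k. Qed.

Lemma einfs0_ge (u : nat -> \bar R) x : (forall k, x <= u k)%E -> (x <= einfs u 0%N)%E.
Proof. by move=> xu; apply: le_ereal_inf_tmp => _ [k _ <-]. Qed.

Lemma half_polydisc_shift_le1 z j i : half_polydisc z -> cabs (z 0 i - p j) <= 1.
Proof.
move=> Uz; apply: le_trans (cabsD _ _) _; rewrite cabsN.
have := Uz i; have := p_half j; lra.
Qed.

Lemma half_polydisc_le1 z i : half_polydisc z -> cabs (z 0 i) <= 1.
Proof. by move=> Uz; have := Uz i; lra. Qed.

Lemma barrier_sum_ge0 k z : half_polydisc z ->
  (0 <= \sum_(j < k) (k%:R / 2 ^+ j)%:E * ell (z 0 i2 - p j)%R)%E.
Proof.
move=> Uz; apply: sume_ge0 => j _; apply: mule_ge0.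
  by rewrite lee_fin divr_ge0// exprn_ge0.
exact/ell_ge0/half_polydisc_shift_le1.
Qed.

Lemma barrier_last_ge0 k z : half_polydisc z -> (0 <= (2 ^- k)%:E * ell (z 0 i0)%R)%E.
Proof.
move=> Uz; apply: mule_ge0; first by rewrite lee_fin invr_ge0 exprn_ge0.
exact/ell_ge0/half_polydisc_le1.
Qed.

(** This growth makes the infimum of the barriers locally a finite
    minimum. *)
Lemma barrier_ge k z : half_polydisc z -> ((k%:R)%:E <= barrier k z)%E.
Proof.
move=> Uz; rewrite /barrier -addeA -[leLHS]adde0; apply: leeD => //.
by apply: adde_ge0; [exact: barrier_sum_ge0|exact: barrier_last_ge0].
Qed.

Lemma barrier_ge0 k z : half_polydisc z -> (0 <= barrier k z)%E.
Proof. by move=> /(barrier_ge k); apply: le_trans; rewrite lee_fin. Qed.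

Lemma neg_potential_ge0 z : half_polydisc z -> (0 <= neg_potential z)%E.
Proof.
move=> Uz; rewrite /neg_potential le_min; apply/andP; split.
  by apply: mule_ge0; [rewrite lee_fin|exact/ell_ge0/half_polydisc_le1].
by apply: einfs0_ge => k; exact: barrier_ge0.
Qed.

Lemma open_half_polydisc : open half_polydisc.
Proof.
have -> : half_polydisc = polydisc 0 (1 / 2).
  by apply/seteqP; split=> z Uz i; have := Uz i; rewrite mxE subr0.
exact: open_polydisc.
Qed.

Lemma half_polydisc0 : half_polydisc 0.
Proof. by move=> i; rewrite mxE cabs0; lra. Qed.

Lemma continuous_coord (i : 'I_n) : continuous (fun z : Cn => z 0 i : C).
Proof.
move=> z; apply: (@cvg_CxP _ _ _ (nbhs z) (nbhs_filter z) _).2 => e e0.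
apply: (nbhs_rVP z [set y : Cn | cabs (y 0 i - z 0 i) < e]).2.
by exists e => // y /(_ i).
Qed.

Lemma continuous_barrier k z : half_polydisc z -> barrier k @ z --> barrier k z.
Proof.
move=> Uz.
have c1 j : (fun y : Cn => ell (y 0 i2 - p j)%R) @ z --> ell (z 0 i2 - p j).
  apply: (@cvg_comp _ _ _ (fun y : Cn => y 0 i2 - p j) ell); last exact: continuous_ell.
  apply: (@cvgB _ _ _ (nbhs z) (nbhs_filter z)); last exact: cvg_cst.
  exact: continuous_coord.
have c0 : (fun y : Cn => ell (y 0 i0)%R) @ z --> ell (z 0 i0).
  by apply: (@cvg_comp _ _ _ (fun y : Cn => y 0 i0 : C) ell);
    [exact: continuous_coord|exact: continuous_ell].
have nU : \forall y \near z, half_polydisc y by apply: open_nbhs_nbhs; split; [exact: open_half_polydisc|].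
have csum : (fun y : Cn => (\sum_(j < k) (k%:R / 2 ^+ j)%:E * ell (y 0 i2 - p j)%R)%E) @ z -->
    (\sum_(j < k) (k%:R / 2 ^+ j)%:E * ell (z 0 i2 - p j)%R)%E.
  apply: (@cvg_nnesum Cn (nbhs z) (nbhs_pfilter z) R 'I_k (index_enum 'I_k)
    (fun j y => (k%:R / 2 ^+ j)%:E * ell (y 0 i2 - p j)%R)%E
    (fun j => (k%:R / 2 ^+ j)%:E * ell (z 0 i2 - p j)%R)%E xpredT) => j _.
    apply: (@filterS _ (nbhs z) (nbhs_filter z) _ _ _ nU) => y Uy; apply: mule_ge0.
      by rewrite lee_fin divr_ge0// exprn_ge0.
    exact/ell_ge0/half_polydisc_shift_le1.
  exact: (@cvgeZl Cn (nbhs z)).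
rewrite /barrier; apply: (@cvgeD _ (nbhs z) (nbhs_filter z)).
- rewrite ge0_adde_def// inE ?barrier_last_ge0//.
  by apply: adde_ge0; [rewrite lee_fin|exact: barrier_sum_ge0].
- apply: (@cvgeD _ (nbhs z) (nbhs_filter z)); [ |exact: cvg_cst|exact: csum].
  by rewrite fin_num_adde_defr.
- exact: (@cvgeZl _ (nbhs z)).
Qed.

(** Lower semicontinuity survives the infimum because only finitely many
    barriers can lie below a given constant, the same ones for all points. *)
Lemma neg_potential_lsc z (c : R) : half_polydisc z ->
  (c%:E < neg_potential z)%E -> \forall y \near z, (c%:E < neg_potential y)%E.
Proof.
move=> Uz; rewrite {1}/neg_potential lt_min => /andP[c1 c2].
have nU : \forall y \near z, half_polydisc y by apply: open_nbhs_nbhs; split; [exact: open_half_polydisc|].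
have n1 : \forall y \near z, (c%:E < (2:R)%:E * ell ((y : Cn) 0 i1)%R)%E.
  have c1' : (fun y : Cn => ((2:R)%:E * ell (y 0 i1)%R)%E) @ z --> ((2:R)%:E * ell (z 0 i1)%R)%E.
    apply: (@cvgeZl _ (nbhs z)) => //.
    by apply: (@cvg_comp _ _ _ (fun y : Cn => y 0 i1 : C) ell);
      [exact: continuous_coord|exact: continuous_ell].
  by apply: (c1' [set u | (c%:E < u)%E]); exact: open_ereal_gt_ereal.
have [c' /andP[cc' c'z]] : exists c' : R, (c%:E < c'%:E)%E && (c'%:E < einfs (fun k => barrier k z) 0%N)%E.
  move: c2; case: (einfs _ _) => [r| |]//.
    rewrite lte_fin => cr; exists ((c + r) / 2); rewrite !lte_fin; apply/andP; split; lra.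
  by move=> _; exists (c + 1); rewrite ltey lte_fin andbT; lra.
(* barriers of index at least [K] exceed [c'] everywhere *)
pose K := (Num.truncn c').+1.
have n2 : \forall y \near z, forall k : 'I_K, (c'%:E < barrier k y)%E.
  apply: (@filter_forall _ _ (fun (k : 'I_K) (y : Cn) => (c'%:E < barrier k y)%E)
    (nbhs z) (nbhs_filter z)) => k.
  have H : nbhs z (barrier k @^-1` [set u | (c'%:E < u)%E]).
    apply: (@continuous_barrier k z Uz); apply: open_ereal_gt_ereal.
    exact: (lt_le_trans c'z (einfs0_le (fun k => barrier k z) k)).
  exact: H.
apply: (@filterS3 _ (nbhs z) (nbhs_filter z) _ _ _ _ _ nU n1 n2) => y Uy y1 y2.
rewrite /neg_potential lt_min y1 /=; apply: (lt_le_trans cc'); apply: einfs0_ge => k.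
have [kK|Kk] := ltnP k K; first exact/ltW/(y2 (Ordinal kK)).
apply: le_trans (barrier_ge k Uy); rewrite lee_fin.
by apply: ltW; apply: lt_le_trans (truncnS_gt _) _; rewrite ler_nat.
Qed.

Lemma measurable_lin_ell (a b : Cn) (i : 'I_n) (c : C) :
  measurable_fun (`[0%R, (2 * pi)%R]%classic : set R)
    ((fun t => ell ((a + expi t *: b) 0 i - c)%R) : R -> \bar R).
Proof.
have -> : (fun t => ell ((a + expi t *: b) 0 i - c)) =
    (fun t => ell ((a 0 i - c) + b 0 i * expi t)).
  by apply/funext => t; rewrite !mxE; congr ell; ring.
exact: measurable_ell_circle.
Qed.

Lemma measurable_coord_ell (a b : Cn) (i : 'I_n) :
  measurable_fun (`[0%R, (2 * pi)%R]%classic : set R)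
    ((fun t => ell ((a + expi t *: b) 0 i)%R) : R -> \bar R).
Proof.
have -> : (fun t => ell ((a + expi t *: b) 0 i)) =
    (fun t => ell ((a + expi t *: b) 0 i - 0)) by apply/funext => t; rewrite subr0.
exact: measurable_lin_ell.
Qed.

Section Mean.
Variables a b : Cn.
Hypothesis disc : forall zeta : C, cabs zeta <= 1 -> half_polydisc (a + zeta *: b).
Local Notation I := (`[0%R, (2 * pi)%R]%classic : set R).

(** This fact and the next one stay in the context, where [done] uses them. *)
Let Ua : half_polydisc a.
Proof. by rewrite -[a]addr0 -(scale0r b); apply: disc; rewrite cabs0; lra. Qed.

Let Uab t : half_polydisc (a + expi t *: b).
Proof. by apply: disc; rewrite cabs_expi. Qed.

Let ell_mean i c : (forall z, half_polydisc z -> cabs (z 0 i - c) <= 1) ->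
  (\int[lebesgue_measure]_(t in I) ell ((a + expi t *: b) 0 i - c)%R
    <= (2 * pi)%:E * ell (a 0 i - c)%R)%E.
Proof.
move=> H.
have E t : ell ((a + expi t *: b) 0 i - c) = ell ((a 0 i - c) + b 0 i * expi t).
  by rewrite !mxE; congr ell; ring.
under eq_integral do rewrite E.
apply: ell_superharmonic => z z1.
have := H _ (disc z1); rewrite !mxE.
by rewrite (_ : _ + _ - c = a 0 i - c + z * b 0 i)//; ring.
Qed.

Let coord_mean i :
  (\int[lebesgue_measure]_(t in I) ell ((a + expi t *: b) 0 i)%R
    <= (2 * pi)%:E * ell (a 0 i)%R)%E.
Proof.
have -> : (fun t => ell ((a + expi t *: b) 0 i)) =
    (fun t => ell ((a + expi t *: b) 0 i - 0)) by apply/funext => t; rewrite subr0.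
rewrite -[a 0 i]subr0; apply: ell_mean => z Uz; rewrite subr0; exact: half_polydisc_le1.
Qed.

Let measurable_barrier k : measurable_fun I ((fun t => barrier k (a + expi t *: b)) : R -> \bar R).
Proof.
rewrite /barrier; apply: emeasurable_funD; last first.
  apply: measurable_funeM.
  exact: measurable_coord_ell.
apply: emeasurable_funD; first exact: measurable_cst.
apply: emeasurable_sum => j; apply: measurable_funeM; exact: measurable_lin_ell.
Qed.

Let barrier_mean k : (\int[lebesgue_measure]_(t in I) barrier k (a + expi t *: b)
    <= (2 * pi)%:E * barrier k a)%E.
Proof.
have mI : measurable I by [].
have pi0 := pi_gt0 R.
have m0 : measurable_fun I ((fun t => ell ((a + expi t *: b) 0 i0)%R) : R -> \bar R).
  exact: measurable_coord_ell.
have mj j := @measurable_lin_ell a b i2 (p j).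
rewrite /barrier ge0_integralD//; last 4 first.
- by move=> t _; apply: adde_ge0; [rewrite lee_fin|exact: barrier_sum_ge0].
- apply: emeasurable_funD; first exact: measurable_cst.
  by apply: emeasurable_sum => j; apply: measurable_funeM; exact: mj.
- by move=> t _; exact: barrier_last_ge0.
- exact: measurable_funeM.
rewrite ge0_muleDr; last 2 first.
- by apply: adde_ge0; [rewrite lee_fin|exact: barrier_sum_ge0].
- exact: barrier_last_ge0.
apply: leeD; last first.
  rewrite ge0_integralZl_EFin// ?invr_ge0 ?exprn_ge0//; last first.
    by move=> t _; exact/ell_ge0/half_polydisc_le1.
  rewrite muleCA; apply: lee_wpmul2l; first by rewrite lee_fin invr_ge0 exprn_ge0.
  exact: coord_mean.
rewrite ge0_integralD//; last 2 first.
- by move=> t _; exact: barrier_sum_ge0.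
- by apply: emeasurable_sum => j; apply: measurable_funeM; exact: mj.
rewrite ge0_muleDr; [|by rewrite lee_fin|exact: barrier_sum_ge0].
apply: leeD.
  rewrite integral_cst//= lebesgue_measure_itv/= lte_fin mulr_gt0// oppr0 adde0.
  by rewrite muleC.
have hm (j : 'I_k) : measurable_fun I ((fun t => (k%:R / 2 ^+ j)%:E *
    ell ((a + expi t *: b) 0 i2 - p j)%R)%E : R -> \bar R).
  by apply: measurable_funeM; exact: mj.
have h0 (j : 'I_k) t : I t -> (0 <= (k%:R / 2 ^+ j)%:E *
    ell ((a + expi t *: b) 0 i2 - p j)%R)%E.
  move=> _; apply: mule_ge0; first by rewrite lee_fin divr_ge0// exprn_ge0.
  exact/ell_ge0/half_polydisc_shift_le1.
rewrite (ge0_integral_sum lebesgue_measure mI hm h0).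
rewrite ge0_sume_distrr; last first.
  move=> j _; apply: mule_ge0; first by rewrite lee_fin divr_ge0// exprn_ge0.
  exact/ell_ge0/half_polydisc_shift_le1.
apply: lee_sum => j _; have mjj := mj j.
rewrite ge0_integralZl_EFin// ?divr_ge0 ?exprn_ge0//; last first.
  by move=> t _; exact/ell_ge0/half_polydisc_shift_le1.
rewrite muleCA; apply: lee_wpmul2l; first by rewrite lee_fin divr_ge0 ?exprn_ge0.
by apply: ell_mean => z /half_polydisc_shift_le1.
Qed.

(** The integral of a minimum is at most the minimum of the integrals,
    and each function of the minimum is superharmonic along discs. *)
Lemma neg_potential_mean : (\int[lebesgue_measure]_(t in I) neg_potential (a + expi t *: b)
    <= (2 * pi)%:E * neg_potential a)%E.
Proof.
have mI : measurable I by [].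
have pi0 := pi_gt0 R.
have pi20 : 0 < 2 * pi :> R by lra.
have m1 : measurable_fun I ((fun t => (2:R)%:E * ell ((a + expi t *: b) 0 i1)%R)%E : R -> \bar R).
  apply: measurable_funeM.
  exact: measurable_coord_ell.
have mPhi : measurable_fun I ((fun t => neg_potential (a + expi t *: b)) : R -> \bar R).
  apply: measurable_mine => //.
  exact: (@measurable_fun_einfs _ _ _ I (fun k t => barrier k (a + expi t *: b)) measurable_barrier 0%N).
have red X : (\int[lebesgue_measure]_(t in I) neg_potential (a + expi t *: b) <= (2 * pi)%:E * X)%E ->
    (((2 * pi)^-1)%:E * \int[lebesgue_measure]_(t in I) neg_potential (a + expi t *: b) <= X)%E.
  by rewrite lee_pdivrMl.
rewrite -lee_pdivrMl// [leRHS]/neg_potential le_min; apply/andP; split; last first.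
  apply: einfs0_ge => k; apply: red; apply: le_trans (barrier_mean k).
  apply: ge0_le_integral; [exact: mI| |exact: mPhi|exact: measurable_barrier|].
  - by move=> t _; exact: neg_potential_ge0.
  - by move=> t _; rewrite ge_min (einfs0_le (fun k => barrier k (a + expi t *: b))) orbT.
apply: red; apply: (@le_trans _ _ (\int[lebesgue_measure]_(t in I) ((2:R)%:E * ell ((a + expi t *: b) 0 i1)%R)))%E.
  apply: ge0_le_integral; [exact: mI| |exact: mPhi|exact: m1|].
  - by move=> t _; exact: neg_potential_ge0.
  - by move=> t _; rewrite ge_min lexx.
rewrite ge0_integralZl_EFin//.
- rewrite muleCA; apply: lee_wpmul2l; first by rewrite lee_fin.
  exact: coord_mean.
- by move=> t _; exact/ell_ge0/half_polydisc_le1.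
- exact: measurable_coord_ell.
Qed.

End Mean.

Lemma plurisubharmonic_potential : plurisubharmonic half_polydisc potential.
Proof.
split.
- move=> x Ux; rewrite /potential lteNl; apply: lt_le_trans (neg_potential_ge0 Ux).
  by rewrite ltNye_eq.
- move=> x c Ux; rewrite /potential lteNl -EFinN => /(neg_potential_lsc Ux).
  by apply: (@filterS _ (nbhs x) (nbhs_filter x)) => y; rewrite EFinN lteNl.
- move=> a b disc; rewrite /potential integral_ge0N; last first.
    by move=> t _; apply: neg_potential_ge0; apply: disc; rewrite (cabs_expi t).
  by rewrite muleN leeN2; exact: neg_potential_mean.
Qed.

End Potential.

(** * Integrals of products over tuples *)

Section TupleFubini.
Context {d : measure_display} {T : measurableType d} {R : realType}.
Variable m : {sigma_finite_measure set T -> \bar R}.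

Definition tprod n (g : 'I_n -> T -> \bar R) (t : n.-tuple T) : \bar R :=
  (\big[*%E/1]_(i < n) g i (tnth t i))%E.

Lemma tprod_ge0 n (g : 'I_n -> T -> \bar R) t : (forall i x, 0 <= g i x)%E ->
  (0 <= tprod g t)%E.
Proof. by move=> g0; rewrite /tprod; elim/big_ind: _ => // x y; exact: mule_ge0. Qed.

Lemma measurable_tprod n (g : 'I_n -> T -> \bar R) :
  (forall i, measurable_fun setT (g i)) -> measurable_fun setT (tprod g).
Proof.
move=> mg; rewrite /tprod.
elim: (index_enum _) => [|i s IH].
  by under eq_fun do rewrite big_nil; exact: measurable_cst.
under eq_fun do rewrite big_cons; apply: emeasurable_funM => //.
by apply: measurableT_comp => //; exact: measurable_tnth.
Qed.

Lemma tprod_cons n (g : 'I_n.+1 -> T -> \bar R) (p : T * n.-tuple T) :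
  tprod g (tuple_cons p) = (g ord0 p.1 * tprod (fun i => g (lift ord0 i)) p.2)%E.
Proof.
rewrite /tprod big_ord_recl; congr (_ * _)%E.
by apply: eq_bigr => i _; rewrite tnthS.
Qed.

Lemma integral_tprod n (g : 'I_n -> T -> \bar R) :
  (forall i, measurable_fun setT (g i)) -> (forall i x, 0 <= g i x)%E ->
  (\int[product_tuple m n]_t tprod g t = \big[*%E/1]_(i < n) \int[m]_x g i x)%E.
Proof.
elim: n g => [|n IH] g mg g0.
  rewrite big_ord0 /=; rewrite integral_dirac//; last exact: measurable_tprod.
  by rewrite /tprod big_ord0 diracT mul1e.
rewrite big_ord_recl -IH//.
have mt := measurable_tprod (fun i => mg (lift ord0 i)).
transitivity (\int[(m \x product_tuple m n)%E]_p (g ord0 p.1 * tprod (fun i => g (lift ord0 i)) p.2))%E.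
  rewrite (_ : \int[product_tuple m n.+1]_t tprod g t =
     \int[pushforward (product_sigma_finite m (product_tuple m n)) (@tuple_cons _ T n)]_t tprod g t)%E//.
  rewrite ge0_integral_pushforward//; last 2 first.
  - exact: measurable_tprod.
  - by move=> t _; exact: tprod_ge0.
  by rewrite preimage_setT; apply: eq_integral => p _; rewrite /= tprod_cons.
rewrite fubini_tonelli1//=; last 2 first.
- apply: emeasurable_funM.
    exact: (measurableT_comp (mg ord0) measurable_fst).
  exact: (measurableT_comp mt measurable_snd).
- by move=> p; apply: mule_ge0 => //; exact: tprod_ge0.
rewrite /fubini_F/=.
under eq_integral => x _.
  rewrite ge0_integralZl//; last by move=> t _; exact: tprod_ge0.
  over.
rewrite ge0_integralZr//.
by apply: integral_ge0 => t _; exact: tprod_ge0.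
Qed.

End TupleFubini.

(** * Lower bounds and dyadic majorants of integrals *)

Section MeasureTools.
Context {d : measure_display} {T : measurableType d} {R : realType}.
Variable mu : {measure set T -> \bar R}.

Lemma integral_ge_cst (D B : set T) (f : T -> \bar R) (c : R) :
  measurable B -> B `<=` D -> (forall x, D x -> 0 <= f x)%E -> 0 <= c ->
  (forall x, B x -> c%:E <= f x)%E -> (c%:E * mu B <= \int[mu]_(x in D) f x)%E.
Proof.
move=> mB BD f0 c0 cf; rewrite -integral_cst//.
rewrite [leLHS]ge0_integralE// [leRHS]ge0_integralE//.
apply: le_ereal_sup => _ [h /= hc <-]; exists h => // x; apply: le_trans (hc x) _.
rewrite !patchE; case: ifPn => [|_]; first by rewrite inE => Bx; rewrite mem_set ?cf//; exact: BD.
by case: ifPn => //; rewrite inE => /f0.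
Qed.

End MeasureTools.

Section PlaneMeasure.
Context {R : realType}.
Local Notation plane := (measurableTypeR R * measurableTypeR R)%type.
Local Notation m := (product_sigma_finite (@lebesgue_measure R) (@lebesgue_measure R)).

Definition square (r : R) : set plane := `[- r, r]%classic `*` `[- r, r]%classic.

Lemma measurable_box (a b c d : R) :
  measurable (`[a, b]%classic `*` `[c, d]%classic : set plane).
Proof. exact: measurableX. Qed.

Lemma plane_box (a b c d : R) : a <= b -> c <= d ->
  m (`[a, b]%classic `*` `[c, d]%classic) = ((b - a) * (d - c))%:E.
Proof.
have L x y : x <= y -> @lebesgue_measure R `[x, y]%classic = (y - x)%:E.
  move=> xy; rewrite lebesgue_measure_itv/= lte_fin.
  case: ltP => [_|yx]; first by rewrite -EFinB.
  by have -> : x = y; [lra|rewrite subrr].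
move=> ab cd; transitivity (@lebesgue_measure R `[a, b]%classic * @lebesgue_measure R `[c, d]%classic)%E.
  by apply: product_measure1E.
by rewrite !L.
Qed.

Lemma plane_square r : 0 <= r -> m (square r) = (4 * r ^+ 2)%:E.
Proof.
move=> r0; rewrite /square plane_box; [congr EFin; ring|lra|lra].
Qed.

(** The majorant is the sum of [a l 4^l] times the indicator function of
    the square of half-side [2^-l]; its integral is 4 times the sum of the
    [a l].  The last clause makes it dominate functions that are infinite at
    the origin, a point outside all dyadic shells. *)
Lemma plane_majorant (a : nat -> R) M : (forall l, 0 <= a l) ->
  (forall k, \sum_(0 <= l < k) a l <= M) ->
  exists G : plane -> \bar R, [/\ measurable_fun setT G,
    forall x, (0 <= G x)%E, (\int[m]_x G x < +oo)%E,
    forall l x, square (2 ^- l) x -> ((a l * 4 ^+ l)%:E <= G x)%E &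
    (forall l, 1 <= a l * 4 ^+ l) -> G (0, 0) = +oo%E].
Proof.
move=> a0 aM.
pose f (l : nat) (x : plane) : \bar R := ((a l * 4 ^+ l)%:E * (\1_(square (2 ^- l)) x)%:E)%E.
have c0 l : 0 <= a l * 4 ^+ l by rewrite mulr_ge0 ?exprn_ge0.
have f0 l x : (0 <= f l x)%E by rewrite /f -EFinM lee_fin mulr_ge0.
have msq r : measurable (square r) by exact: measurable_box.
have mf l : measurable_fun setT (f l).
  by apply: measurable_funeM; apply/measurable_EFinP; exact: measurable_indic.
have fle l x : (f l x <= \sum_(k <oo) f k x)%E.
  apply: le_trans (@nneseries_lim_ge R (fun k => f k x) xpredT 0%N l.+1 _) => //.
  by rewrite big_mkord big_ord_recr /= leeDr// sume_ge0.
exists (fun x => \sum_(l <oo) f l x)%E; split.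
- exact: ge0_emeasurable_sum.
- by move=> x; apply: nneseries_ge0.
- rewrite integral_nneseries//.
  apply: (@le_lt_trans _ _ (4 * M)%:E); last exact: ltry.
  apply: lime_le; first by apply: is_cvg_nneseries => l _ _; apply: integral_ge0.
  apply: nearW => k; apply: (@le_trans _ _ (\sum_(0 <= l < k) (4 * a l)%:E)).
    apply: lee_sum => l _; rewrite ge0_integralZl_EFin//; last first.
      by apply/measurable_EFinP; exact: measurable_indic.
    rewrite integral_indic// setIT [X in (_ * X)%E](_ : _ = (4 * (2 ^- l) ^+ 2)%:E); last first.
      by apply: plane_square; rewrite invr_ge0 exprn_ge0.
    rewrite -EFinM lee_fin le_eqVlt; apply/orP; left; apply/eqP.
    have -> : (4 : R) ^+ l = 2 ^+ l * 2 ^+ l by rewrite -exprMn; congr (_ ^+ _); lra.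
    by field; rewrite expf_neq0.
  by rewrite sumEFin lee_fin -mulr_sumr ler_wpM2l.
- move=> l x lx; apply: le_trans (fle l x).
  by rewrite /f indicE mem_set// mule1.
- move=> a1; apply/eqP; rewrite -leye_eq.
  have H (k : nat) : ((k%:R)%:E <= \sum_(l <oo) f l (0%R, 0%R))%E.
    apply: le_trans (@nneseries_lim_ge R (fun l => f l (0, 0)) xpredT 0%N k _) => //.
    apply: (@le_trans _ _ (\sum_(0 <= l < k) 1%:E)%E).
      by rewrite sumEFin lee_fin big_mkord sumr_const card_ord.
    apply: lee_sum => l _; rewrite /f indicE mem_set ?mule1 ?lee_fin//.
    by rewrite /square /= !in_itv /= !oppr_le0 !invr_ge0 !exprn_ge0.
  rewrite leye_eq; apply/eqP/eq_infty => t.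
  apply: le_trans (H (Num.truncn t).+1); rewrite lee_fin ltW//.
  exact: truncnS_gt.
Qed.

End PlaneMeasure.

(** * Dyadic shells and convergent series *)

Section ElementaryBounds.
Context {R : realType}.
Local Notation C := (Cx R).

Lemma ln2_ge_half : 1 / 2 <= ln 2 :> R.
Proof.
have := @le_ln1Dx R (- (1 / 2)) ltac:(lra).
have -> : 1 + - (1 / 2) = 2^-1 :> R by lra.
by rewrite lnV ?posrE//; lra.
Qed.

Lemma ln2_le1 : ln 2 <= 1 :> R.
Proof. have := @le_ln1Dx R 1 ltac:(lra); have -> : 1 + 1 = 2 :> R by lra. exact. Qed.

Lemma ln_pow2V (l : nat) : ln (2 ^- l) = - (l%:R * ln 2) :> R.
Proof. by rewrite lnV ?posrE ?exprn_gt0// lnXn// mulr_natl. Qed.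

Lemma dyadic_shell (s : R) : 0 < s -> s <= 1 ->
  exists l : nat, 2 ^- l.+1 < s /\ s <= 2 ^- l.
Proof.
move=> s0 s1.
have ex : exists l : nat, 2 ^- l.+1 < s.
  exists (Num.truncn s^-1); rewrite invf_plt ?posrE ?exprn_gt0//.
  apply: lt_trans (truncnS_gt _) _.
  by rewrite -natrX ltr_nat; exact: ltn_expl.
case: (ex_minnP ex) => l ls lmin; exists l; split => //.
case: l ls lmin => [|l] ls lmin; first by rewrite expr0 invr1.
by rewrite leNgt; apply/negP => /lmin; rewrite ltnn.
Qed.

Definition supn (z : C) : R := Num.max `|cre z| `|cim z|.

Lemma supn_le_cabs z : supn z <= cabs z.
Proof. by rewrite ge_max Re_le_cabs Im_le_cabs. Qed.

Lemma cabs_le_supn z : cabs z <= 2 * supn z.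
Proof.
apply: le_trans (cabs_le z) _; rewrite mulr_natl mulr2n.
by apply: lerD; rewrite le_max lexx ?orbT.
Qed.

Lemma supn_gt0 z : z != 0 -> 0 < supn z.
Proof.
move=> z0; have : 0 < cabs z by rewrite cabs_gt0.
have := cabs_le_supn z; lra.
Qed.

Lemma supn_shell z : z != 0 -> cabs z <= 1 -> exists l : nat,
  [/\ 2 ^- l.+1 < supn z, supn z <= 2 ^- l & square (2 ^- l) (cre z, cim z)].
Proof.
move=> z0 z1; have [l [l1 l2]] := dyadic_shell (supn_gt0 z0) (le_trans (supn_le_cabs z) z1).
exists l; split=> //; rewrite /square /= !in_itv /= -!ler_norml.
by move: l2; rewrite /supn ge_max => /andP[].
Qed.

(** A telescoping substitute for the general term [g l^(- g - 1)] of a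
    convergent series. *)
Definition power_gap (g : R) (l : nat) : R := l.+1%:R `^ (- g) - l.+2%:R `^ (- g).

(** Convexity of [x^(- g)], through [e^u >= 1 + u]. *)
Lemma power_gap_ge g l : 0 < g -> g * l.+2%:R `^ (- g - 1) <= power_gap g l.
Proof.
move=> g0; rewrite /power_gap.
have p1 : 0 < l.+1%:R :> R by rewrite ltr0Sn.
have p2 : 0 < l.+2%:R :> R by rewrite ltr0Sn.
have E (x : R) a : 0 < x -> x `^ a = expR (a * ln x).
  by move=> x0; rewrite /powR gt_eqF.
rewrite !E//.
have -> : expR ((- g - 1) * ln l.+2%:R) = expR (- g * ln l.+2%:R) / l.+2%:R.
  by rewrite mulrBl mul1r expRD expRN lnK.
have -> : expR (- g * ln l.+1%:R) = expR (- g * ln l.+2%:R) * expR (- g * ln (l.+1%:R / l.+2%:R)).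
  by rewrite -expRD ln_div ?posrE//; congr expR; ring.
have h : expR (- g * ln (l.+1%:R / l.+2%:R)) >= 1 + g / l.+2%:R.
  apply: le_trans (expR_ge1Dx _); rewrite lerD2l mulNr -mulrN ler_pM2l//.
  have -> : l.+1%:R / l.+2%:R = 1 + (- l.+2%:R^-1) :> R.
    by rewrite -[l.+2%:R]natr1; field; lra.
  rewrite lerNr; apply: le_ln1Dx.
  by rewrite ltrN2 invf_lt1// ltr1n.
have e0 := expR_gt0 (- g * ln l.+2%:R).
have := ler_wpM2l (ltW e0) h; move: (expR (- g * ln l.+2%:R)) (expR _) (l.+2%:R^-1).
by move=> e H u; lra.
Qed.

Lemma power_gap_ge0 g l : 0 < g -> 0 <= power_gap g l.
Proof. by move=> g0; apply: le_trans (power_gap_ge l g0); rewrite mulr_ge0 ?powR_ge0// ltW. Qed.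

Lemma power_gap_sum g k : 0 < g -> \sum_(0 <= l < k) power_gap g l <= 1.
Proof.
move=> g0.
have -> : \sum_(0 <= l < k) power_gap g l = 1 - k.+1%:R `^ (- g).
  elim: k => [|k IH]; first by rewrite big_nil powR1 subrr.
  by rewrite big_nat_recr//= IH /power_gap; ring.
by rewrite gerBl powR_ge0.
Qed.

Lemma geometric_sum_le (q : R) k : 0 <= q -> q < 1 ->
  \sum_(0 <= l < k) 4 * q ^+ l.+1 <= 4 / (1 - q).
Proof.
move=> q0 q1.
have -> : \sum_(0 <= l < k) 4 * q ^+ l.+1 = 4 / (1 - q) * q * (1 - q ^+ k).
  elim: k => [|k IH]; first by rewrite big_nil expr0 subrr mulr0.
  by rewrite big_nat_recr//= IH !exprS; field; lra.
have h : 0 <= 4 / (1 - q) by rewrite divr_ge0//; lra.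
have qk : 0 <= q ^+ k by rewrite exprn_ge0.
rewrite -mulrA -[leRHS]mulr1 ler_wpM2l//.
have qk1 : q ^+ k <= 1 by rewrite exprn_ile1// ltW.
nra.
Qed.

End ElementaryBounds.

(** * Estimates away from the poles *)

Section Convergence.
Context {R : realType} {n : nat}.
Local Notation C := (Cx R).
Local Notation Cn := 'rV[C]_n.
Variables (i0 i2 : 'I_n) (p : nat -> C).

Lemma barrier_le (k : nat) (y : Cn) (B L : R) : 0 <= B ->
  (forall j, ell (y 0 i2 - p j)%R <= B%:E)%E -> (ell (y 0 i0)%R <= L%:E)%E ->
  (barrier i0 i2 p k y <= (k%:R * (1 + 2 * B) + 2 ^- k * L)%:E)%E.
Proof.
move=> B0 yB yL.
have geo m : \sum_(j < m) (2 ^- j) = 2 - 2 * 2 ^- m :> R.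
  elim: m => [|m IH]; first by rewrite big_ord0 expr0; lra.
  by rewrite big_ord_recr/= IH exprS invfM; lra.
rewrite /barrier EFinD; apply: leeD; last first.
  by rewrite EFinM; apply: lee_wpmul2l => //; rewrite lee_fin invr_ge0 exprn_ge0.
rewrite mulrDr mulr1 EFinD leeD2l//.
apply: (@le_trans _ _ (\sum_(j < k) (k%:R * B * 2 ^- j)%:E)%E).
  apply: lee_sum => j _; rewrite (mulrAC k%:R) [leRHS]EFinM.
  by apply: lee_wpmul2l => //; rewrite lee_fin divr_ge0// exprn_ge0.
rewrite sumEFin lee_fin -mulr_sumr geo.
have kB : 0 <= k%:R * B by rewrite mulr_ge0.
have p0 : 0 <= 2 ^- k :> R by rewrite invr_ge0 exprn_ge0.
nra.
Qed.

(** With [|z0|] about [2^-l], an index [k] about [log2 l] makes the last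
    term of the barrier at most 1 and the others of the order of [k]. *)
Lemma einfs_barrier_le (l : nat) (y : Cn) (B : R) : 0 <= B ->
  (forall j, ell (y 0 i2 - p j)%R <= B%:E)%E ->
  2 ^- l.+1 <= cabs (y 0 i0) ->
  (einfs (fun k => barrier i0 i2 p k y) 0%N <=
    ((1 + 2 * B) * (1 + 2 * ln l.+2%:R) + 1)%:E)%E.
Proof.
move=> B0 yB yl; pose k := (trunc_log 2 l.+1).+1.
have lk : (l.+1 < 2 ^ k)%N by exact: trunc_log_ltn.
have kl : (2 ^ k.-1 <= l.+1)%N by rewrite /k /= trunc_logP.
have yL : (ell (y 0 i0)%R <= (l.+1%:R)%:E)%E.
  apply: le_trans (ell_le _ yl) _; first by rewrite invr_gt0 exprn_gt0.
  rewrite ln_pow2V opprK lee_fin.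
  by rewrite -[leRHS]mulr1 ler_wpM2l// ln2_le1.
apply: le_trans (einfs0_le _ k) _; apply: le_trans (barrier_le k B0 yB yL) _.
rewrite lee_fin; apply: lerD.
  rewrite mulrC ler_wpM2l//; first lra.
  have : k.-1%:R * ln 2 <= ln l.+1%:R :> R.
    rewrite mulr_natl -lnXn// ler_ln ?posrE ?exprn_gt0 ?ltr0Sn//.
    by rewrite -natrX ler_nat.
  have h : ln l.+1%:R <= ln l.+2%:R :> R by rewrite ler_ln ?posrE ?ltr0Sn// ler_nat.
  have -> : k%:R = k.-1%:R + 1 :> R by rewrite natr1.
  have k0 : 0 <= k.-1%:R :> R by [].
  have := @ln2_ge_half R; nra.
rewrite mulrC ler_pdivrMr ?exprn_gt0// mul1r -natrX ler_nat ltnW//.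
Qed.

(** Interpolation between two bounds on [r]: almost all of the exponent is
    spent on the first one, where a factor less than 2 keeps the exponential
    integrable, and only [2 eps] of it on the second one. *)
Lemma exp_split (r lam V eps : R) : 0 < eps -> eps <= 1 / 2 -> r <= 2 * lam -> r <= V ->
  expR ((1 + eps) * r) <= expR (2 * (1 - eps) * lam) * expR (2 * eps * V).
Proof.
move=> e0 e1 rl rV; rewrite -expRD ler_expR.
have -> : (1 + eps) * r = (1 - eps) * r + 2 * eps * r by ring.
have := ler_wpM2l (_ : 0 <= 1 - eps) rl; have := ler_wpM2l (_ : 0 <= 2 * eps) rV.
move=> /(_ ltac:(lra)) h1 /(_ ltac:(lra)) h2; lra.
Qed.

(** The constant 5 comes from [(l - 1) log 2 >= (l + 2) / 5] for
    [l >= 3]. *)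
Lemma weight_le (alpha : R) (l : nat) (z : C) : 0 < alpha -> (3 <= l)%N ->
  2 ^- l.+1 <= cabs z -> cabs z <= 2 * 2 ^- l ->
  (cabs z ^+ 2 * (- ln (cabs z)) `^ alpha)^-1 <=
    4 ^+ l.+1 * (5 `^ alpha * l.+2%:R `^ (- alpha)).
Proof.
move=> a0 l3 z1 z2.
have p0 : 0 < 2 ^- l.+1 :> R by rewrite invr_gt0 exprn_gt0.
have z0 : 0 < cabs z by apply: lt_le_trans z1.
have l2 : 0 < l.+2%:R :> R by rewrite ltr0Sn.
have L1 : l.+2%:R / 5 <= - ln (cabs z).
  have : ln (cabs z) <= ln (2 * 2 ^- l) by rewrite ler_ln ?posrE// mulr_gt0// invr_gt0 exprn_gt0.
  rewrite lnM ?posrE ?invr_gt0 ?exprn_gt0// ln_pow2V.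
  have l3' : 3 <= l%:R :> R by rewrite ler_nat.
  have -> : l.+2%:R = l%:R + 2 :> R by rewrite -[2]/(2%:R) -natrD addn2.
  have := @ln2_ge_half R; nra.
have L0 : 0 < l.+2%:R / 5 :> R by rewrite divr_gt0.
have pw : (l.+2%:R / 5) `^ alpha <= (- ln (cabs z)) `^ alpha.
  by rewrite ge0_ler_powR// ?nnegrE; lra.
have -> : 5 `^ alpha * l.+2%:R `^ (- alpha) = ((l.+2%:R / 5) `^ alpha)^-1.
  rewrite /powR !gt_eqF// -expRN -expRD; congr expR.
  by rewrite ln_div ?posrE//; ring.
have -> : 4 ^+ l.+1 = ((2 ^- l.+1) ^+ 2)^-1 :> R.
  by rewrite -exprVn invrK exprAC; congr (_ ^+ _); lra.
rewrite -invfM lef_pV2 ?posrE ?mulr_gt0 ?exprn_gt0 ?powR_gt0//; last lra.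
apply: ler_pM; [by rewrite exprn_ge0// ltW|exact: powR_ge0| |exact: pw].
by rewrite lerXn2r ?nnegrE// ltW.
Qed.

End Convergence.

(** * The divisor, and the integrand of the constant 1 *)

Section Triviality.
Context {R : realType} {n : nat}.
Local Notation C := (Cx R).
Local Notation Cn := 'rV[C]_n.
Local Notation plane := (measurableTypeR R * measurableTypeR R)%type.
Variables (i0 i1 i2 : 'I_n) (p : nat -> C).
Hypothesis p_half : forall j, cabs (p j) <= 1 / 2.

Definition hyperplane : set Cn := [set z | half_polydisc z /\ z 0 i0 = 0].

Definition axis_pt (q : C) : Cn := q *: delta_mx 0 i2.

Lemma axis_ptE q i : axis_pt q 0 i = if i == i2 then q else 0.
Proof. by rewrite !mxE eqxx /=; case: eqP => _; rewrite ?mulr1 ?mulr0. Qed.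

(** The factor [cabs 1 ^+ 2] makes this literally the integrand in the
    definition of the ideal at the constant function 1. *)
Definition unit_integrand (alpha eps : R) (y : Cn) : \bar R :=
  ((cabs (1 : C) ^+ 2 * (cabs (y 0 i0) ^+ 2 * (- ln (cabs (y 0 i0))) `^ alpha)^-1)%:E *
   expeR (- ((1 + eps)%:E * potential i0 i1 i2 p y)))%E.

Lemma unit_integrandE alpha eps y (r : R) : neg_potential i0 i1 i2 p y = r%:E ->
  unit_integrand alpha eps y =
  ((cabs (y 0 i0) ^+ 2 * (- ln (cabs (y 0 i0))) `^ alpha)^-1 * expR ((1 + eps) * r))%:E.
Proof.
move=> Er; rewrite /unit_integrand /potential Er cabs1 expr1n mul1r.
by rewrite muleN oppeK.
Qed.

(** For [|z0|] about [2^-l] and [|z1|] about [2^-k], up to constants the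
    weight is at most [4^l l^(- alpha)] and, by [exp_split], the exponential at
    most [4^((1 - eps) k) l^g]: the power [l^g] comes from the logarithmic
    bound on the barriers and the smallness of [eps].  As [g = (alpha - 1) / 2],
    the total exponent of [l] is [- g - 1], so that the bound is a product of
    two majorants as in [plane_majorant]. *)
Lemma unit_integrand_bound (alpha eps B : R) (G1 G2 : plane -> \bar R) (y : Cn) :
  let g := (alpha - 1) / 2 in
  1 < alpha -> 0 < eps -> eps <= 1 / 2 -> 0 <= B -> 4 * eps * (1 + 2 * B) <= g ->
  (forall x, 0 <= G1 x)%E -> (forall x, 0 <= G2 x)%E ->
  (forall l x, square (2 ^- l) x -> ((power_gap g l * 4 ^+ l)%:E <= G1 x)%E) ->
  (forall l x, square (2 ^- l) x ->
    ((4 * expR (- (2 * eps * ln 2)) ^+ l.+1 * 4 ^+ l)%:E <= G2 x)%E) ->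
  G2 (0, 0) = +oo%E ->
  half_polydisc y -> cabs (y 0 i0) <= 1 / 8 -> (forall j, ell (y 0 i2 - p j)%R <= B%:E)%E ->
  (unit_integrand alpha eps y <=
    (4 * 5 `^ alpha * expR (2 * eps * (2 + 2 * B)) / g)%:E *
      (G1 (cre (y 0 i0), cim (y 0 i0))%R * G2 (cre (y 0 i1), cim (y 0 i1))%R))%E.
Proof.
move=> g a1 e0 e1 B0 eB G10 G20 G1P G2P G2oo Uy y0 yB.
have g0 : 0 < g by rewrite /g; lra.
set K := 4 * _ * _ / g.
have K0 : 0 < K by rewrite /K divr_gt0// mulr_gt0 ?expR_gt0// mulr_gt0 ?powR_gt0.
have [y00|y00] := eqVneq (y 0 i0) 0.
  rewrite /unit_integrand y00 cabs0 expr0n mul0r invr0 mulr0 mul0e.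
  by apply: mule_ge0; [rewrite lee_fin ltW|exact: mule_ge0].
have [l [l1 l2 lsq]] := supn_shell y00 (half_polydisc_le1 i0 Uy).
have l3 : (3 <= l)%N.
  rewrite leqNgt; apply/negP => l3.
  have : supn (y 0 i0) <= 1 / 8 by apply: le_trans y0; exact: supn_le_cabs.
  have : 2 ^- 3 <= 2 ^- l.+1 :> R.
    by rewrite lef_pV2 ?posrE ?exprn_gt0// ler_weXn2l// ler1n.
  have -> : 2 ^- 3 = 1 / 8 :> R by rewrite !exprS expr0; lra.
  lra.
have z1 : 2 ^- l.+1 <= cabs (y 0 i0) by apply: le_trans (supn_le_cabs _); exact: ltW.
have z2 : cabs (y 0 i0) <= 2 * 2 ^- l.
  by apply: le_trans (cabs_le_supn _) _; rewrite ler_pM2l.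
have G1y := G1P l _ lsq.
have rz := power_gap_ge l g0.
have l2p : 0 < l.+2%:R :> R by rewrite ltr0Sn.
have rpos : 0 < power_gap g l by apply: lt_le_trans rz; rewrite mulr_gt0// powR_gt0.
have G1pos : (0 < G1 (cre (y 0 i0), cim (y 0 i0))%R)%E.
  by apply: lt_le_trans G1y; rewrite lte_fin mulr_gt0 ?exprn_gt0.
(* at [z1 = 0] the right-hand side is infinite *)
have [y10|y10] := eqVneq (y 0 i1) 0.
  have -> : (cre (y 0 i1), cim (y 0 i1)) = (0, 0) by rewrite y10.
  by rewrite G2oo gt0_muley// gt0_muley ?lte_fin// leey.
have c1 : cabs (y 0 i1) <= 1 := half_polydisc_le1 i1 Uy.
have [k [k1 k2 ksq]] := supn_shell y10 c1.
have G2y := G2P k _ ksq.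
have V := einfs_barrier_le B0 yB z1.
set W := (1 + 2 * B) * _ + 1 in V.
have w1 : 2 ^- k.+1 <= cabs (y 0 i1) by apply: le_trans (supn_le_cabs _); exact: ltW.
have lam : (ell (y 0 i1)%R <= (k.+1%:R * ln 2)%:E)%E.
  apply: le_trans (ell_le _ w1) _; first by rewrite invr_gt0 exprn_gt0.
  by rewrite ln_pow2V opprK.
have P0 : (0 <= neg_potential i0 i1 i2 p y)%E := neg_potential_ge0 i0 i1 i2 p_half Uy.
have P1 : (neg_potential i0 i1 i2 p y <= (2 * (k.+1%:R * ln 2))%:E)%E.
  rewrite /neg_potential ge_min; apply/orP; left; rewrite EFinM.
  by apply: lee_wpmul2l => //; rewrite lee_fin.
have P2 : (neg_potential i0 i1 i2 p y <= W%:E)%E by rewrite /neg_potential ge_min V orbT.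
have [r Er] : exists r, neg_potential i0 i1 i2 p y = r%:E.
  by move: P0 P2; case: (neg_potential _ _ _ _ _) => // r _ _; exists r.
move: P1 P2; rewrite Er !lee_fin => P1 P2.
rewrite (unit_integrandE _ _ Er).
apply: (@le_trans _ _ (K%:E * ((power_gap g l * 4 ^+ l)%:E *
  (4 * expR (- (2 * eps * ln 2)) ^+ k.+1 * 4 ^+ k)%:E))%E); last first.
  apply: lee_wpmul2l; first by rewrite lee_fin ltW.
  apply: lee_pmul; [| |exact: G1y|exact: G2y]; rewrite lee_fin.
    by apply: mulr_ge0; [exact: ltW|exact: exprn_ge0].
  apply: mulr_ge0; last exact: exprn_ge0.
  by apply: mulr_ge0 => //; apply: exprn_ge0; exact: expR_ge0.
rewrite -!EFinM lee_fin.
have ee := exp_split e0 e1 P1 P2.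
have we := weight_le (lt_trans ltr01 a1) l3 z1 z2.
apply: le_trans (ler_pM _ _ we ee) _; rewrite ?expR_ge0//.
  by rewrite invr_ge0 mulr_ge0 ?exprn_ge0 ?cabs_ge0 ?powR_ge0.
have E2 : expR (2 * (1 - eps) * (k.+1%:R * ln 2)) =
    4 * expR (- (2 * eps * ln 2)) ^+ k.+1 * 4 ^+ k.
  have -> : 4 * expR (- (2 * eps * ln 2)) ^+ k.+1 * 4 ^+ k =
     4 ^+ k.+1 * expR (- (2 * eps * ln 2)) ^+ k.+1 :> R by rewrite [4 ^+ k.+1]exprS; ring.
  have -> : 4 = expR (2 * ln 2) :> R.
    rewrite mulr_natl mulr2n expRD lnK ?posrE//; lra.
  rewrite -!expRM_natl -expRD; congr expR; ring.
rewrite E2.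
have W0 : expR (2 * eps * W) <= expR (2 * eps * (2 + 2 * B)) * l.+2%:R `^ g.
  rewrite /powR gt_eqF// -expRD ler_expR /W.
  have ln0 : 0 <= ln l.+2%:R :> R by rewrite ln_ge0// ler1n.
  have := ler_wpM2r ln0 eB; lra.
set E4 := 4 * expR _ ^+ _ * _.
have E40 : 0 <= E4.
  apply: mulr_ge0; last exact: exprn_ge0.
  by apply: mulr_ge0 => //; apply: exprn_ge0; exact: expR_ge0.
have powE : l.+2%:R `^ (- alpha) * l.+2%:R `^ g = l.+2%:R `^ (- g - 1) :> R.
  rewrite -powRD; last by apply/implyP => _; rewrite (gt_eqF l2p).
  by congr (_ `^ _); rewrite /g; lra.
have -> : K * (power_gap g l * 4 ^+ l * E4) =
  (4 ^+ l.+1 * 5 `^ alpha * expR (2 * eps * (2 + 2 * B)) * (power_gap g l / g)) * E4.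
  by rewrite /K exprS; field; lra.
have h1 : l.+2%:R `^ (- g - 1) <= power_gap g l / g by rewrite ler_pdivlMr// mulrC.
rewrite mulrCA mulrC ler_wpM2r//.
have A0 : 0 <= 4 ^+ l.+1 * 5 `^ alpha :> R by rewrite mulr_ge0 ?exprn_ge0 ?powR_ge0.
have pa0 : 0 <= l.+2%:R `^ (- alpha) :> R by exact: powR_ge0.
apply: (@le_trans _ _ (4 ^+ l.+1 * (5 `^ alpha * l.+2%:R `^ (- alpha)) *
   (expR (2 * eps * (2 + 2 * B)) * l.+2%:R `^ g))).
  by rewrite ler_wpM2l// mulrA mulr_ge0.
have -> : 4 ^+ l.+1 * (5 `^ alpha * l.+2%:R `^ (- alpha)) *
   (expR (2 * eps * (2 + 2 * B)) * l.+2%:R `^ g) =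
   4 ^+ l.+1 * 5 `^ alpha * expR (2 * eps * (2 + 2 * B)) * (l.+2%:R `^ (- alpha) * l.+2%:R `^ g).
  by ring.
by rewrite powE ler_wpM2l// mulr_ge0 ?expR_ge0.
Qed.

End Triviality.

(** * The hyperplane as a smooth divisor *)

Section HyperplaneEquation.
Context {R : realType} {n : nat}.
Local Notation C := (Cx R).
Local Notation Cn := 'rV[C]_n.
Variable (i0 : 'I_n).

Lemma differentiable_coord0 (y : Cn) : differentiable (fun z : Cn => z 0 i0 : C) y.
Proof. exact: differentiable_coord. Qed.

Lemma near_hyperplane (x : Cn) : half_polydisc x ->
  \forall y \near x, hyperplane i0 y <-> (y : Cn) 0 i0 = 0.
Proof.
move=> Ux.
have nU : \forall y \near x, half_polydisc y by apply: open_nbhs_nbhs; split; [exact: open_half_polydisc|].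
apply: (@filterS _ (nbhs x) (nbhs_filter x) _ _ _ nU) => y Uy.
by split=> [[]|].
Qed.

Lemma hyperplane_equation (x : Cn) : hyperplane i0 x ->
  local_equation (hyperplane i0) x (fun y : Cn => y 0 i0).
Proof.
move=> [Ux x0]; split => //.
- by apply: (@filterE _ (nbhs x) (nbhs_filter x)) => y; exact: differentiable_coord0.
- exact: near_hyperplane.
exists (delta_mx 0 i0).
have @f : {linear Cn -> C}.
  by exists (fun N : Cn => N 0 i0); do 2![eexists]; do ?[constructor];
     rewrite ?mxE// => ? *; rewrite ?mxE//; move=> ?; rewrite !mxE.
have cf : continuous f by exact: coord_continuous.
rewrite (_ : (fun y : Cn => y 0 i0) = f)// diff_lin//.
by rewrite /f /= mxE !eqxx oner_eq0.
Qed.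

Lemma smooth_hyperplane : smooth_divisor (half_polydisc : set Cn) (hyperplane i0).
Proof.
split; first by move=> x [].
- move=> x Ux nDx.
  have x0 : x 0 i0 != 0 by apply/eqP => x0; apply: nDx.
  apply: (nbhs_rVP x [set y | ~ hyperplane i0 y]).2.
  exists (cabs (x 0 i0)); first by rewrite cabs_gt0.
  by move=> y /(_ i0) + [_ y0]; rewrite y0 sub0r cabsN ltxx.
- by move=> x Dx; exists (fun y : Cn => y 0 i0); exact: hyperplane_equation.
Qed.

End HyperplaneEquation.

(** * Measurability in real coordinates *)

Section MeasurabilityPotential.
Context {R : realType} {n : nat}.
Local Notation C := (Cx R).
Local Notation Cn := 'rV[C]_n.
Local Notation plane := (measurableTypeR R * measurableTypeR R)%type.
Variables (i0 i1 i2 : 'I_n) (p : nat -> C).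

Lemma measurable_expeR : measurable_fun [set: \bar R] (@expeR R).
Proof.
have -> : @expeR R = fun x => maxe 0%E (er_map (@expR R) x).
  apply/funext => -[r| |] /=.
  - by rewrite max_r// lee_fin expR_ge0.
  - by rewrite max_r// leey.
  - by rewrite max_l// leNye.
apply: measurable_maxe; first exact: measurable_cst.
exact: (@measurable_er_map _ (measurableTypeR R) R _ (@measurable_expR R)).
Qed.

Lemma of_planesE (t : n.-tuple plane) i :
  (of_planes t : Cn) 0 i = pt (tnth t i).1 (tnth t i).2.
Proof. by rewrite mxE. Qed.

Lemma measurable_re_planes (i : 'I_n) : measurable_fun setT (fun t : n.-tuple plane => (tnth t i).1).
Proof. exact: (measurableT_comp measurable_fst (measurable_tnth i)). Qed.

Lemma measurable_im_planes (i : 'I_n) : measurable_fun setT (fun t : n.-tuple plane => (tnth t i).2).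
Proof. exact: (measurableT_comp measurable_snd (measurable_tnth i)). Qed.

Lemma measurable_ell_planes (i : 'I_n) (c : C) :
  measurable_fun setT ((fun t => ell ((of_planes t : Cn) 0 i - c)%R) : n.-tuple plane -> \bar R).
Proof.
have -> : (fun t : n.-tuple plane => ell ((of_planes t : Cn) 0 i - c)) =
    (fun t : n.-tuple plane => ell (pt ((tnth t i).1 - cre c) ((tnth t i).2 - cim c))).
  apply/funext => t; rewrite of_planesE; congr ell.
  by apply: Cx_eq; rewrite ?ReB ?ImB.
apply: measurable_ell => //; apply: measurable_funB => //;
  by [exact: measurable_re_planes|exact: measurable_im_planes].
Qed.

Lemma measurable_ell_planes0 (i : 'I_n) :
  measurable_fun setT ((fun t => ell ((of_planes t : Cn) 0 i)%R) : n.-tuple plane -> \bar R).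
Proof.
have -> : (fun t : n.-tuple plane => ell ((of_planes t : Cn) 0 i)) =
  (fun t : n.-tuple plane => ell ((of_planes t : Cn) 0 i - 0)).
  by apply/funext => t; rewrite subr0.
exact: measurable_ell_planes.
Qed.

Lemma measurable_cabs_planes (i : 'I_n) (c : C) :
  measurable_fun setT (fun t : n.-tuple plane => cabs ((of_planes t : Cn) 0 i - c)).
Proof.
have -> : (fun t : n.-tuple plane => cabs ((of_planes t : Cn) 0 i - c)) =
    (fun t : n.-tuple plane => Num.sqrt (((tnth t i).1 - cre c) ^+ 2 + ((tnth t i).2 - cim c) ^+ 2)).
  apply/funext => t; rewrite of_planesE cabsE.
  by rewrite ReB ImB.
have ms : measurable_fun [set: R] (@Num.sqrt R).
  by apply: continuous_measurable_fun; exact: sqrt_continuous.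
apply: (measurableT_comp ms); apply: measurable_funD; apply: measurable_funX;
  apply: measurable_funB => //;
  by [exact: measurable_re_planes|exact: measurable_im_planes].
Qed.

Lemma measurable_neg_potential_planes :
  measurable_fun setT ((fun t => neg_potential i0 i1 i2 p (of_planes t)) : n.-tuple plane -> \bar R).
Proof.
apply: measurable_mine.
  by apply: measurable_funeM; exact: measurable_ell_planes0.
apply: (@measurable_fun_einfs _ _ _ setT (fun k t => barrier i0 i2 p k (of_planes t))) => k.
rewrite /barrier; apply: emeasurable_funD; last first.
  by apply: measurable_funeM; exact: measurable_ell_planes0.
apply: emeasurable_funD; first exact: measurable_cst.
by apply: emeasurable_sum => j; apply: measurable_funeM; exact: measurable_ell_planes.
Qed.

Lemma measurable_unit_integrand alpha eps : measurable_fun setT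
  ((fun t => unit_integrand i0 i1 i2 p alpha eps (of_planes t)) : n.-tuple plane -> \bar R).
Proof.
have mc : measurable_fun setT (fun t : n.-tuple plane => cabs ((of_planes t : Cn) 0 i0)).
  have -> : (fun t : n.-tuple plane => cabs ((of_planes t : Cn) 0 i0)) =
     (fun t : n.-tuple plane => cabs ((of_planes t : Cn) 0 i0 - 0)).
    by apply/funext => t; rewrite subr0.
  exact: measurable_cabs_planes.
rewrite /unit_integrand /potential; apply: emeasurable_funM.
  apply/measurable_EFinP; apply: measurable_funM; first exact: measurable_cst.
  have -> : (fun t : n.-tuple plane => (cabs ((of_planes t : Cn) 0 i0) ^+ 2 *
      (- ln (cabs ((of_planes t : Cn) 0 i0))) `^ alpha)^-1) =
    (fun t : n.-tuple plane => (cabs ((of_planes t : Cn) 0 i0) ^+ 2 *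
      (- ln (cabs ((of_planes t : Cn) 0 i0))) `^ alpha) `^ (-1)).
    apply/funext => t; rewrite powR_inv1// mulr_ge0 ?powR_ge0// exprn_ge0//.
    exact: cabs_ge0.
  apply: (measurableT_comp (measurable_powR (-1))).
  apply: measurable_funM; first exact: measurable_funX.
  apply: (measurableT_comp (measurable_powR alpha)).
  by apply: measurableT_comp => //; apply: measurableT_comp.
apply: (measurableT_comp measurable_expeR).
apply: measurableT_comp => //; apply: measurable_funeM.
apply: measurableT_comp => //; exact: measurable_neg_potential_planes.
Qed.

End MeasurabilityPotential.

(** * The ideal is trivial away from the poles *)

Section OneInAdjoint.
Context {R : realType} {n : nat}.
Local Notation C := (Cx R).
Local Notation Cn := 'rV[C]_n.
Local Notation plane := (measurableTypeR R * measurableTypeR R)%type.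
Local Notation m := (product_sigma_finite (@lebesgue_measure R) (@lebesgue_measure R)).

Lemma measurable_polydisc x r :
  measurable ((@of_planes R n : n.-tuple plane -> Cn) @^-1` polydisc x r).
Proof.
have -> : (@of_planes R n : n.-tuple plane -> Cn) @^-1` polydisc x r =
    \bigcap_(i in [set: 'I_n]) ((fun t : n.-tuple plane => cabs ((of_planes t : Cn) 0 i - x 0 i))
       @^-1` [set` `]-oo, r[]).
  apply/seteqP; split => t.
    by move=> /= Wt i _ /=; rewrite in_itv /=; exact: Wt.
  by move=> Wt i; have := Wt i Logic.I; rewrite /= in_itv.
apply: fin_bigcap_measurable => // i _.
rewrite -[X in measurable X]setTI; apply: measurable_cabs_planes => //.
Qed.

Variables (i0 i1 i2 : 'I_n) (p : nat -> C).
Hypotheses (i01 : i0 != i1) (i02 : i0 != i2) (p_half : forall j, cabs (p j) <= 1 / 2).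

(** Near [axis_pt i2 q] the coordinate [z2] stays at distance at least
    [d / 2] from the poles, so [unit_integrand_bound] applies as soon as [eps]
    is small enough in terms of [d]; the bound is a product over the
    coordinates. *)
Lemma one_in_adjoint (alpha d : R) (q : C) : 1 < alpha -> cabs q < 1 / 2 ->
  0 < d -> d <= 1 -> (forall j, d <= cabs (q - p j)) ->
  adjoint_ideal alpha (hyperplane i0) (potential i0 i1 i2 p) (axis_pt i2 q : Cn) (fun=> 1).
Proof.
move=> a1 qh d0 d1 dq.
pose B := - ln (d / 2).
have B0 : 0 <= B by rewrite /B oppr_ge0 ln_le0//; lra.
pose g := (alpha - 1) / 2; have g0 : 0 < g by rewrite /g; lra.
have B1 : 0 < 4 * (1 + 2 * B) by lra.
pose eps := Num.min (1 / 2) (g / (4 * (1 + 2 * B))).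
have e0 : 0 < eps by rewrite lt_min; apply/andP; split; [lra|exact: divr_gt0].
have e1 : eps <= 1 / 2 by rewrite ge_min lexx.
have eB : 4 * eps * (1 + 2 * B) <= g.
  have : eps <= g / (4 * (1 + 2 * B)) by rewrite ge_min lexx orbT.
  by rewrite ler_pdivlMr//; lra.
pose rho := Num.min (1 / 8) (Num.min (d / 2) (1 / 2 - cabs q)).
have rho0 : 0 < rho by rewrite !lt_min; lra.
have rho8 : rho <= 1 / 8 by rewrite ge_min lexx.
have rhod : rho <= d / 2 by rewrite !ge_min lexx orbT.
have rhoq : rho <= 1 / 2 - cabs q by rewrite !ge_min lexx !orbT.
pose x : Cn := axis_pt i2 q.
have xq i : cabs (x 0 i) <= cabs q.
  by rewrite /x axis_ptE; case: ifP => _ //; rewrite cabs0 cabs_ge0.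
have WU y : polydisc x rho y -> half_polydisc y.
  move=> Wy i; have := Wy i; have := xq i; have := cabsD (y 0 i - x 0 i) (x 0 i).
  rewrite subrK; lra.
have Ux : half_polydisc x by move=> i; apply: le_lt_trans (xq i) qh.
have Dx : hyperplane i0 x by split => //; rewrite /x axis_ptE (negbTE i02).
exists eps => //; split.
  by apply: (@filterE _ (nbhs x) (nbhs_filter x)) => y; exact: differentiable_cst.
exists (fun y => (cabs ((y : Cn) 0 i0) ^+ 2 * (- ln (cabs (y 0 i0))) `^ alpha)^-1).
  by right; exists (fun y : Cn => y 0 i0) => //; exact: hyperplane_equation.
exists (polydisc x rho); split; first exact: open_polydisc.
  by move=> i; rewrite subrr cabs0.
have [G1 [mG1 G10 G1oo G1P _]] := plane_majorant (fun l => power_gap_ge0 l g0) (fun k => power_gap_sum k g0).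
pose qq := expR (- (2 * eps * ln 2)) : R.
have ln20 : 0 < ln 2 :> R by apply: lt_le_trans (@ln2_ge_half R); rewrite divr_gt0.
have qq0 : 0 <= qq := expR_ge0 _.
have qq1 : qq < 1 by rewrite /qq expR_lt1 oppr_lt0 mulr_gt0// mulr_gt0.
have a20 l : 0 <= 4 * qq ^+ l.+1 by rewrite mulr_ge0// exprn_ge0.
have [G2 [mG2 G20 G2oo G2P G2y]] := plane_majorant a20 (fun k => geometric_sum_le k qq0 qq1).
have {}G2y : G2 (0, 0) = +oo%E.
  apply: G2y => l; have -> : 4 * qq ^+ l.+1 * 4 ^+ l = (4 * qq) ^+ l.+1 by rewrite exprMn [4 ^+ l.+1]exprS; ring.
  apply: exprn_ege1.
  have -> : 4 * qq = expR (2 * ln 2 - 2 * eps * ln 2).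
    rewrite expRD /qq; congr (_ * _).
    have -> : 2 * ln 2 = ln 2 + ln 2 :> R by ring.
    by rewrite expRD lnK ?posrE//; ring.
  by apply/ltW/pexpR_gt1; nra.
(* the remaining coordinates are confined to the unit square *)
pose gg (i : 'I_n) : plane -> \bar R := fun z =>
  if i == i0 then G1 z else if i == i1 then G2 z else (\1_(square 1) z)%:E.
have mgg i : measurable_fun setT (gg i).
  rewrite /gg; case: eqP => // _; case: eqP => // _.
  by apply/measurable_EFinP; apply: measurable_indic; exact: measurable_box.
have gg0 i z : (0 <= gg i z)%E.
  by rewrite /gg; case: eqP => // _; case: eqP => // _; rewrite lee_fin.
pose K := 4 * 5 `^ alpha * expR (2 * eps * (2 + 2 * B)) / g.
have K0 : 0 <= K.
  by rewrite /K divr_ge0 ?(ltW g0)// mulr_ge0 ?expR_ge0// mulr_ge0 ?powR_ge0.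
pose Wt := (@of_planes R n : n.-tuple plane -> Cn) @^-1` polydisc x rho.
have mW : measurable Wt := measurable_polydisc x rho.
pose F (t : n.-tuple plane) := unit_integrand i0 i1 i2 p alpha eps (of_planes t).
have mF : measurable_fun setT F by exact: measurable_unit_integrand.
have F0 t : (0 <= F t)%E.
  apply: mule_ge0; last exact: expeR_ge0.
  by rewrite lee_fin mulr_ge0 ?exprn_ge0 ?cabs_ge0// invr_ge0 mulr_ge0 ?exprn_ge0 ?cabs_ge0 ?powR_ge0.
have FT t : Wt t -> (F t <= K%:E * tprod gg t)%E.
  move=> Wt_t; have Uy := WU _ Wt_t.
  have -> : tprod gg t = (G1 (tnth t i0) * G2 (tnth t i1))%E.
    rewrite /tprod (bigD1 i0)//= (bigD1 i1) 1?eq_sym//= big1 ?mule1.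
      by rewrite /gg eqxx eq_sym (negbTE i01) eqxx.
    move=> i /andP[ii0 ii1]; rewrite /gg (negbTE ii0) (negbTE ii1) indicE mem_set//.
    have := half_polydisc_le1 i Uy; rewrite of_planesE => yi.
    have := le_trans (Re_le_cabs _) yi; have := le_trans (Im_le_cabs _) yi.
    by rewrite /square /= !in_itv /= !ler_norml => -> ->.
  have y0 : cabs ((of_planes t : Cn) 0 i0) <= 1 / 8.
    have := Wt_t i0; rewrite /x axis_ptE (negbTE i02) subr0 => /ltW h.
    exact: le_trans h rho8.
  have yB j : (ell ((of_planes t : Cn) 0 i2 - p j)%R <= B%:E)%E.
    apply: ell_le; first by rewrite divr_gt0.
    have := Wt_t i2; rewrite /x axis_ptE eqxx => h.
    have h1 := dq j; have := cabsD ((of_planes t : Cn) 0 i2 - p j) (q - (of_planes t : Cn) 0 i2).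
    rewrite (_ : _ + _ = q - p j); last by ring.
    rewrite (cabsB q ((of_planes t : Cn) 0 i2)); lra.
  have := unit_integrand_bound (i2 := i2) i1 p_half a1 e0 e1 B0 eB G10 G20 G1P G2P G2y Uy y0 yB.
  by rewrite !of_planesE; case: (tnth t i0) => ? ?; case: (tnth t i1).
have fin : (\int[lebesgue_planes n]_(t in Wt) F t < +oo)%E.
  apply: (@le_lt_trans _ _ (\int[lebesgue_planes n]_(t in Wt) (K%:E * tprod gg t))%E).
    apply: ge0_le_integral => //.
    - exact: measurable_funTS.
    - by apply: measurable_funTS; apply: measurable_funeM; exact: measurable_tprod.
  apply: (@le_lt_trans _ _ (\int[lebesgue_planes n]_t (K%:E * tprod gg t))%E).
    apply: ge0_subset_integral => //.
    - by apply: measurable_funeM; exact: measurable_tprod.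
    - by move=> t _; apply: mule_ge0; [rewrite lee_fin|exact: tprod_ge0].
  rewrite ge0_integralZl_EFin//; last 2 first.
  - by move=> t _; exact: tprod_ge0.
  - exact: measurable_tprod.
  rewrite /lebesgue_planes integral_tprod//.
  apply: lte_mul_pinfty => //.
  suff : (0 <= \big[*%E/1]_(i < n) \int[m]_z gg i z < +oo)%E by case/andP.
  elim/big_ind : _ => [|u v /andP[u0 u1] /andP[v0 v1]|i _].
  - by rewrite lee01 ltey.
  - rewrite mule_ge0// lte_mul_pinfty// ge0_fin_numE//.
  - rewrite integral_ge0//= /gg; case: eqP => // _; case: eqP => // _.
    rewrite integral_indic//; last exact: measurable_box.
    rewrite setIT; apply: (@le_lt_trans _ _ (4 * 1 ^+ 2)%:E); last exact: ltry.
    by rewrite -plane_square.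
apply/integrableP; split; first exact: measurable_funTS.
by under eq_integral => t _ do rewrite gee0_abs//.
Qed.

End OneInAdjoint.

(** * Estimates near a pole *)

Section Divergence.
Context {R : realType} {n : nat}.
Local Notation C := (Cx R).
Local Notation Cn := 'rV[C]_n.
Local Notation plane := (measurableTypeR R * measurableTypeR R)%type.
Local Notation m2 := (product_sigma_finite (@lebesgue_measure R) (@lebesgue_measure R)).

(** Let [s] be the bound on [t], of order [2^-m].  Then [- log t] exceeds
    [- log s] by [log (s / t)], and this is absorbed by the factor [s / t]
    gained in [t^2].  The weight is thus at least of order
    [4^m m^(- alpha)], uniformly in [t]. *)
Lemma weight_growth (alpha t K : R) (m : nat) : 0 < alpha -> 1 <= K -> (0 < m)%N ->
  0 < t -> t < 1 -> t <= K * (2 * 2 ^- m) ->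
  0 < t ^+ 2 * (- ln t) `^ alpha /\
  t ^+ 2 * (- ln t) `^ alpha <= (1 + alpha) `^ alpha * (4 * K ^+ 2) * (m%:R `^ alpha * 4 ^- m).
Proof.
move=> a0 K1 m0 t0 t1 ts; pose s := K * (2 * 2 ^- m).
have s0 : 0 < s by rewrite /s !mulr_gt0 ?invr_gt0 ?exprn_gt0//; lra.
have lt0 : 0 < - ln t by rewrite oppr_gt0 ln_lt0// t0.
split; first by rewrite mulr_gt0 ?exprn_gt0// powR_gt0.
pose y := s / t.
have y1 : 1 <= y by rewrite /y ler_pdivlMr// mul1r.
have y0 : 0 < y by lra.
have mR : 1 <= m%:R :> R by rewrite ler1n.
have lns : - ln s <= m%:R.
  rewrite /s !lnM ?posrE ?mulr_gt0 ?invr_gt0 ?exprn_gt0//; try lra.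
  rewrite ln_pow2V.
  have lnK : 0 <= ln K by rewrite ln_ge0.
  have := @ln2_ge_half R; have := @ln2_le1 R; nra.
have lny : ln y <= alpha * y `^ (alpha^-1).
  have -> : ln y = alpha * ln (y `^ (alpha^-1)) by rewrite ln_powR; field; lra.
  by rewrite ler_pM2l//; apply/ltW/ln_sublinear; rewrite powR_gt0.
have yp1 : 1 <= y `^ (alpha^-1) by rewrite -[leLHS](powRr0 y) ler_powR// invr_ge0 ltW.
have lnt : - ln t <= m%:R * (1 + alpha) * y `^ (alpha^-1).
  have -> : - ln t = - ln s + ln y by rewrite /y ln_div ?posrE//; ring.
  move: (y `^ alpha^-1) lny yp1 => Y lny Y1.
  have h1 : 0 <= m%:R * (Y - 1) by rewrite mulr_ge0//; lra.
  have h2 : 0 <= alpha * Y * (m%:R - 1) by rewrite !mulr_ge0//; lra.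
  lra.
have pw : (- ln t) `^ alpha <= (m%:R * (1 + alpha) * y `^ (alpha^-1)) `^ alpha.
  apply: (ge0_ler_powR (ltW a0)) => //; rewrite nnegrE; first exact: ltW.
  by apply: le_trans lnt; exact: ltW.
have pwE : (m%:R * (1 + alpha) * y `^ (alpha^-1)) `^ alpha = m%:R `^ alpha * (1 + alpha) `^ alpha * y.
  have ma0 : 0 <= 1 + alpha by lra.
  have mm0 : 0 <= m%:R :> R by [].
  rewrite (powRM _ (mulr_ge0 mm0 ma0) (powR_ge0 _ _)) (powRM _ mm0 ma0).
  have aV : alpha^-1 * alpha = 1 by rewrite mulVf// gt_eqF.
  by rewrite -powRrM aV (powRr1 (ltW y0)).
rewrite pwE in pw.
have t2 : 0 <= t ^+ 2 by rewrite exprn_ge0// ltW.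
apply: le_trans (ler_wpM2l t2 pw) _.
have A0 : 0 <= m%:R `^ alpha * (1 + alpha) `^ alpha by rewrite mulr_ge0 ?powR_ge0.
have -> : t ^+ 2 * (m%:R `^ alpha * (1 + alpha) `^ alpha * y) =
   m%:R `^ alpha * (1 + alpha) `^ alpha * (t * s) by rewrite /y; field; lra.
have -> : (1 + alpha) `^ alpha * (4 * K ^+ 2) * (m%:R `^ alpha * 4 ^- m) =
   m%:R `^ alpha * (1 + alpha) `^ alpha * (s * s).
  have -> : 4 ^- m = 2 ^- m * 2 ^- m :> R.
    by rewrite -invfM -exprMn; congr (_ ^- _); lra.
  rewrite /s; ring.
by apply: ler_wpM2l => //; apply: ler_wpM2r => //; exact: ltW.
Qed.

Variables (i0 i2 : 'I_n) (p : nat -> C).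
Hypothesis p_lt : forall j, cabs (p j) < 1 / 2.

Let p_half j : cabs (p j) <= 1 / 2 := ltW (p_lt j).

(** There are three ranges of [k].  If [k <= j] or [2^k < M^2], the last
    term of the barrier is at least [8 kap M].  Otherwise the pole at
    [p j] contributes at least [4 kap k], and [k >= 2 log M]. *)
Lemma barrier_ge_log (kap j M : nat) (y : Cn) : half_polydisc y -> (2 <= M)%N ->
  32 * kap%:R * 2 ^+ j <= M%:R :> R ->
  ((4 * kap%:R * 2 ^+ j)%:E <= ell (y 0 i2 - p j)%R)%E ->
  ((M%:R ^+ 4 / 4)%:E <= ell (y 0 i0)%R)%E ->
  forall k, ((8 * kap%:R * ln M%:R)%:E <= barrier i0 i2 p k y)%E.
Proof.
move=> Uy M2 Mk yp y0 k.
have MR : 2 <= M%:R :> R by rewrite (ler_nat _ 2).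
have M0 : 0 < M%:R :> R by lra.
have K0 : 0 <= kap%:R :> R by [].
have lnM : ln M%:R <= M%:R :> R by apply/ltW/ln_sublinear.
have j1 : 1 <= 2 ^+ j :> R by rewrite exprn_ege1// ler1n.
have last_le : ((2 ^- k)%:E * ell (y 0 i0)%R <= barrier i0 i2 p k y)%E.
  rewrite /barrier -[leLHS]add0e; apply: leeD => //.
  by apply: adde_ge0; [rewrite lee_fin|exact: barrier_sum_ge0].
have lastb (r : R) : 0 <= r -> 8 * kap%:R * ln M%:R <= r * (M%:R ^+ 4 / 4) ->
    r <= 2 ^- k -> ((8 * kap%:R * ln M%:R)%:E <= barrier i0 i2 p k y)%E.
  move=> r0 h rk; apply: le_trans last_le.
  apply: (@le_trans _ _ ((2 ^- k)%:E * (M%:R ^+ 4 / 4)%:E)%E).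
    rewrite -EFinM lee_fin; apply: le_trans h _.
    exact: (ler_wpM2r (divr_ge0 (exprn_ge0 4 (ltW M0)) (ler0n R 4)) rk).
  by apply: lee_wpmul2l => //; rewrite lee_fin invr_ge0 exprn_ge0.
have kM : 8 * kap%:R * ln M%:R <= 8 * kap%:R * M%:R :> R by apply: ler_wpM2l => //; lra.
have [kj|jk] := leqP k j.
  apply: (lastb (2 ^- j)); first by rewrite invr_ge0 exprn_ge0.
    apply: le_trans kM _; rewrite [leRHS]mulrC ler_pdivlMr ?exprn_gt0//.
    have h1 : 32 * kap%:R * 2 ^+ j * M%:R <= M%:R * M%:R :> R by apply: ler_wpM2r => //; lra.
    have h2 : M%:R * M%:R <= M%:R ^+ 4 :> R.
      rewrite -expr2; apply: ler_weXn2l => //; lra.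
    have -> : 8 * kap%:R * M%:R * 2 ^+ j = 32 * kap%:R * 2 ^+ j * M%:R / 4 :> R by field.
    by rewrite ler_pM2r//; lra.
  by rewrite lef_pV2 ?posrE ?exprn_gt0// ler_weXn2l// ler1n.
have [Mk2|kM2] := lerP (M%:R ^+ 2) (2 ^+ k : R); last first.
  apply: (lastb ((M%:R ^+ 2)^-1)); first by rewrite invr_ge0 exprn_ge0.
    apply: le_trans kM _.
    have -> : (M%:R ^+ 2)^-1 * (M%:R ^+ 4 / 4) = M%:R * M%:R / 4 :> R by field; lra.
    have h0 : 32 * kap%:R <= M%:R :> R by nra.
    have h1 : 32 * kap%:R * M%:R <= M%:R * M%:R :> R by apply: ler_wpM2r => //; lra.
    lra.
  by rewrite lef_pV2 ?posrE ?exprn_gt0// ltW.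
have lnk : 2 * ln M%:R <= k%:R :> R.
  have : ln (M%:R ^+ 2) <= ln (2 ^+ k : R) by rewrite ler_ln ?posrE ?exprn_gt0.
  rewrite !lnXn// -!(mulr_natl (ln _)).
  have := @ln2_le1 R; have : 0 <= k%:R :> R by []; nra.
have term_le : ((k%:R / 2 ^+ j)%:E * ell (y 0 i2 - p j)%R <= barrier i0 i2 p k y)%E.
  rewrite /barrier (bigD1 (Ordinal jk))//= -addeA addeC -addeA -[leLHS]adde0.
  have -> : ((k%:R / 2 ^+ j)%:E * ell (y 0 i2 - p j)%R + 0 =
     (k%:R / 2 ^+ j)%:E * ell (y 0 i2 - p j)%R)%E by rewrite adde0.
  set T := (_ * ell (y 0%R i2 - p j)%R)%E.
  rewrite -addeA -[leLHS]adde0; apply: leeD => //; apply: adde_ge0.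
    apply: sume_ge0 => i _; apply: mule_ge0; first by rewrite lee_fin divr_ge0// exprn_ge0.
    exact/ell_ge0/half_polydisc_shift_le1.
  by apply: adde_ge0; [exact: barrier_last_ge0|rewrite lee_fin].
apply: le_trans term_le.
apply: (@le_trans _ _ ((k%:R / 2 ^+ j)%:E * (4 * kap%:R * 2 ^+ j)%:E)%E).
  rewrite -EFinM lee_fin.
  have -> : k%:R / 2 ^+ j * (4 * kap%:R * 2 ^+ j) = 4 * kap%:R * k%:R :> R.
    by field; rewrite expf_neq0.
  by have := ler_wpM2l (mulr_ge0 (ler0n R 4) K0) lnk; lra.
by apply: lee_wpmul2l => //; rewrite lee_fin divr_ge0// exprn_ge0.
Qed.

Definition tbox (B : 'I_n -> set plane) : set (n.-tuple plane) :=
  [set t | forall i, B i (tnth t i)].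

Lemma measurable_tbox B : (forall i, measurable (B i)) -> measurable (tbox B).
Proof.
move=> mB; have -> : tbox B = \bigcap_(i in [set: 'I_n]) ((fun t : n.-tuple plane => tnth t i) @^-1` B i).
  by apply/seteqP; split => t; [move=> Bt i _; exact: Bt|move=> Bt i; exact: Bt].
apply: fin_bigcap_measurable => // i _.
rewrite -[X in measurable X]setTI; exact: measurable_tnth.
Qed.

Lemma planes_tbox B : (forall i, measurable (B i)) ->
  lebesgue_planes n (tbox B) = (\big[*%E/1]_(i < n) m2 (B i))%E.
Proof.
move=> mB; have mT := measurable_tbox mB.
have mI i : measurable_fun setT (fun z : plane => (\1_(B i) z)%:E : \bar R).
  by apply/measurable_EFinP; exact: measurable_indic.
transitivity (\int[lebesgue_planes n]_t tprod (fun i z => (\1_(B i) z)%:E) t)%E.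
  transitivity (\int[lebesgue_planes n]_t (\1_(tbox B) t)%:E)%E.
    by rewrite integral_indic// setIT.
  apply: eq_integral => t _; rewrite /tprod indicE.
  have [Bt|nBt] := pselect (tbox B t).
    by rewrite mem_set// big1// => i _; rewrite indicE mem_set//; exact: Bt.
  rewrite memNset//.
  have [i Bi] : exists i, ~ B i (tnth t i) by apply/existsNP.
  by rewrite (bigD1 i)//= indicE memNset// mul0e.
rewrite /lebesgue_planes integral_tprod//; apply: eq_bigr => i _.
by rewrite integral_indic// setIT.
Qed.

End Divergence.

(** * The ideal vanishes at the poles *)

Section AdjointVanishes.
Context {R : realType}.
Local Notation plane := (measurableTypeR R * measurableTypeR R)%type.
Local Notation m2 := (product_sigma_finite (@lebesgue_measure R) (@lebesgue_measure R)).

(** The right-hand side is a lower bound of the integrand times the volume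
    of the box [|z0| ~ 2^-m], [|z1| <= m^(- kap)].  The powers of 2 cancel, and
    what remains is [m^(2 kap eps - alpha)], at least [m] by the choice of
    [kap]. *)
Lemma volume_balance (alpha eps K c1 V lm : R) (m kap : nat) :
  0 < alpha -> 0 < eps -> 0 < K -> 0 < c1 -> 0 < V -> 0 < m%:R :> R -> 0 <= lm ->
  m%:R = expR lm -> alpha + 1 <= 2 * kap%:R * eps ->
  c1 ^+ 2 / ((1 + alpha) `^ alpha * (4 * K ^+ 2)) * expR (- (2 * (1 + eps) * ln 2)) * 2 * V * m%:R
  <= (c1 ^+ 2 * ((1 + alpha) `^ alpha * (4 * K ^+ 2) * (m%:R `^ alpha * 4 ^- m))^-1 *
      expR ((1 + eps) * (2 * (kap%:R * lm) - 2 * ln 2))) *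
     ((2 ^- m.+1 * 2 ^- m) * (4 * expR (- (kap%:R * lm)) ^+ 2 * V)).
Proof.
move=> a0 e0 K0 c0 V0 m0 lm0 mlm kape.
pose A := (1 + alpha) `^ alpha * (4 * K ^+ 2).
have A0 : 0 < A by rewrite /A mulr_gt0 ?powR_gt0 ?mulr_gt0 ?exprn_gt0//; lra.
pose X := c1 ^+ 2 / A * expR (- (2 * (1 + eps) * ln 2)) * 2 * V.
have X0 : 0 < X by rewrite /X !mulr_gt0 ?invr_gt0 ?expR_gt0 ?exprn_gt0.
rewrite -/A -/X.
have mA : m%:R `^ alpha = expR (alpha * lm) by rewrite /powR gt_eqF// mlm expRK.
have p2 : 2 ^+ m != 0 :> R by rewrite expf_neq0.
have -> : (c1 ^+ 2 * (A * (m%:R `^ alpha * 4 ^- m))^-1 *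
      expR ((1 + eps) * (2 * (kap%:R * lm) - 2 * ln 2))) *
     ((2 ^- m.+1 * 2 ^- m) * (4 * expR (- (kap%:R * lm)) ^+ 2 * V)) =
     X * (expR (- (alpha * lm)) * expR ((1 + eps) * (2 * (kap%:R * lm))) * expR (- (kap%:R * lm)) ^+ 2).
  have -> : (1 + eps) * (2 * (kap%:R * lm) - 2 * ln 2) =
    (1 + eps) * (2 * (kap%:R * lm)) + (- (2 * (1 + eps) * ln 2)) by ring.
  rewrite expRD mA (expRN (alpha * lm)) /X.
  have -> : 4 ^- m = 2 ^- m * 2 ^- m :> R.
    by rewrite -invfM -exprMn; congr (_ ^- _); lra.
  rewrite [2 ^+ m.+1]exprS; field.
  by rewrite p2 gt_eqF ?expR_gt0// gt_eqF.
apply: ler_wpM2l; first exact: ltW.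
rewrite mlm expr2 -!expRD ler_expR.
have := ler_wpM2r lm0 kape; lra.
Qed.

Lemma cabs_box (z c : Cx R) (r : R) : cre c - r <= cre z <= cre c + r ->
  cim c - r <= cim z <= cim c + r -> cabs (z - c) <= 2 * r.
Proof.
move=> h1 h2; apply: le_trans (cabs_le _) _; rewrite ReB ImB mulr_natl mulr2n.
by apply: lerD; rewrite ler_distl.
Qed.

(** If [f] is not 0 at the pole, the integrand is bounded below on boxes
    near this point by [weight_growth] and [barrier_ge_log], and
    [volume_balance] makes its integral exceed any constant. *)
Lemma adjoint_vanishes (n : nat) (i0 i1 i2 : 'I_n) (p : nat -> Cx R) (alpha : R)
    (j : nat) (f : 'rV[Cx R]_n -> Cx R) :
  i0 != i1 -> i0 != i2 -> i1 != i2 -> (forall j, cabs (p j) < 1 / 2) -> 1 < alpha ->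
  adjoint_ideal alpha (hyperplane i0) (potential i0 i1 i2 p) (axis_pt i2 (p j)) f ->
  f (axis_pt i2 (p j)) = 0.
Proof.
move=> i01 i02 i12 p_lt a1 [eps e0 [hf [w wP [W [oW Wx Wint]]]]].
have a0 : 0 < alpha by lra.
set x := axis_pt i2 (p j) in hf wP Wx *.
have x_i i : x 0 i = if i == i2 then p j else 0 by exact: axis_ptE.
have x0 : x 0 i0 = 0 by rewrite x_i (negbTE i02).
have Ux : half_polydisc x.
  by move=> i; rewrite x_i; case: eqP => _ //; rewrite cabs0; lra.
have Dx : hyperplane i0 x by split.
case: wP => [[]//|[h [hh hx hD _] wE]].
have nHP := near_hyperplane i0 Ux.
have h0 : \forall y \near x, (y : 'rV[Cx R]_n) 0 i0 = 0 -> h y = 0.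
  apply: (@filterS2 _ (nbhs x) (nbhs_filter x) _ _ _ _ hD nHP) => y.
  by move=> [D1 _] [_ D2] y0; apply: D1; exact: D2.
have [K' [d1 [K'0 d10 hK']]] := vanishing_lipschitz hh x0 hx h0.
pose K := Num.max 1 K'.
have K1 : 1 <= K by rewrite le_max lexx.
have KK : K' <= K by rewrite le_max lexx orbT.
apply/eqP; rewrite -cabs_eq0 eq_le cabs_ge0 andbT leNgt; apply/negP => fx.
pose c1 := cabs (f x) / 2; have c10 : 0 < c1 by rewrite divr_gt0.
have nf : \forall y \near x, c1 <= cabs (f y).
  have /differentiable_continuous fc : differentiable f x by exact: nbhs_singleton hf.
  have := (@cvg_CxP _ _ f (nbhs x) (nbhs_filter x) (f x)).1 fc _ c10.
  apply: (@filterS _ (nbhs x) (nbhs_filter x)) => y.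
  by have := cabsD (f x - f y) (f y); rewrite subrK (cabsB (f x)) /c1; lra.
have nh1 : \forall y \near x, cabs (h y) < 1.
  have /differentiable_continuous hc : differentiable h x by exact: nbhs_singleton hh.
  have := (@cvg_CxP _ _ h (nbhs x) (nbhs_filter x) (h x)).1 hc _ ltr01.
  by apply: (@filterS _ (nbhs x) (nbhs_filter x)) => y; rewrite hx subr0.
have nU : \forall y \near x, half_polydisc y by apply: open_nbhs_nbhs; split; [exact: open_half_polydisc|].
have nW : \forall y \near x, W y by apply: open_nbhs_nbhs; split.
have nhK : \forall y \near x, cabs (h y) <= K * cabs ((y : 'rV[Cx R]_n) 0 i0).
  apply: (nbhs_rVP x [set y : 'rV[Cx R]_n | cabs (h y) <= K * cabs (y 0 i0)]).2.
  exists d1 => // y /hK' /= hy; apply: le_trans hy _.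
  by apply: ler_wpM2r => //; exact: cabs_ge0.
have /nbhs_rVP[r0 r00 r0P] : \forall y \near x, [/\ c1 <= cabs (f y),
    cabs (h y) < 1 /\ (h y = 0 -> (y : 'rV[Cx R]_n) 0 i0 = 0), half_polydisc y, W y
    & cabs (h y) <= K * cabs ((y : 'rV[Cx R]_n) 0 i0)].
  have nh0 : \forall y \near x, h y = 0 -> (y : 'rV[Cx R]_n) 0 i0 = 0.
    apply: (@filterS2 _ (nbhs x) (nbhs_filter x) _ _ _ _ hD nHP) => y.
    by move=> [_ D1] [D2 _] hy; apply: D2; exact: D1.
  by near=> y; split; [near: y|split; near: y|near: y|near: y|near: y].
have [kap kape kap1] : exists2 kap : nat, alpha + 1 <= 2 * kap%:R * eps & 1 <= kap%:R :> R.
  have [t tP] : exists t : nat, (alpha + 1) / (2 * eps) < t.+1%:R.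
    by eexists; exact: truncnS_gt.
  exists t.+1; last by rewrite ler1n.
  have ee : 0 < 2 * eps by rewrite mulr_gt0.
  by rewrite ltr_pdivrMr// in tP; clear -tP; lra.
pose rho := Num.min (r0 / 4) (expR (- (4 * kap%:R * 2 ^+ j)) / 2).
have rho0 : 0 < rho by rewrite lt_min !divr_gt0 ?expR_gt0.
have rho4 : rho <= r0 / 4 by rewrite ge_min lexx.
have rhoe : 2 * rho <= expR (- (4 * kap%:R * 2 ^+ j)).
  have : rho <= expR (- (4 * kap%:R * 2 ^+ j)) / 2 by rewrite ge_min lexx orbT.
  by clear; lra.
pose V := \prod_(i < n | (i != i0) && (i != i1)) (4 * rho ^+ 2).
have V0 : 0 < V by apply: prodr_gt0 => i _; rewrite mulr_gt0// exprn_gt0.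
have K0 : 0 < K := lt_le_trans ltr01 K1.
pose A := (1 + alpha) `^ alpha * (4 * K ^+ 2).
have A0 : 0 < A by rewrite /A mulr_gt0 ?powR_gt0 ?mulr_gt0 ?exprn_gt0//; clear -a0; lra.
pose E := c1 ^+ 2 / A * expR (- (2 * (1 + eps) * ln 2)) * 2 * V.
have E0 : 0 < E by rewrite /E !mulr_gt0 ?invr_gt0 ?expR_gt0 ?exprn_gt0.
pose Wt := (@of_planes R n : n.-tuple plane -> 'rV[Cx R]_n) @^-1` W.
pose F (y : 'rV[Cx R]_n) : \bar R :=
  ((cabs (f y) ^+ 2 * w y)%:E * expeR (- ((1 + eps)%:E * potential i0 i1 i2 p y)))%E.
have w0 y : 0 <= w y.
  by rewrite wE invr_ge0 mulr_ge0 ?exprn_ge0 ?cabs_ge0 ?powR_ge0.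
have F0 y : (0 <= F y)%E.
  apply: mule_ge0; last exact: expeR_ge0.
  by rewrite lee_fin mulr_ge0 ?exprn_ge0 ?cabs_ge0.
have [I I0 IE] : exists2 I : R, 0 <= I & (\int[lebesgue_planes n]_(t in Wt) F (of_planes t) = I%:E)%E.
  have Wi : (lebesgue_planes n).-integrable Wt (F \o @of_planes R n) := Wint.
  have /integrableP[_] := Wi.
  have -> : (\int[lebesgue_planes n]_(t in Wt) `|(F \o @of_planes R n) t| =
      \int[lebesgue_planes n]_(t in Wt) F (of_planes t))%E.
    by apply: eq_integral => t _; rewrite /= gee0_abs.
  have : (0 <= \int[lebesgue_planes n]_(t in Wt) F (of_planes t))%E by exact: integral_ge0.
  case: (integral _ _ _) => // r r1 _; exists r => //.
have q1 : 0 <= 32 * kap%:R * 2 ^+ j :> R by rewrite !mulr_ge0 ?exprn_ge0.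
have q2 : 0 < 2 / r0 by rewrite divr_gt0.
have q3 : 0 <= I / E by rewrite divr_ge0// ltW.
(* [M] exceeds all constants of the estimate; the box will be at distance about
   [2^-m] from the divisor with [m = M^4], so that [log m = 4 log M] *)
have [M Mgt] : exists M : nat, 2 + 32 * kap%:R * 2 ^+ j + 2 / r0 + I / E < M%:R :> R.
  by eexists; exact: truncnS_gt.
have M2 : (2 <= M)%N by rewrite -(ler_nat R); clear -Mgt q1 q2 q3; lra.
have MR : 2 <= M%:R :> R by rewrite (ler_nat _ 2).
have [m mR] : exists m : nat, m%:R = M%:R ^+ 4 :> R by exists (M ^ 4)%N; rewrite natrX.
have MmR : M%:R <= m%:R :> R by rewrite mR -[leLHS]expr1; apply: ler_weXn2l => //; clear -MR; lra.
have m0 : 0 < m%:R :> R by clear -MR MmR; lra.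
pose lm := ln (m%:R : R).
have lm0 : 0 <= lm by rewrite /lm ln_ge0//; clear -MR MmR; lra.
have elm : m%:R = expR lm by rewrite /lm lnK// posrE.
pose s := expR (- (kap%:R * lm)).
have sm : s <= m%:R^-1.
  rewrite elm -expRN ler_expR; have := ler_wpM2r lm0 kap1; clear; lra.
have s0 : 0 < s by exact: expR_gt0.
have mr0 : m%:R^-1 < r0 / 2.
  rewrite -[r0 / 2]invrK ltf_pV2 ?posrE ?invr_gt0 ?divr_gt0// invf_div.
  by clear -Mgt MmR q1 q3; lra.
have pm : 2 ^- m <= m%:R^-1 :> R.
  by rewrite lef_pV2 ?posrE ?exprn_gt0// -natrX ler_nat ltnW// ltn_expl.
have pm0 : 0 < 2 ^- m :> R by rewrite invr_gt0 exprn_gt0.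
have pmS : 2 ^- m.+1 = 2 ^- m / 2 :> R by rewrite exprS invfM mulrC.
pose B (i : 'I_n) : set plane :=
  if i == i0 then `[2 ^- m.+1, 2 ^- m]%classic `*` `[0, 2 ^- m]%classic
  else if i == i1 then square s
  else `[cre (x 0 i) - rho, cre (x 0 i) + rho]%classic `*`
       `[cim (x 0 i) - rho, cim (x 0 i) + rho]%classic.
have mB i : measurable (B i).
  by rewrite /B; case: eqP => _; [|case: eqP => _]; exact: measurable_box.
have volB : lebesgue_planes n (tbox B) =
    ((2 ^- m.+1 * 2 ^- m) * (4 * s ^+ 2 * V))%:E.
  rewrite planes_tbox// (bigD1 i0)//= (bigD1 i1) 1?eq_sym//=.
  have -> : m2 (B i0) = (2 ^- m.+1 * 2 ^- m)%:E.
    by rewrite /B eqxx plane_box ?pmS; clear -pm0; [congr EFin; lra|lra|lra].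
  have -> : m2 (B i1) = (4 * s ^+ 2)%:E.
    by rewrite /B eq_sym (negbTE i01) eqxx; apply: plane_square; exact: ltW.
  rewrite (eq_bigr (fun=> (4 * rho ^+ 2)%:E)); last first.
    move=> i /andP[ii0 ii1]; rewrite /B (negbTE ii0) (negbTE ii1) plane_box;
      [|clear -rho0; lra|clear -rho0; lra].
    by congr EFin; ring.
  by rewrite -(big_morph EFin EFinM erefl) -!EFinM.
pose v := 2 * (kap%:R * lm) - 2 * ln 2.
pose low := c1 ^+ 2 * (A * (m%:R `^ alpha * 4 ^- m))^-1 * expR ((1 + eps) * v).
have low0 : 0 <= low.
  rewrite /low mulr_ge0 ?expR_ge0// mulr_ge0 ?exprn_ge0 ?(ltW c10)// invr_ge0.
  by rewrite mulr_ge0 ?(ltW A0)// mulr_ge0 ?powR_ge0// invr_ge0 exprn_ge0.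
have lnm4 : lm = 4 * ln M%:R :> R.
  by rewrite /lm mR lnXn ?mulr_natl//; clear -MR; lra.
have ln20 : 0 < ln 2 :> R by apply: lt_le_trans (@ln2_ge_half R); rewrite divr_gt0.
have box t : tbox B t -> Wt t /\ (low%:E <= F (of_planes t))%E.
  move=> Bt; pose y : 'rV[Cx R]_n := of_planes t.
  have ycoord i : y 0 i = pt (tnth t i).1 (tnth t i).2 by exact: of_planesE.
  have b0 : 2 ^- m.+1 <= cre (y 0 i0) <= 2 ^- m /\ 0 <= cim (y 0 i0) <= 2 ^- m.
    by have := Bt i0; rewrite /B eqxx ycoord /cre /cim /= !in_itv /=.
  have b1 : - s <= cre (y 0 i1) <= s /\ - s <= cim (y 0 i1) <= s.
    by have := Bt i1; rewrite /B eq_sym (negbTE i01) eqxx ycoord /square /cre /cim /= !in_itv /=.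
  have b2 i : i != i0 -> i != i1 -> cabs (y 0 i - x 0 i) <= 2 * rho.
    move=> ii0 ii1; have := Bt i; rewrite /B (negbTE ii0) (negbTE ii1) /= !in_itv /=.
    by rewrite ycoord; case=> ? ?; exact: cabs_box.
  have y0le : cabs (y 0 i0) <= 2 * 2 ^- m.
    rewrite -[y 0 i0]subr0; have [c d] := b0.
    by apply: cabs_box; rewrite /cre /cim /= -/(cre _) -/(cim _); clear -c d pm0 pmS; lra.
  have y0ge : 2 ^- m.+1 <= cabs (y 0 i0).
    apply: le_trans (Re_le_cabs _); apply: le_trans (ler_norm _).
    by have [/andP[]] := b0.
  have y1le : cabs (y 0 i1) <= 2 * s.
    rewrite -[y 0 i1]subr0; have [c d] := b1.
    by apply: cabs_box; rewrite /cre /cim /= -/(cre _) -/(cim _); clear -c d; lra.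
  have ynear i : cabs (y 0 i - x 0 i) < r0.
    have [->|ii0] := eqVneq i i0.
      by rewrite x0 subr0; clear -y0le pm mr0; lra.
    have [->|ii1] := eqVneq i i1.
      by rewrite x_i (negbTE i12) subr0; clear -y1le sm mr0; lra.
    by have := b2 i ii0 ii1; clear -rho4 r00; lra.
  have [fy [hy1 hy0] Uy Wy hyK] := r0P y ynear.
  split; first exact: Wy.
  have y00 : y 0 i0 != 0.
    by rewrite -cabs_gt0; apply: lt_le_trans y0ge; rewrite pmS divr_gt0.
  have hypos : 0 < cabs (h y) by rewrite cabs_gt0; apply/eqP => /hy0; apply/eqP.
  have mnat : (0 < m)%N by rewrite -(ltr_nat R).
  have hyle : cabs (h y) <= K * (2 * 2 ^- m).
    by apply: le_trans hyK _; apply: ler_wpM2l => //; exact: ltW.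
  have [wpos wle] := weight_growth a0 K1 mnat hypos hy1 hyle.
  have wge : (A * (m%:R `^ alpha * 4 ^- m))^-1 <= w y.
    rewrite wE lef_pV2 ?posrE// mulr_gt0// mulr_gt0 ?powR_gt0 ?invr_gt0 ?exprn_gt0//.
  have Phi_ge : (v%:E <= neg_potential i0 i1 i2 p y)%E.
    rewrite /neg_potential le_min; apply/andP; split.
      have := ell_ge (mulr_gt0 (ltr0n R 2) s0) y1le.
      rewrite lnM ?posrE// /s expRK => hl.
      apply: (@le_trans _ _ ((2 : R)%:E * (- (ln 2 + - (kap%:R * lm)))%:E)%E).
        by rewrite -EFinM lee_fin /v; clear; lra.
      by apply: lee_wpmul2l => //; rewrite lee_fin.
    apply: (@le_trans _ _ (8 * kap%:R * ln M%:R)%:E).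
      by rewrite lee_fin /v lnm4; clear -ln20; lra.
    apply: einfs0_ge; apply: (barrier_ge_log (j := j) p_lt Uy M2).
    - by clear -Mgt q2 q3; lra.
    - have i20 : i2 != i0 by rewrite eq_sym.
      have i21 : i2 != i1 by rewrite eq_sym.
      have := b2 i2 i20 i21; rewrite x_i eqxx => yr.
      have rr : 0 < 2 * rho by rewrite mulr_gt0.
      apply: le_trans (ell_ge rr yr); rewrite lee_fin.
      have : ln (2 * rho) <= ln (expR (- (4 * kap%:R * 2 ^+ j))) by rewrite ler_ln ?posrE ?expR_gt0.
      by rewrite expRK lerNr.
    - have rr : 0 < 2 * 2 ^- m :> R by rewrite mulr_gt0.
      apply: le_trans (ell_ge rr y0le); rewrite lee_fin lnM ?posrE// ln_pow2V -mR.
      have m8 : 16 <= m%:R :> R.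
        have -> : 16 = 2 ^+ 4 :> R by rewrite !exprS expr0; clear; lra.
        by rewrite mR; apply: lerXn2r; rewrite ?nnegrE.
      have := @ln2_ge_half R; clear -m8 => h2.
      by have := ler_wpM2l (_ : 0 <= m%:R - 2) h2; move=> /(_ ltac:(lra)); lra.
  rewrite /F -/y /low EFinM; apply: lee_pmul.
  - rewrite lee_fin mulr_ge0 ?exprn_ge0 ?(ltW c10)// invr_ge0.
    by rewrite mulr_ge0 ?(ltW A0)// mulr_ge0 ?powR_ge0// invr_ge0 exprn_ge0.
  - by rewrite lee_fin expR_ge0.
  - rewrite lee_fin; apply: ler_pM => //; first by rewrite exprn_ge0// ltW.
      by rewrite invr_ge0 mulr_ge0 ?(ltW A0)// mulr_ge0 ?powR_ge0// invr_ge0 exprn_ge0.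
    by apply: lerXn2r; rewrite ?nnegrE ?cabs_ge0// ltW.
  - rewrite /potential muleN oppeK -[(expR _)%:E]/(expeR ((1 + eps) * v)%:E) lee_expeR EFinM.
    by apply: lee_wpmul2l => //; rewrite lee_fin addr_ge0// ltW.
have BW : tbox B `<=` Wt by move=> t /box[].
have : (low%:E * lebesgue_planes n (tbox B) <= I%:E)%E.
  by rewrite -IE; exact: (integral_ge_cst (lebesgue_planes n) (measurable_tbox mB) BW
    (fun t _ => F0 (of_planes t)) low0 (fun t Bt => (box t Bt).2)).
rewrite volB -EFinM lee_fin => ineq.
have := volume_balance a0 e0 K0 c10 V0 m0 lm0 elm kape.
rewrite -/A -/E -/s -/v -/low => ineq2.
have : E * m%:R <= I by apply: le_trans ineq2 ineq.
have : I / E < m%:R by clear -Mgt MmR q1 q2; lra.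
by rewrite ltr_pdivrMr// mulrC ltNge => /negP.
Unshelve. all: by end_near. Qed.

End AdjointVanishes.

(** * Poles dense in the boundaries of shrinking squares *)

Section DenseInSquares.
Context {R : realType}.
Local Notation C := (Cx R).

(** The shift by 3 keeps all squares in the disc of radius [1 / 4]. *)
Definition side (i : nat) : R := 2 ^- (i + 3).

(** Rationals outside [[-1, 1]] are sent to 0, so that every code denotes a
    point of the boundary of a square. *)
Definition clamp (r : rat) : R := if `|ratr r : R| <= 1 then ratr r else 0.

(** A code is the index of a square, a relative position on an edge, and
    the choice of the edge: horizontal or vertical, on the positive or on the
    negative side. *)
Definition square_pt (c : nat * (rat * (bool * bool))) : C :=
  let: (i, (r, (horiz, pos))) := c in
  let e := if pos then side i else - side i in
  if horiz then pt (side i * clamp r) e else pt e (side i * clamp r).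

Definition square_seq (j : nat) : C :=
  if @unpickle (nat * (rat * (bool * bool)))%type j is Some c then square_pt c
  else square_pt (0%N, (0, (true, true))).

Lemma side_gt0 i : 0 < side i.
Proof. by rewrite invr_gt0 exprn_gt0. Qed.

Lemma side_le i : side i <= 1 / 8.
Proof.
have -> : 1 / 8 = 2 ^- 3 :> R by rewrite !exprS expr0; lra.
by rewrite lef_pV2 ?posrE ?exprn_gt0// ler_weXn2l ?ler1n// leq_addl.
Qed.

Lemma clamp_le r : `|clamp r| <= 1.
Proof. by rewrite /clamp; case: ifP => // _; rewrite normr0. Qed.

Lemma side_clamp i r : `|side i * clamp r| <= side i.
Proof.
rewrite normrM (gtr0_norm (side_gt0 i)) -[leRHS]mulr1.
by rewrite ler_pM2l ?side_gt0 ?clamp_le.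
Qed.

Lemma square_ptP c : exists i, [/\ `|cre (square_pt c)| <= side i,
  `|cim (square_pt c)| <= side i & `|cre (square_pt c)| = side i \/ `|cim (square_pt c)| = side i].
Proof.
case: c => i [r [hz ps]]; exists i; rewrite /square_pt.
have e : `|if ps then side i else - side i| = side i.
  by case: ps; rewrite ?normrN gtr0_norm ?side_gt0.
by case: hz; rewrite /cre /cim /= e; split => //; rewrite ?side_clamp//; [right|left].
Qed.

Lemma square_seqP j : exists i, [/\ `|cre (square_seq j)| <= side i,
  `|cim (square_seq j)| <= side i & `|cre (square_seq j)| = side i \/ `|cim (square_seq j)| = side i].
Proof. by rewrite /square_seq; case: unpickle => [c|]; exact: square_ptP. Qed.

Lemma square_seq_lt j : cabs (square_seq j) < 1 / 2.
Proof.
have [i [h1 h2 _]] := square_seqP j; have := side_le i.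
have := cabs_le (square_seq j); lra.
Qed.

Lemma square_seq_onto c : exists j, square_seq j = square_pt c.
Proof. by exists (pickle c); rewrite /square_seq pickleK. Qed.

Lemma clamp_dense (u e : R) : - 1 <= u <= 1 -> 0 < e -> exists r, `|clamp r - u| < e.
Proof.
move=> u1 e0.
have lt1 : Num.max (- 1) (u - e) < Num.min 1 (u + e).
  by rewrite gt_max !lt_min; apply/andP; split; apply/andP; split; lra.
have [r] := rat_in_itvoo lt1; rewrite in_itv /= gt_max lt_min => /andP[/andP[r1 r2] /andP[r3 r4]].
exists r; rewrite /clamp ifT; last by rewrite ler_norml; apply/andP; split; exact: ltW.
by rewrite ltr_norml; apply/andP; split; lra.
Qed.

Lemma dense_on_edges (F : C -> C) (i : nat) (r : R) : 2 * side i < r ->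
  (forall z, cabs z < r -> {for z, continuous F}) ->
  (forall j, cabs (square_seq j) < r -> F (square_seq j) = 0) ->
  on_edges (fun z => F z = 0) (- side i) (side i) (- side i) (side i).
Proof.
move=> ir cF F0; have s0 := side_gt0 i.
(* one statement for the four edges, with the booleans of [square_pt] *)
have main (t : R) (hz ps : bool) : - side i <= t <= side i ->
    F (if hz then pt t (if ps then side i else - side i)
       else pt (if ps then side i else - side i) t) = 0.
  set e := if ps then _ else _; set z := if hz then _ else _ => ti.
  have ae : `|e| = side i by rewrite /e; case: (ps); rewrite ?normrN gtr0_norm.
  have at_ : `|t| <= side i by rewrite ler_norml.
  have zr : cabs z < r.
    apply: le_lt_trans (cabs_le _) _; rewrite /z; case: (hz); rewrite /cre /cim /= ae; lra.
  apply/eqP; rewrite -cabs_eq0 eq_le cabs_ge0 andbT leNgt; apply/negP => Fz.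
  have /continuous_CxP/(_ _ Fz)[d d0 dP] := cF z zr.
  have u1 : - 1 <= t / side i <= 1.
    by rewrite -ler_norml normrM normfV (gtr0_norm s0) ler_pdivrMr// mul1r.
  have [q qP] := clamp_dense u1 (divr_gt0 d0 s0).
  have [j jE] := square_seq_onto (i, (q, (hz, ps))).
  have jz : cabs (square_seq j - z) < d.
    have -> : cabs (square_seq j - z) = `|side i * clamp q - t|.
      rewrite jE /square_pt -/e /z cabsE; case: (hz); rewrite ReB ImB /cre /cim /=.
        by rewrite subrr expr0n addr0 sqrtr_sqr.
      by rewrite subrr expr0n add0r sqrtr_sqr.
    have -> : side i * clamp q - t = side i * (clamp q - t / side i) by field; lra.
    by rewrite normrM (gtr0_norm s0) mulrC -ltr_pdivlMr.
  have jr : cabs (square_seq j) < r.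
    apply: le_lt_trans (cabs_le _) _; rewrite jE /square_pt -/e.
    by have := side_clamp i q; case: (hz); rewrite /cre /cim /= ae; lra.
  by have := dP _ jz; rewrite F0// sub0r cabsN ltxx.
split=> t ti; split.
- exact: (main t true false ti).
- exact: (main t true true ti).
- exact: (main t false false ti).
- exact: (main t false true ti).
Qed.

(** A point strictly between consecutive squares, whose half-sides are
    [side i] and [side i / 2]. *)
Definition good_pt (i : nat) : C := pt (3 / 4 * side i) 0.

Lemma side_cmp i k : side i <= side k \/ side k <= side i / 2.
Proof.
have [ik|ki] := leqP k i; [left|right].
  by rewrite /side lef_pV2 ?posrE ?exprn_gt0// ler_weXn2l ?ler1n// leq_add2r.
rewrite /side -[X in _ <= _ / X]expr1 -invfM -exprD lef_pV2 ?posrE ?exprn_gt0//.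
by rewrite ler_weXn2l ?ler1n// addn1 -addSn leq_add2r.
Qed.

Lemma good_pt_far i j : side i / 4 <= cabs (good_pt i - square_seq j).
Proof.
have s0 := side_gt0 i.
have hr := Re_le_cabs (good_pt i - square_seq j).
have hi := Im_le_cabs (good_pt i - square_seq j).
rewrite ReB in hr; rewrite ImB in hi.
have [k [h1 h2 h3]] := square_seqP j.
have gr : cre (good_pt i) = 3 / 4 * side i by [].
have gi : cim (good_pt i) = 0 by [].
rewrite gr in hr; rewrite gi sub0r normrN in hi.
have [ki|ik] := side_cmp i k; last first.
  apply: le_trans hr; rewrite ler_normr; apply/orP; left.
  by move: h1; rewrite ler_norml => /andP[_]; lra.
case: h3 => h3; last by apply: le_trans hi; rewrite h3; lra.
apply: le_trans hr; rewrite distrC; apply: le_trans (lerB_dist _ _).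
by rewrite h3 ger0_norm; lra.
Qed.

Lemma good_pt_le i : cabs (good_pt i) <= side i.
Proof.
have s0 := side_gt0 i.
apply: le_trans (cabs_le _) _; rewrite /cre /cim /= normr0 addr0 ger0_norm; lra.
Qed.

Lemma side_small (r : R) : 0 < r -> exists i, 2 * side i < r.
Proof.
move=> r0; have [k kP] : exists k : nat, 2 / r < k%:R by eexists; exact: truncnS_gt.
exists k; rewrite /side mulrC -ltr_pdivlMr// invf_plt ?posrE ?exprn_gt0 ?divr_gt0// invf_div.
apply: lt_trans kP _; rewrite -natrX ltr_nat.
by apply: leq_ltn_trans (leq_addr 3 k) _; exact: ltn_expl.
Qed.

End DenseInSquares.

(** * Non-coherence *)

Section Noncoherence.
Context {R : realType} {n : nat}.
Local Notation C := (Cx R).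
Local Notation Cn := 'rV[C]_n.

(** The section vanishes at the poles, hence on the boundary of the [i]-th
    square by density, hence inside it by Cauchy's formula. *)
Lemma sections_vanish (i0 i1 i2 : 'I_n) (alpha : R) (W : set Cn) (g : Cn -> C) (r : R) (i : nat) :
  i0 != i1 -> i0 != i2 -> i1 != i2 -> 1 < alpha ->
  holomorphic_on W g ->
  (forall y, W y -> adjoint_ideal alpha (hyperplane i0) (potential i0 i1 i2 square_seq) y g) ->
  (forall z, cabs z < r -> W (axis_pt i2 z)) -> 2 * side i < r ->
  g (axis_pt i2 (good_pt i)) = 0.
Proof.
move=> i01 i02 i12 a1 hg Mg rW ir.
pose F (z : C) := g (axis_pt i2 z).
have dF z : cabs z < r -> derivable F z 1.
  move=> zr; have -> : F = (fun s => g (0 + s *: delta_mx 0 i2)).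
    by apply/funext => s; rewrite add0r.
  by apply: differentiable_slice; rewrite add0r; apply: hg; exact: rW.
have s0 : 0 < side i :> R := side_gt0 i.
have sq (u v : R) : - side i <= u <= side i -> - side i <= v <= side i -> cabs (pt u v) < r.
  move=> us vs; apply: le_lt_trans (cabs_le _) _; rewrite /cre /cim /=.
  have : `|u| <= side i by rewrite ler_norml.
  have : `|v| <= side i by rewrite ler_norml.
  lra.
apply: (@holo_zero_edges _ F (- side i) (side i) (- side i) (side i)); try lra.
  by move=> u v us vs; apply: dF; exact: sq.
apply: dense_on_edges ir _ _; first by move=> z zr; apply: derivable_continuous; exact: dF.
move=> j jr; apply: (adjoint_vanishes i01 i02 i12 square_seq_lt a1).
by apply: Mg; exact: rW.
Qed.

(** Generators near the origin would all vanish at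
    [axis_pt i2 (good_pt i)] for [i] large, where the ideal contains 1. *)
Lemma not_coherent (i0 i1 i2 : 'I_n) (alpha : R) (V : set Cn) :
  i0 != i1 -> i0 != i2 -> i1 != i2 -> 1 < alpha -> V 0 ->
  ~ coherent_ideal V (adjoint_ideal alpha (hyperplane i0) (potential i0 i1 i2 square_seq)).
Proof.
move=> i01 i02 i12 a1 V0 [fin _].
have [W [oW W0 _ [m [g [gM gen]]]]] := fin 0 V0.
have /nbhs_rVP[r r0 rP] : nbhs (0 : Cn) W by apply: open_nbhs_nbhs.
have rW (z : C) : cabs z < r -> W (axis_pt i2 z).
  by move=> zr; apply: rP => i; rewrite axis_ptE mxE subr0; case: ifP; rewrite ?cabs0.
have [i ir] := side_small r0.
have s0 : 0 < side i :> R := side_gt0 i.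
have qr : cabs (good_pt i : C) < r.
  by apply: le_lt_trans (good_pt_le i) _; lra.
have g0 j : g j ord0 (axis_pt i2 (good_pt i)) = 0.
  have [hol sec] := gM j.
  by apply: (sections_vanish i01 i02 i12 a1 (hol ord0) sec rW ir).
have half j : cabs (square_seq j : C) <= 1 / 2 by exact/ltW/square_seq_lt.
have s8 : side i <= 1 / 8 :> R := side_le i.
have one : adjoint_ideal alpha (hyperplane i0) (potential i0 i1 i2 square_seq)
    (axis_pt i2 (good_pt i)) (fun=> 1).
  apply: (one_in_adjoint i01 i02 half a1 _ _ _ (good_pt_far i)).
  - by apply: le_lt_trans (good_pt_le i) _; lra.
  - lra.
  - lra.
have [a _ /(_ ord0) aP] := gen (axis_pt i2 (good_pt i)) (fun _ _ => 1) (rW _ qr) one.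
have := nbhs_singleton aP; rewrite big1 => [/eqP|j _]; last by rewrite g0 mulr0.
by rewrite oner_eq0.
Qed.

(** It is enough to leave [z1 = 0], since the potential is at least [- 2 ell z1]. *)
Lemma potential_finite_on_hyperplane (i0 i1 i2 : 'I_n) (p : nat -> C) : i0 != i1 ->
  exists2 x, hyperplane i0 x & potential i0 i1 i2 p x <> -oo%E.
Proof.
move=> i01; pose x : Cn := axis_pt i1 (pt (1 / 4) 0).
have c4 : cabs (pt (1 / 4) 0 : C) = 1 / 4.
  by rewrite cabsE /cre /cim /= expr0n addr0 sqrtr_sqr ger0_norm//; lra.
exists x.
  split; last by rewrite axis_ptE (negbTE i01).
  by move=> i; rewrite axis_ptE; case: ifP => _; rewrite ?cabs0 ?c4; lra.
have e14 : (ell (x 0%R i1) <= (- ln (1 / 4))%:E)%E.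
  by apply: ell_le; rewrite ?axis_ptE ?eqxx ?c4//; lra.
have : (neg_potential i0 i1 i2 p x < +oo)%E.
  rewrite /neg_potential gt_min; apply/orP; left.
  apply: (@le_lt_trans _ _ ((2 : R)%:E * (- ln (1 / 4))%:E)%E); last by rewrite -EFinM ltry.
  by apply: lee_wpmul2l => //; rewrite lee_fin.
by rewrite /potential; case: (neg_potential _ _ _ _ _).
Qed.

End Noncoherence.

Theorem theorem1p1 (R : realType) (n : nat) (hn : (3 <= n)%N) :
  exists (U : set 'rV[Cx R]_n) (phi : 'rV[Cx R]_n -> \bar R)
         (D : set 'rV[Cx R]_n),
    [/\ open U /\ U 0,
        plurisubharmonic U phi,
        smooth_divisor U D,
        (exists2 x, D x & phi x <> -oo%E)
      & forall alpha : R, 1 < alpha ->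
          ~ exists V : set 'rV[Cx R]_n,
              [/\ open V, V 0, V `<=` U
                & coherent_ideal V (adjoint_ideal alpha D phi)]].
Proof.
pose i0 : 'I_n := Ordinal (leq_trans (isT : 0 < 3)%N hn).
pose i1 : 'I_n := Ordinal (leq_trans (isT : 1 < 3)%N hn).
pose i2 : 'I_n := Ordinal (leq_trans (isT : 2 < 3)%N hn).
have i01 : i0 != i1 by [].
have i02 : i0 != i2 by [].
have i12 : i1 != i2 by [].
exists half_polydisc, (potential i0 i1 i2 square_seq), (hyperplane i0); split.
- by split; [exact: open_half_polydisc|exact: half_polydisc0].
- by apply: plurisubharmonic_potential => j; exact/ltW/square_seq_lt.
- exact: smooth_hyperplane.
- exact: potential_finite_on_hyperplane.
- by move=> alpha a1 [V [_ V0 _]]; exact: not_coherent.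
Qed.
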